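(* The set ${\cal MS}\cap\mathfrak M_{1,c}(X_1^+)$ is open and dense in $\mathfrak M_{1,c}(X_1^+)$ with respect to the wH-topology ${\cal O}$ in $\mathfrak M_{1,c}(X_1^+)$. Moreover, for each $\tau\in{\cal MS}\cap\mathfrak M_{1,c}(X_1^+)$ the following (1) and (2) hold. (1) For each $z\in\mathbb P^2\setminus\{[1:0:0]\}$ there exists a Borel subset $E^+_{\tau,z}$ of $(X_1^+)^{\mathbb Z}$ with $\tau^{\mathbb Z}(E^+_{\tau,z})=1$ such that for each $\gamma=(\gamma_j)_{j\in\mathbb Z}\in E^+_{\tau,z}$, $\gamma_{n-1}\circ\cdots\circ\gamma_0(z)\to[0:1:0]$ as $n\to\infty$; and for each $z\in\mathbb P^2\setminus\{[0:1:0]\}$ there exists a Borel subset $E^-_{\tau,z}$ of $(X_1^+)^{\mathbb Z}$ with $\tau^{\mathbb Z}(E^-_{\tau,z})=1$ such that for each $\gamma=(\gamma_j)_{j\in\mathbb Z}\in E^-_{\tau,z}$, $\gamma_{-n}^{-1}\circ\cdots\circ\gamma_{-1}^{-1}(z)\to[1:0:0]$ as $n\to\infty$. (2) For $\tau^{\mathbb Z}$-a.e. $\gamma\in(X_1^+)^{\mathbb Z}$, $J_\gamma^{\pm}=K_\gamma^{\pm}$ and $\mathrm{Leb}_4(K_\gamma^{\pm})=0$.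
   Context: $X^+$ is the set of all maps $f:\mathbb C^2\to\mathbb C^2$ of the form $f(x,y)=(y+\alpha,p(y)-\delta x)$ with $\alpha\in\mathbb C$, $\delta\in\mathbb C\setminus\{0\}$, $p$ a polynomial with $\deg p\ge2$ (polynomial automorphisms of $\mathbb C^2$); $X^-=\{f^{-1}:f\in X^+\}$. In $X^+$, $f_j=(y+\alpha_j,p_j(y)-\delta_jx)\to f=(y+\alpha,p(y)-\delta x)$ iff $\alpha_j\to\alpha$, $\delta_j\to\delta$, $\deg p_j=\deg p$ for all large $j$, and the coefficients of $p_j$ converge to those of $p$; $X^-$ has the topology making $f\mapsto f^{-1}$ a homeomorphism. $X_1^+\subset X^+$ is the subspace of maps $f(x,y)=(y+\alpha,p(y)-x)$ (i.e. $\delta=1$), with the relative topology. $\mathbb C^2\subset\mathbb P^2$ via $(x,y)\mapsto[x:y:1]$. Each $f\in X^+$ extends to a holomorphic self-map of $\mathbb P^2\setminus\{[1:0:0]\}$ and each $f\in X^-$ to one of $\mathbb P^2\setminus\{[0:1:0]\}$; they are regarded as such. $d$ is the distance on $\mathbb P^2$ induced by the Fubini--Study metric. $\mathrm{Leb}_4$ is Lebesgue measure on $\mathbb C^2\cong\mathbb R^4$. For a metric space ${\cal Y}$, $\mathfrak M_{1,c}({\cal Y})$ is the set of Borel probability measures on ${\cal Y}$ with compact topological support. The wH-topology ${\cal O}$ is the (metrizable, for separable ${\cal Y}$) topology in which $\tau_n\to\tau$ iff $\int\varphi\,d\tau_n\to\int\varphi\,d\tau$ for every bounded continuous $\varphi:{\cal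 Y}\to\mathbb C$ and $\mathrm{supp}\,\tau_n\to\mathrm{supp}\,\tau$ in the Hausdorff metric on nonempty compact subsets of ${\cal Y}$. Measures on $X_1^+$ are also regarded as measures on $X^+$. $\tau^{\mathbb Z}=\otimes_{n\in\mathbb Z}\tau$. For $\tau\in\mathfrak M_{1,c}(X^{\pm})$, $G_\tau=\{\gamma_n\circ\cdots\circ\gamma_1:n\in\mathbb N,\gamma_j\in\mathrm{supp}\,\tau\}$. For a nonempty $\Lambda\subset\mathbb P^2$, $\tau$ is mean stable on $\Lambda$ if each $f\in\mathrm{supp}\,\tau$ is defined on $\Lambda$ with $f(\Lambda)\subset\Lambda$ and there exist $n,m\in\mathbb N$, nonempty relatively open subsets $U_1,\dots,U_m$ of $\Lambda$, a nonempty compact $Q\subset\bigcup_{j=1}^mU_j$ and $c\in(0,1)$ such that: (a) for each $(\gamma_1,\dots,\gamma_n)\in(\mathrm{supp}\,\tau)^n$, $\gamma_n\circ\cdots\circ\gamma_1(\bigcup_jU_j)\subset Q$, and for each $j$ and all $x,y\in U_j$, $d(\gamma_n\circ\cdots\circ\gamma_1(x),\gamma_n\circ\cdots\circ\gamma_1(y))\le c\,d(x,y)$; (b) for each $z\in\Lambda$ there is $f_z\in G_\tau$ with $f_z(z)\in\bigcup_jU_j$. ${\cal MS}$ is the set of all $\tau\in\mathfrak M_{1,c}(X^+)$ such that $\tau$ is mean stable on $\mathbb P^2\setminus\{[1:0:0]\}$ and $\tau^{-1}$ is mean stable on $\mathbb P^2\setminus\{[0:1:0]\}$, where $\tau^{-1}\in\mathfrak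 M_{1,c}(X^-)$ is $\tau^{-1}(A)=\tau(\{f\in X^+:f^{-1}\in A\})$. For $\gamma=(\gamma_j)_{j\in\mathbb Z}\in(X^+)^{\mathbb Z}$: $K_\gamma^+=\{z\in\mathbb C^2:\{\gamma_{n-1}\circ\cdots\circ\gamma_0(z)\}_{n\ge1}\text{ is bounded in }\mathbb C^2\}$, $K_\gamma^-=\{z\in\mathbb C^2:\{\gamma_{-n}^{-1}\circ\cdots\circ\gamma_{-1}^{-1}(z)\}_{n\ge1}\text{ is bounded in }\mathbb C^2\}$, $J_\gamma^{\pm}=\partial K_\gamma^{\pm}$ (boundary in $\mathbb C^2$). *)

(* Defs.v *)
From HB Require Import structures.
From mathcomp Require Import all_boot all_order all_algebra.
From mathcomp Require Import spectral sesquilinear.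
From mathcomp Require Import all_classical all_reals all_analysis.
From mathcomp Require Import complex ring.

Set Implicit Arguments.
Unset Strict Implicit.
Unset Printing Implicit Defensive.

Import Order.TTheory GRing.Theory Num.Theory numFieldNormedType.Exports.

Local Open Scope classical_set_scope.
Local Open Scope ring_scope.

Section HermitianAngle.
Variables (C : numClosedFieldType) (n : nat).
Implicit Types u v w : 'rV[C]_n.

Local Notation "''[' u , v ]" := (dotmx u v) : ring_scope.
Local Notation "''[' u ]" := '[u, u] : ring_scope.

Definition cosangle u v : C := `|'[u, v]| / (sqrtC '[u] * sqrtC '[v]).

Lemma sqrt_dot_gt0 u : u != 0 -> 0 < sqrtC '[u].
Proof. by move=> u0; rewrite sqrtC_gt0 dnorm_gt0. Qed.

Lemma cosangle_ge0 u v : 0 <= cosangle u v.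
Proof. by rewrite divr_ge0// mulr_ge0// sqrtC_ge0; exact: dnorm_ge0. Qed.

Lemma cosangle_le1 u v : u != 0 -> v != 0 -> cosangle u v <= 1.
Proof.
move=> u0 v0; rewrite ler_pdivrMr ?mul1r; first exact: CauchySchwarz_sqrt.
by rewrite mulr_gt0// sqrt_dot_gt0.
Qed.

Lemma dotmx_conj u v : '[u, v] = ('[v, u])^*.
Proof. by rewrite hermC/= expr0 mul1r. Qed.

Lemma cosangleC u v : cosangle u v = cosangle v u.
Proof. by rewrite /cosangle dotmx_conj norm_conjC [_ * sqrtC _]mulrC. Qed.

Lemma cosanglexx u : u != 0 -> cosangle u u = 1.
Proof.
move=> u0; rewrite /cosangle -expr2 sqrtCK.
by rewrite ger0_norm ?dnorm_ge0// divff// dnorm_eq0.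
Qed.

Lemma cosangle1 u v : u != 0 -> v != 0 -> cosangle u v = 1 ->
  <[u]>%VS = <[v]>%VS.
Proof.
move=> u0 v0.
have uv0 : sqrtC '[u] * sqrtC '[v] != 0.
  by rewrite mulf_neq0// gt_eqF// sqrt_dot_gt0.
move/(canRL (mulfVK uv0)); rewrite mul1r => /eqP.
rewrite CauchySchwarz_sqrt free_cons span_seq1 seq1_free v0 andbT negbK.
move=> /vlineP[c uE].
have c0 : c != 0 by apply: contraNneq u0 => c0; rewrite uE c0 scale0r.
apply/eqP; rewrite eqEsubv -!memvE {1}uE memvZ ?memv_line//=.
by apply/vlineP; exists c^-1; rewrite uE scalerA mulVf// scale1r.
Qed.

Lemma cosangle_unit u v : u != 0 -> v != 0 ->
  cosangle u v = `|'[(sqrtC '[u])^-1 *: u, (sqrtC '[v])^-1 *: v]|.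
Proof.
move=> u0 v0; rewrite /cosangle linearZl_LR/= linearZr_LR/= !normrM normfV.
rewrite norm_conjC normfV !(gtr0_norm (sqrt_dot_gt0 _))//.
by rewrite invfM [LHS]mulrC mulrA.
Qed.

Lemma dot_unit u : u != 0 -> '[(sqrtC '[u])^-1 *: u] = 1.
Proof.
move=> u0; rewrite linearZl_LR/= linearZr_LR/= geC0_conj; last first.
  by rewrite invr_ge0 ltW// sqrt_dot_gt0.
by rewrite mulrA -expr2 exprVn sqrtCK mulVf// dnorm_eq0.
Qed.

Lemma unit_triangle u v w : '[u] = 1 -> '[v] = 1 -> '[w] = 1 ->
  exists t : C, [/\ 0 <= t,
    t ^+ 2 <= (1 - `|'[u, v]| ^+ 2) * (1 - `|'[v, w]| ^+ 2) &
    `|'[u, v]| * `|'[v, w]| <= `|'[u, w]| + t].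
Proof.
move=> uu vv ww.
pose u2 := u - '[u, v] *: v; pose w2 := w - '[w, v] *: v.
have u2v : '[u2, v] = 0 by rewrite linearBl/= linearZl_LR/= vv mulr1 subrr.
have w2v : '[w2, v] = 0 by rewrite linearBl/= linearZl_LR/= vv mulr1 subrr.
have vu2 : '[v, u2] = 0 by rewrite dotmx_conj u2v rmorph0.
have vw2 : '[v, w2] = 0 by rewrite dotmx_conj w2v rmorph0.
have uwE : '[u, w] = '[u2, w2] + '[u, v] * '[v, w].
  rewrite [in RHS]linearBl/= linearZl_LR/= vw2 mulr0 subr0.
  by rewrite linearBr/= linearZr_LR/= -dotmx_conj mulrC subrK.
have u2E : '[u2] = 1 - `|'[u, v]| ^+ 2.
  rewrite {1}/u2 linearBl/= linearZl_LR/= vu2 mulr0 subr0 linearBr/=.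
  by rewrite linearZr_LR/= uu normCK mulrC.
have w2E : '[w2] = 1 - `|'[v, w]| ^+ 2.
  rewrite {1}/w2 linearBl/= linearZl_LR/= vw2 mulr0 subr0 linearBr/=.
  by rewrite linearZr_LR/= ww normCK -!dotmx_conj.
exists `|'[u2, w2]|; split=> //; first by rewrite -u2E -w2E CauchySchwarz.
rewrite -normrM uwE -[X in `|X| <= _](addKr '[u2, w2]) addrC.
by rewrite (le_trans (ler_normB _ _)).
Qed.

Lemma cosangle_triangle u v w : u != 0 -> v != 0 -> w != 0 ->
  exists t : C, [/\ 0 <= t,
    t ^+ 2 <= (1 - cosangle u v ^+ 2) * (1 - cosangle v w ^+ 2) &
    cosangle u v * cosangle v w <= cosangle u w + t].
Proof.
move=> u0 v0 w0; rewrite !cosangle_unit//.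
by apply: unit_triangle; rewrite dot_unit.
Qed.

End HermitianAngle.

HB.instance Definition _ (R : realType) := NormedModule.copy R[i] R[i]^o.

Definition P2 (R : realType) : Type :=
  {L : {vspace 'rV[R[i]]_3} | \dim L == 1%N}.

HB.instance Definition _ (R : realType) := SubChoice.on (P2 R).

Section ProjectivePlane.
Context {R : realType}.
Local Notation C := R[i].
Implicit Types (L M N : P2 R) (u v w : 'rV[C]_3).

Definition rep L : 'rV[C]_3 := vpick (val L).

Definition hvec (x y z : C) : 'rV[C]_3 := \row_j [:: x; y; z]`_j.

Lemma hvec_neq0 (x y z : C) :
  (hvec x y z != 0) = [|| x != 0, y != 0 | z != 0].
Proof.
rewrite -[RHS]negbK !negb_or !negbK; congr (~~ _).
apply/eqP/and3P => [/rowP h|[/eqP-> /eqP-> /eqP->]].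
  have := h (inord 0); have := h (inord 1); have := h (inord 2).
  by rewrite !mxE !inordK//= => -> -> ->.
by apply/rowP => -[[|[|[|//]]] ?]; rewrite !mxE.
Qed.

Fact dim_line1 : \dim <[(hvec 1 0 0)%R]>%VS == 1%N.
Proof. by rewrite dim_vline hvec_neq0 oner_eq0. Qed.

(* The point [x : y : z]; the value at x = y = z = 0 is irrelevant. *)
Definition hpoint (x y z : C) : P2 R :=
  insubd (exist (fun L : {vspace 'rV[C]_3} => \dim L == 1%N) _ dim_line1 : P2 R)
    <[hvec x y z]>%VS.

Lemma val_hpoint (x y z : C) : hvec x y z != 0 ->
  val (hpoint x y z) = <[hvec x y z]>%VS.
Proof. by move=> n0; rewrite val_insubd dim_vline n0. Qed.

Lemma rep_neq0 L : rep L != 0.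
Proof.
rewrite /rep vpick0; apply/eqP => L0.
by have := valP L; rewrite /= L0 dimv0.
Qed.

Lemma val_rep L : val L = <[rep L]>%VS.
Proof.
apply/eqP; rewrite eq_sym eqEdim -memvE memv_pick/= dim_vline rep_neq0.
by have /eqP -> := valP L.
Qed.

Lemma rep_hpoint (x y z : C) : hvec x y z != 0 ->
  exists2 c, c != 0 & rep (hpoint x y z) = c *: hvec x y z.
Proof.
move=> n0; have := memv_pick (val (hpoint x y z)).
rewrite val_hpoint// => /vlineP[c rE]; exists c => //.
  apply/eqP => c0; have := rep_neq0 (hpoint x y z).
  by rewrite /rep val_hpoint// rE c0 scale0r eqxx.
by rewrite /rep val_hpoint.
Qed.

Lemma hpoint_scale (c x y z : C) : c != 0 ->
  hpoint (c * x) (c * y) (c * z) = hpoint x y z.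
Proof.
move=> c0; congr (insubd _ _).
have -> : hvec (c * x) (c * y) (c * z) = c *: hvec x y z.
  by apply/rowP => -[[|[|[|//]]] ?]; rewrite !mxE.
apply/eqP; rewrite eqEsubv -!memvE memvZ ?memv_line//=.
by apply/vlineP; exists c^-1; rewrite scalerA mulVf// scale1r.
Qed.

(* Distance of the Fubini-Study metric (with the normalization for which
   complex lines have diameter pi / 2). *)
Definition fubini_study L M : R :=
  acos (complex.Re (cosangle (rep L) (rep M))).

Lemma Re_cosangle L M :
  (complex.Re (cosangle (rep L) (rep M)))%:C%C = cosangle (rep L) (rep M).
Proof. by apply: RRe_real; apply: ger0_real; exact: cosangle_ge0. Qed.

Lemma fubini_studyxx L : fubini_study L L = 0.
Proof. by rewrite /fubini_study cosanglexx ?rep_neq0//= acos1. Qed.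

Lemma cosangle_itv L M : -1 <= complex.Re (cosangle (rep L) (rep M)) <= 1.
Proof.
have ge0 : 0 <= complex.Re (cosangle (rep L) (rep M)).
  by rewrite -(@lecR R) Re_cosangle; exact: cosangle_ge0.
rewrite (le_trans _ ge0) ?oppr_le0//= -(@lecR R) Re_cosangle.
by apply: cosangle_le1; exact: rep_neq0.
Qed.

Lemma fubini_study_positivity L M : fubini_study L M = 0 -> L = M.
Proof.
move=> /(congr1 cos); rewrite cos0 acosK ?in_itv/= ?cosangle_itv// => h.
apply/val_inj; rewrite !val_rep; apply: cosangle1; rewrite ?rep_neq0//.
by rewrite -Re_cosangle h.
Qed.

Lemma fubini_study_sym L M : fubini_study L M = fubini_study M L.
Proof. by rewrite /fubini_study cosangleC. Qed.

Lemma acos_triangle (a b c r : R) :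
  -1 <= a <= 1 -> -1 <= b <= 1 -> -1 <= c <= 1 -> 0 <= r ->
  r ^+ 2 <= (1 - a ^+ 2) * (1 - b ^+ 2) -> a * b <= c + r ->
  acos c <= acos a + acos b.
Proof.
move=> a1 b1 c1 r0 r2 abc.
have [le_pi|/ltW ge_pi] := leP (acos a + acos b) pi; last first.
  exact: le_trans (acos_lepi c1) ge_pi.
rewrite leNgt -ltr_cos ?in_itv/= ?acos_ge0 ?acos_lepi ?addr_ge0 ?acos_ge0//.
rewrite -leNgt cosD !acosK ?in_itv//= !sin_acos//.
have a2 : 0 <= 1 - a ^+ 2.
  by rewrite subr_ge0 -real_normK ?num_real// expr_le1// ler_norml.
rewrite -sqrtrM// lerBlDr (le_trans abc)// lerD2l -(ger0_norm r0) -sqrtr_sqr.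
by rewrite ler_wsqrtr.
Qed.

Lemma acos_triangleC (a b c t : C) :
  (complex.Re a)%:C%C = a -> (complex.Re b)%:C%C = b ->
  (complex.Re c)%:C%C = c ->
  -1 <= complex.Re a <= 1 -> -1 <= complex.Re b <= 1 ->
  -1 <= complex.Re c <= 1 -> 0 <= t ->
  t ^+ 2 <= (1 - a ^+ 2) * (1 - b ^+ 2) -> a * b <= c + t ->
  acos (complex.Re c) <= acos (complex.Re a) + acos (complex.Re b).
Proof.
move=> <- <- <- /= a1 b1 c1 t0.
have <- : (complex.Re t)%:C%C = t by apply: RRe_real; exact: ger0_real.
rewrite -rmorphM -rmorphD lecR => t2 abc.
apply: acos_triangle abc => //; first by rewrite -lecR RRe_real// ger0_real.
by rewrite -lecR rmorphXn rmorphM/= !rmorphB/= !rmorphXn/= rmorph1.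
Qed.

Lemma fubini_study_triangle M L N :
  fubini_study L N <= fubini_study L M + fubini_study M N.
Proof.
have [t [t0]] := cosangle_triangle (rep_neq0 L) (rep_neq0 M) (rep_neq0 N).
by apply: acos_triangleC => //; [exact: Re_cosangle|exact: Re_cosangle|
  exact: Re_cosangle|exact: cosangle_itv|exact: cosangle_itv|
  exact: cosangle_itv].
Qed.

End ProjectivePlane.

HB.instance Definition _ (R : realType) := @isMetric.Build R (P2 R)
  (@fubini_study R) (@fubini_studyxx R) (@fubini_study_positivity R)
  (@fubini_study_sym R) (@fubini_study_triangle R).

Section ComplexModulus.
Context {R : realType}.
Local Notation C := R[i].

Definition cnorm (z : C) : R := complex.Re `|z|.

Lemma cnormE z : (cnorm z)%:C%C = `|z|.
Proof. by rewrite RRe_real// normr_real. Qed.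

Lemma cnorm_ge0 z : 0 <= cnorm z.
Proof. by rewrite -(@lecR R) cnormE; exact: normr_ge0. Qed.

Lemma cnorm0 : cnorm 0 = 0.
Proof. by apply: (@complexI R); rewrite cnormE normr0. Qed.

Lemma cnormB z t : cnorm (z - t) = cnorm (t - z).
Proof. by rewrite /cnorm distrC. Qed.

Lemma cnorm_triangle t z w : cnorm (z - w) <= cnorm (z - t) + cnorm (t - w).
Proof. by rewrite -lecR rmorphD/= !cnormE ler_distD. Qed.

End ComplexModulus.

(* [Henon alpha delta p] encodes the map (x, y) |-> (y + alpha, p(y) - delta x);
   the triple is determined by the map, see [henon_inj]. *)
Record Xplus (R : realType) := Henon {
  hshift : R[i];
  hjac : R[i];
  hpoly : {poly R[i]};
  hjac_neq0 : hjac != 0;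
  hpoly_deg : (2 < size hpoly)%N
}.

Section Henon.
Context {R : realType}.
Local Notation C := R[i].
Implicit Types (f g : Xplus R) (z : C * C).

Definition henon f z : C * C :=
  (z.2 + hshift f, (hpoly f).[z.2] - hjac f * z.1).

Definition henon_inv f z : C * C :=
  (((hpoly f).[z.1 - hshift f] - z.2) / hjac f, z.1 - hshift f).

Lemma henonK f : cancel (henon f) (henon_inv f).
Proof.
case=> x y; rewrite /henon /henon_inv /= addrK subKr mulrC mulKf//.
exact: hjac_neq0.
Qed.

Lemma henon_invK f : cancel (henon_inv f) (henon f).
Proof.
case=> x y; rewrite /henon /henon_inv /= subrK mulrC mulfVK ?subKr//.
exact: hjac_neq0.
Qed.

Lemma Xplus_eq f g : hshift f = hshift g -> hjac f = hjac g ->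
  hpoly f = hpoly g -> f = g.
Proof.
case: f g => [a d p d0 p2] [a' d' p' d0' p2'] /= aa dd pp; subst a' d' p'.
by congr Henon; exact: bool_irrelevance.
Qed.

Lemma henon_inj : injective henon.
Proof.
move=> f g fg; apply: Xplus_eq.
- by have /(congr1 fst)/= := congr1 (@^~ (0, 0)) fg; rewrite !add0r.
- have /(congr1 snd)/= := congr1 (@^~ (1, 0)) fg; rewrite !mulr1.
  have /(congr1 snd)/= := congr1 (@^~ (0, 0)) fg; rewrite !mulr0 !subr0.
  by move=> -> /addrI/oppr_inj.
- apply/eqP; rewrite -subr_eq0; apply/eqP.
  pose s := [seq n%:R : C | n <- iota 0 (size (hpoly f - hpoly g))].
  apply: (@roots_geq_poly_eq0 _ _ s).
  + apply/allP => y _; rewrite rootE hornerD hornerN subr_eq0; apply/eqP.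
    have /(congr1 snd)/= := congr1 (@^~ (0, y)) fg.
    by rewrite !mulr0 !subr0.
  + by rewrite map_inj_uniq ?iota_uniq// => m n /eqP; rewrite eqr_nat => /eqP.
  + by rewrite size_map size_iota.
Qed.

End Henon.

HB.instance Definition _ (R : realType) := gen_eqMixin (Xplus R).
HB.instance Definition _ (R : realType) := gen_choiceMixin (Xplus R).

Section XplusTopology.
Context {R : realType}.
Local Notation C := R[i].
Implicit Types f g h : Xplus R.

(* The metric is the maximum of the distances of the parameters, with maps of
   different degrees at infinite distance. *)
Definition hball f (e : R) g : Prop :=
  [/\ size (hpoly f) = size (hpoly g),
      cnorm (hshift f - hshift g) < e,
      cnorm (hjac f - hjac g) < e &
      forall i, cnorm ((hpoly f)`_i - (hpoly g)`_i) < e].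

Lemma hball_center f e : 0 < e -> hball f e f.
Proof. by move=> e0; split=> // [||i]; rewrite subrr cnorm0. Qed.

Lemma hball_sym f g e : hball f e g -> hball g e f.
Proof. by case=> s a d p; split=> // [||i]; rewrite cnormB. Qed.

Lemma hball_triangle f g h e1 e2 :
  hball f e1 g -> hball g e2 h -> hball f (e1 + e2) h.
Proof.
move=> [s1 a1 d1 p1] [s2 a2 d2 p2]; split=> [|||i]; first by rewrite s1.
- exact: le_lt_trans (cnorm_triangle (hshift g) _ _) (ltrD _ _).
- exact: le_lt_trans (cnorm_triangle (hjac g) _ _) (ltrD _ _).
- exact: le_lt_trans (cnorm_triangle ((hpoly g)`_i) _ _) (ltrD (p1 i) (p2 i)).
Qed.

End XplusTopology.

HB.instance Definition _ (R : realType) :=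
  hasNbhs.Build (Xplus R) (nbhs_ (entourage_ (@hball R))).
HB.instance Definition _ (R : realType) :=
  @Nbhs_isPseudoMetric.Build R (Xplus R) (entourage_ (@hball R)) erefl
    (@hball R) (@hball_center R) (@hball_sym R) (@hball_triangle R) erefl.

Fact henon2_subproof (R : realType) : (2 < size ('X^2 : {poly R[i]}))%N.
Proof. by rewrite size_polyXn. Qed.

HB.instance Definition _ (R : realType) := isPointed.Build (Xplus R)
  (Henon 0 (oner_neq0 _) (henon2_subproof R)).

Section XplusConvergence.
Context {R : realType}.

Lemma near_cnormP T (F : set_system T) {FF : Filter F} (u : T -> R[i]) (l : R[i]) :
  u @ F --> l <-> forall e : R, 0 < e -> \forall n \near F, cnorm (l - u n) < e.
Proof.
split=> [/cvgrPdist_lt ul e e0|ul].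
  have : 0 < e%:C%C :> R[i] by rewrite ltcR.
  move=> /ul; apply: filterS => n; by rewrite -cnormE ltcR.
apply/cvgrPdist_lt => e e0; have eR : e = (complex.Re e)%:C%C.
  by rewrite RRe_real// gtr0_real.
have := ul (complex.Re e); rewrite -(@ltcR R) -eR => /(_ e0).
by apply: filterS => n; rewrite -cnormE [in X in _ -> X]eR ltcR.
Qed.

Lemma Xplus_cvgP (f_ : nat -> Xplus R) (f : Xplus R) :
  f_ n @[n --> \oo] --> f <->
  [/\ hshift (f_ n) @[n --> \oo] --> hshift f,
      hjac (f_ n) @[n --> \oo] --> hjac f,
      \forall n \near \oo, size (hpoly (f_ n)) = size (hpoly f) &
      forall i, (hpoly (f_ n))`_i @[n --> \oo] --> (hpoly f)`_i].
Proof.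
split=> [/cvg_ballP ff|[a d s p]].
  split=> [|||i].
  - apply/near_cnormP => e /ff; apply: filterS => n; by case.
  - apply/near_cnormP => e /ff; apply: filterS => n; by case.
  - by have /ff := @ltr01 R; apply: filterS => n; case.
  - by apply/near_cnormP => e /ff; apply: filterS => n; case.
apply/cvg_ballP => e e0.
have small : \forall n \near \oo, forall i : 'I_(size (hpoly f)),
    cnorm ((hpoly f)`_i - (hpoly (f_ n))`_i) < e.
  by apply: filter_forall => i; have /near_cnormP := p i; exact.
move/near_cnormP : a => /(_ e e0) a; move/near_cnormP : d => /(_ e e0) d.
near=> n.
have sn : size (hpoly (f_ n)) = size (hpoly f) by near: n.
split=> [|||i]; first exact/esym.
- by near: n.
- by near: n.
have [li|il] := ltnP i (size (hpoly f)).
  suff : forall i : 'I_(size (hpoly f)),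
    cnorm ((hpoly f)`_i - (hpoly (f_ n))`_i) < e by move/(_ (Ordinal li)).
  by near: n.
by rewrite !nth_default ?sn// subrr cnorm0.
Unshelve. all: by end_near. Qed.

End XplusConvergence.

Record Xminus (R : realType) := Xinv { Xinv_of : Xplus R }.

Section XminusChoice.
Variable R : realType.
Lemma Xinv_ofK : cancel (@Xinv_of R) (@Xinv R). Proof. by case. Qed.
HB.instance Definition _ := Choice.copy (Xminus R) (can_type Xinv_ofK).
End XminusChoice.

(* [Xinv f] stands for f^-1 and the topology makes [Xinv] a homeomorphism. *)
HB.instance Definition _ (R : realType) :=
  PseudoMetric.copy (Xminus R) (initial_topology (@Xinv_of R)).
HB.instance Definition _ (R : realType) :=
  isPointed.Build (Xminus R) (Xinv point).

Definition Xplus1 (R : realType) : Type :=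
  set_type [set f : Xplus R | hjac f = 1].

HB.instance Definition _ (R : realType) := PseudoMetric.on (Xplus1 R).

Definition Xplus1_val (R : realType) : Xplus1 R -> Xplus R := set_val.

Fact Xplus1_point_subproof (R : realType) :
  (point : Xplus R) \in [set f : Xplus R | hjac f = 1].
Proof. exact/mem_set. Qed.

HB.instance Definition _ (R : realType) := isPointed.Build (Xplus1 R)
  (exist (fun f => f \in [set f : Xplus R | hjac f = 1]) point
    (Xplus1_point_subproof R)).

Section Extension.
Context {R : realType}.
Local Notation C := R[i].
Implicit Types (f : Xplus R) (w : C * C) (L : P2 R).

Definition embed w : P2 R := hpoint w.1 w.2 1.

Definition homogenize (p : {poly C}) (y z : C) : C :=
  \sum_(i < size p) p`_i * y ^+ i * z ^+ ((size p).-1 - i).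

(* The extensions of f and of f^-1 to P2, in homogeneous coordinates of degree
   d = deg p.  The value at the single point where all three coordinates
   vanish ([1:0:0] for f, [0:1:0] for f^-1) is irrelevant. *)
Definition extend f L : P2 R :=
  let v := rep L in let x := v 0 0 in let y := v 0 1 in let z := v 0 2%:R in
  let d := (size (hpoly f)).-1 in
  hpoint (z ^+ d.-1 * (y + hshift f * z))
         (homogenize (hpoly f) y z - hjac f * x * z ^+ d.-1)
         (z ^+ d).

Definition extend_inv f L : P2 R :=
  let v := rep L in let x := v 0 0 in let y := v 0 1 in let z := v 0 2%:R in
  let d := (size (hpoly f)).-1 in
  let x' := x - hshift f * z in
  hpoint ((homogenize (hpoly f) x' z - y * z ^+ d.-1) / hjac f)
         (z ^+ d.-1 * x')
         (z ^+ d).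

Lemma hvecE (x y z : C) : (hvec x y z 0 0 = x) * (hvec x y z 0 1 = y) *
  (hvec x y z 0 2%:R = z).
Proof. by rewrite !mxE. Qed.

Lemma homogenize_scale p (c y : C) :
  homogenize p (c * y) c = c ^+ (size p).-1 * p.[y].
Proof.
rewrite horner_coef mulr_sumr; apply: eq_bigr => i _.
have ip : (i <= (size p).-1)%N.
  by rewrite -ltnS prednK ?(leq_ltn_trans _ (ltn_ord i)).
by rewrite -[in RHS](subnKC ip) exprD exprMn; ring.
Qed.

Lemma homogenize0 p (y : C) :
  homogenize p y 0 = lead_coef p * y ^+ (size p).-1.
Proof.
rewrite /homogenize lead_coefE; case: (size p) (size_poly_eq0 p) => [|n] /esym.
  by move=> /eqP->; rewrite big_ord0 coef0 mul0r.
move=> _; rewrite big_ord_recr/= subnn mulr1 big1 ?add0r// => i _.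
by rewrite expr0n subn_eq0 leqNgt ltn_ord mulr0.
Qed.

Lemma hpolyS f : (size (hpoly f)).-1 = (size (hpoly f)).-2.+1.
Proof. by have := hpoly_deg f; case: size => [|[|]]. Qed.

Lemma rep_embed w : exists2 c, c != 0 & rep (embed w) = c *: hvec w.1 w.2 1.
Proof. by apply: rep_hpoint; rewrite hvec_neq0 oner_eq0 !orbT. Qed.

Lemma extend_embed f w : extend f (embed w) = embed (henon f w).
Proof.
rewrite /extend; have [c c0 ->] := rep_embed w; rewrite !mxE/= mulr1.
rewrite homogenize_scale /embed /=.
rewrite -[RHS](@hpoint_scale _ (c ^+ (size (hpoly f)).-1)) ?expf_neq0//.
rewrite hpolyS /= exprSr; move: (c ^+ _) => a.
by congr hpoint; ring.
Qed.

Lemma extend_inv_embed f w : extend_inv f (embed w) = embed (henon_inv f w).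
Proof.
rewrite /extend_inv; have [c c0 ->] := rep_embed w; rewrite !mxE/= mulr1.
have -> : c * w.1 - hshift f * c = c * (w.1 - hshift f) by ring.
rewrite homogenize_scale /embed /=.
rewrite -[RHS](@hpoint_scale _ (c ^+ (size (hpoly f)).-1)) ?expf_neq0//.
rewrite hpolyS /= exprSr; move: (c ^+ _) => a.
by congr hpoint; ring.
Qed.

Lemma extend_infinity f (x y : C) : y != 0 ->
  extend f (hpoint x y 0) = hpoint 0 1 0.
Proof.
move=> y0; rewrite /extend.
have [c c0 ->] := @rep_hpoint _ x y 0 ltac:(by rewrite hvec_neq0 y0 orbT).
rewrite !mxE/= mulr0 homogenize0 hpolyS !expr0n/=.
have s3 := hpoly_deg f.
have -> : ((size (hpoly f)).-2 == 0)%N = false by case: size s3 => [|[|[|]]].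
rewrite mul0r mulr0 subr0; set a := _ * _; rewrite -[RHS](@hpoint_scale _ a) ?mulr0 ?mulr1//.
by rewrite mulf_neq0 ?expf_neq0 ?mulf_neq0// lead_coef_eq0 -size_poly_gt0
  (ltn_trans _ s3).
Qed.

Lemma extend_inv_infinity f (x y : C) : x != 0 ->
  extend_inv f (hpoint x y 0) = hpoint 1 0 0.
Proof.
move=> x0; rewrite /extend_inv.
have [c c0 ->] := @rep_hpoint _ x y 0 ltac:(by rewrite hvec_neq0 x0).
rewrite !mxE/= !mulr0 subr0 homogenize0 hpolyS !expr0n/=.
have s3 := hpoly_deg f.
have -> : ((size (hpoly f)).-2 == 0)%N = false by case: size s3 => [|[|[|]]].
rewrite mul0r mulr0 subr0; set a := _ / _; rewrite -[RHS](@hpoint_scale _ a) ?mulr0 ?mulr1//.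
rewrite mulf_neq0 ?invr_eq0 ?hjac_neq0// mulf_neq0 ?expf_neq0 ?mulf_neq0//.
by rewrite lead_coef_eq0 -size_poly_gt0 (ltn_trans _ s3).
Qed.

End Extension.

Definition borel (Y : ptopologicalType) : Type := g_sigma_algebraType (@open Y).

HB.instance Definition _ (Y : ptopologicalType) := Measurable.on (borel Y).

Definition tsupp (R : realType) (Y : ptopologicalType)
    (mu : probability (borel Y) R) : set Y :=
  [set y | forall U : set Y, open U -> U y -> (0 < mu U)%E].

Record M1c (R : realType) (Y : ptopologicalType) := MkM1c {
  law :> probability (borel Y) R;
  compact_tsupp : compact (tsupp law)
}.

HB.instance Definition _ (R : realType) (Y : ptopologicalType) :=
  gen_eqMixin (M1c R Y).
HB.instance Definition _ (R : realType) (Y : ptopologicalType) :=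
  gen_choiceMixin (M1c R Y).

Section Integral.
Context {R : realType} {Y : ptopologicalType}.

Definition cintegral (mu : probability (borel Y) R) (phi : Y -> R[i]) : R[i] :=
  (\int[mu]_y complex.Re (phi y) +i* \int[mu]_y complex.Im (phi y))%C.

Definition Cb : Type :=
  set_type [set phi : Y -> R[i] | continuous phi /\ bounded_fun phi].

End Integral.
Arguments Cb : clear implicits.

(* Subsets of Y with the Hausdorff distance as an extended pseudometric; on
   nonempty compact subsets it is the Hausdorff metric. *)
Definition hset (Y : Type) : Type := set Y.

Section Hausdorff.
Context {R : realType} {Y : pseudoMetricType R}.
Implicit Types A B D : hset Y.

HB.instance Definition _ := gen_eqMixin (hset Y).
HB.instance Definition _ := gen_choiceMixin (hset Y).

Definition hausdorff_ball A (e : R) B : Prop :=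
  exists e', [/\ 0 < e', e' < e,
    forall a, A a -> exists2 b, B b & ball a e' b &
    forall b, B b -> exists2 a, A a & ball a e' b].

Lemma hausdorff_ball_center A e : 0 < e -> hausdorff_ball A e A.
Proof.
move=> e0; exists (e / 2).
have e20 : 0 < e / 2 by rewrite divr_gt0.
split=> // [|a Aa|a Aa]; first by rewrite ltr_pdivrMr// ltr_pMr// ltr1n.
  by exists a => //; exact: ballxx.
by exists a => //; exact: ballxx.
Qed.

Lemma hausdorff_ball_sym A B e : hausdorff_ball A e B -> hausdorff_ball B e A.
Proof.
move=> [e' [e0 ee AB BA]]; exists e'; split=> // [b /BA|a /AB] [x ? ?].
  by exists x => //; exact: ball_sym.
by exists x => //; exact: ball_sym.
Qed.

Lemma hausdorff_ball_triangle A B D e1 e2 :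
  hausdorff_ball A e1 B -> hausdorff_ball B e2 D ->
  hausdorff_ball A (e1 + e2) D.
Proof.
move=> [d1 [d10 de1 AB BA]] [d2 [d20 de2 BD DB]]; exists (d1 + d2).
split; [exact: addr_gt0|exact: ltrD|..].
  by move=> a /AB[b /BD[d Dd bd] ab]; exists d => //; exact: ball_triangle ab bd.
by move=> d /DB[b /BA[a Aa ab] bd]; exists a => //; exact: ball_triangle ab bd.
Qed.

HB.instance Definition _ :=
  hasNbhs.Build (hset Y) (nbhs_ (entourage_ hausdorff_ball)).
HB.instance Definition _ := @Nbhs_isPseudoMetric.Build R (hset Y)
  (entourage_ hausdorff_ball) erefl hausdorff_ball hausdorff_ball_center
  hausdorff_ball_sym hausdorff_ball_triangle erefl.

End Hausdorff.

(* The wH-topology: the coarsest topology making tau |-> \int phi dtau, for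
   every bounded continuous phi, and tau |-> supp tau continuous.  Its
   convergent sequences are described by [wH_cvgP]. *)
Section WH.
Context {R : realType} {Y : pseudoPMetricType R}.

Definition wH_map (tau : M1c R Y) : {ptws (Cb R Y) -> R[i]} * hset Y :=
  (fun phi => cintegral tau (set_val phi), tsupp tau).

HB.instance Definition _ :=
  Topological.copy (M1c R Y) (initial_topology wH_map).

Lemma initial_cvgP (S : choiceType) (T : topologicalType) (f : S -> T)
    (F : set_system S) {FF : Filter F} (s : S) :
  F --> (s : initial_topology f) <-> f @ F --> f s.
Proof.
split=> [Fs U /= /(@initial_continuous _ _ f s)|fFs U]; first exact: Fs.
rewrite nbhsE => -[V [[W oW <-] Wfs] VU].
by apply: filterS VU _; apply: fFs; exact: open_nbhs_nbhs.
Qed.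

Lemma prod_cvgP (I : Type) (T : topologicalType) (F : set_system (I -> T))
    {FF : Filter F} (f : {ptws I -> T}) :
  F --> f <-> forall i, (fun g : I -> T => g i) @ F --> f i.
Proof.
split=> [/cvg_sup Ff i|Ff]; first by have /initial_cvgP := Ff i; exact.
by apply/cvg_sup => i; apply/initial_cvgP; exact: Ff.
Qed.

Lemma wH_cvgP (tau_ : nat -> M1c R Y) (tau : M1c R Y) :
  tau_ n @[n --> \oo] --> tau <->
  (forall phi : Y -> R[i], continuous phi -> bounded_fun phi ->
     cintegral (tau_ n) phi @[n --> \oo] --> cintegral tau phi) /\
  (tsupp (tau_ n) : hset Y) @[n --> \oo] --> (tsupp tau : hset Y).
Proof.
pose G := (wH_map \o tau_) @ \oo.
split=> [/initial_cvgP tt|[tphi ts]].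
  have {}tt : G --> wH_map tau by exact: tt.
  split=> [phi cphi bphi|].
    have /prod_cvgP : (fst \o (wH_map \o tau_)) n @[n --> \oo] -->
        (wH_map tau).1.
      by apply: (cvg_comp _ _ tt); exact: cvg_fst.
    move=> /(_ (exist (fun g => g \in [set g | continuous g /\ bounded_fun g])
      phi (mem_set (conj cphi bphi)))); exact.
  have : (snd \o (wH_map \o tau_)) n @[n --> \oo] --> (wH_map tau).2.
    by apply: (cvg_comp _ _ tt); exact: cvg_snd.
  exact.
apply/initial_cvgP.
suff : G --> wH_map tau by exact.
have tp : (fst \o (wH_map \o tau_)) n @[n --> \oo] --> (wH_map tau).1.
  apply/prod_cvgP => -[phi phiP].
  by have [cphi bphi] := set_mem phiP; exact: tphi.
exact: cvg_pair tp ts.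
Qed.

End WH.

Section Pushforward.
Context {R : realType} {Y Z : ptopologicalType}.

Definition closed_embedding (f : Y -> Z) : Prop :=
  [/\ continuous f, closed (range f) &
      forall U, open U -> exists2 V, open V & f @^-1` V = U].

Variable f : Y -> Z.
Hypothesis fE : closed_embedding f.

Lemma closed_embedding_measurable :
  measurable_fun setT (f : borel Y -> borel Z).
Proof.
have [fc _ _] := fE.
apply: (@measurability _ _ (borel Y) (borel Z) setT f (@open Z)) => //.
move=> _ [V oV <-]; rewrite setTI; apply: sub_sigma_algebra.
by move/continuousP : fc; exact.
Qed.

Definition push (mu : probability (borel Y) R) : probability (borel Z) R :=
  distribution mu (mfun_Sub (mem_set closed_embedding_measurable)).

Lemma pushE mu A : push mu A = mu (f @^-1` A).
Proof. by []. Qed.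

Lemma tsupp_push mu : tsupp (push mu) = f @` tsupp mu.
Proof.
have [fc fcl fo] := fE; apply/seteqP; split=> [z zs|_ [y ys <-] U oU Uy].
  have [[y _ yz]|nz] := pselect (range f z); last first.
    have := zs _ (closed_openC fcl) nz.
    rewrite pushE (_ : _ @^-1` _ = set0) ?measure0 ?ltxx//.
    by rewrite -subset0 => y; apply; exists y.
  exists y => // U oU Uy; have [V oV VU] := fo _ oU.
  by rewrite -VU -pushE; apply: zs => //; rewrite -yz -[V _]/((f @^-1` V) y) VU.
rewrite pushE; apply: ys => //; by move/continuousP : fc; exact.
Qed.

Lemma compact_tsupp_push (mu : M1c R Y) : compact (tsupp (push mu)).
Proof.
rewrite tsupp_push; apply: continuous_compact; last exact: compact_tsupp.
by apply: continuous_subspaceT; have [] := fE.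
Qed.

Definition M1c_push (mu : M1c R Y) : M1c R Z := MkM1c (@compact_tsupp_push mu).

End Pushforward.

Section Embeddings.
Context {R : realType}.

Lemma continuous_hjac : continuous (@hjac R).
Proof.
move=> f; apply: (near_cnormP (F := nbhs f) _ _).2 => e e0.
by have := nbhsx_ballx f _ e0; apply: filterS => g [].
Qed.

Lemma Xplus1_val_embedding : closed_embedding (@Xplus1_val R).
Proof.
split.
- exact: initial_continuous.
- have -> : range (@Xplus1_val R) = @hjac R @^-1` [set 1].
    apply/seteqP; split=> [_ [[f fP] _ <-]|f f1]; first exact: (set_mem fP).
    by exists (exist (fun g => g \in [set g | hjac g = 1]) f (mem_set f1)).
  apply: preimage_closed; first by move=> f _; exact: continuous_hjac.
  apply: accessible_closed_set1; apply: hausdorff_accessible.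
  exact: (@norm_hausdorff _ R[i]).
- by move=> U [V oV VU]; exists V.
Qed.

Lemma Xinv_embedding : closed_embedding (@Xinv R).
Proof.
split.
- by apply/continuousP => _ [V oV <-].
- have -> : range (@Xinv R) = setT; last exact: closedT.
  by apply/seteqP; split=> // -[f] _; exists f.
- by move=> U oU; exists (@Xinv_of R @^-1` U) => //; exists U.
Qed.

Definition M1c_incl (tau : M1c R (Xplus1 R)) : M1c R (Xplus R) :=
  M1c_push Xplus1_val_embedding tau.

Definition M1c_inv (tau : M1c R (Xplus R)) : M1c R (Xminus R) :=
  M1c_push Xinv_embedding tau.

End Embeddings.

Section MeanStability.
Context {R : realType}.

(* The composition g_n o ... o g_1 for s = [:: g_1; ...; g_n]. *)
Definition compose_seq (Y : Type) (act : Y -> P2 R -> P2 R) (s : seq Y)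
    (z : P2 R) : P2 R := foldl (fun z g => act g z) z s.

(* Mean stability on Lam of a measure on a space Y of maps; [act g] is the map
   on P2 corresponding to g, which is only meaningful on the set [dom]. *)
Definition mean_stable (Y : ptopologicalType) (act : Y -> P2 R -> P2 R)
    (dom Lam : set (P2 R)) (tau : M1c R Y) : Prop :=
  [/\ Lam `<=` dom,
    forall g, tsupp tau g -> forall z, Lam z -> Lam (act g z) &
    exists (n m : nat) (U : 'I_m -> set (P2 R)) (Q : set (P2 R)) (c : R),
      let UU := \bigcup_j U j in
      [/\ (0 < n)%N /\ (0 < m)%N,
        forall j, U j !=set0 /\ exists2 O, open O & U j = Lam `&` O,
        [/\ Q !=set0, compact Q & Q `<=` UU],
        0 < c < 1 &
        [/\ forall s : seq Y, size s = n -> [set` s] `<=` tsupp tau ->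
              compose_seq act s @` UU `<=` Q /\
              forall j x y, U j x -> U j y ->
                mdist (compose_seq act s x) (compose_seq act s y)
                  <= c * mdist x y &
            forall z, Lam z -> exists s : seq Y,
              [/\ (0 < size s)%N, [set` s] `<=` tsupp tau &
                UU (compose_seq act s z)]]]].

Definition pt100 : P2 R := hpoint 1 0 0.
Definition pt010 : P2 R := hpoint 0 1 0.

Definition MS : set (M1c R (Xplus R)) := [set tau |
  mean_stable extend (~` [set pt100]) (~` [set pt100]) tau /\
  mean_stable (fun g => extend_inv (Xinv_of g))
    (~` [set pt010]) (~` [set pt010]) (M1c_inv tau)].

End MeanStability.

Section Orbits.
Context {R : realType}.
Local Notation C := R[i].
Implicit Types (gam : int -> Xplus R) (z : C * C) (L : P2 R).

(* gam_(n-1) o ... o gam_0 and gam_(-n)^-1 o ... o gam_(-1)^-1,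
   on C^2 and on P2 *)
Fixpoint forward gam (n : nat) z : C * C :=
  if n is k.+1 then henon (gam k%:Z) (forward gam k z) else z.

Fixpoint backward gam (n : nat) z : C * C :=
  if n is k.+1 then henon_inv (gam (- (k.+1)%:Z)) (backward gam k z) else z.

Fixpoint forwardP2 gam (n : nat) L : P2 R :=
  if n is k.+1 then extend (gam k%:Z) (forwardP2 gam k L) else L.

Fixpoint backwardP2 gam (n : nat) L : P2 R :=
  if n is k.+1 then extend_inv (gam (- (k.+1)%:Z)) (backwardP2 gam k L) else L.

Definition Kplus gam : set (C * C) :=
  [set z | bounded_set [set forward gam n z | n in [set n | (1 <= n)%N]]].

Definition Kminus gam : set (C * C) :=
  [set z | bounded_set [set backward gam n z | n in [set n | (1 <= n)%N]]].

Definition frontier (A : set (C * C)) : set (C * C) :=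
  closure A `\` interior A.

Definition Jplus gam := frontier (Kplus gam).
Definition Jminus gam := frontier (Kminus gam).

Definition Leb4 (A : set (C * C)) : \bar R :=
  ((lebesgue_measure \x lebesgue_measure) \x
   (lebesgue_measure \x lebesgue_measure))%E
  [set t : (R * R) * (R * R) |
    A ((t.1.1 +i* t.1.2)%C, (t.2.1 +i* t.2.2)%C)].

End Orbits.

Section PowerMeasure.
Context {R : realType} (Y : ptopologicalType).

(* Y^Z with the product of the Borel sigma-algebras, which for second-countable
   Y is the Borel sigma-algebra of the product topology. *)
Definition cylinders : set (set (int -> Y)) :=
  [set B | exists i (A : set (borel Y)),
    measurable A /\ B = [set gam | A (gam i)]].

Definition biseq : Type := g_sigma_algebraType cylinders.

HB.instance Definition _ := Measurable.on biseq.

Definition is_power (tau : probability (borel Y) R)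
    (P : probability biseq R) : Prop :=
  forall (s : seq int) (A : int -> set (borel Y)), uniq s ->
    (forall i, measurable (A i)) ->
    P [set gam | forall i, i \in s -> A i (gam i)] =
    (\prod_(i <- s) tau (A i))%E.

(* The product measure tau^Z, described by its values on cylinders, which
   determine it. *)
Definition power_measure (tau : probability (borel Y) R) :
    probability biseq R :=
  xget (dirac (point : biseq) : probability biseq R) [set P | is_power tau P].

End PowerMeasure.
Arguments power_measure {R Y}.
Arguments is_power {R Y}.

(* Main.v *)
Require Import Defs.
From HB Require Import structures.
From mathcomp Require Import all_boot all_order all_algebra.
From mathcomp Require Import all_classical all_reals all_analysis.
From mathcomp Require Import spectral sesquilinear measurable_realfun complex ring lra.

Set Implicit Arguments.
Unset Strict Implicit.
Unset Printing Implicit Defensive.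

Import Order.TTheory GRing.Theory Num.Theory numFieldNormedType.Exports.

Local Open Scope classical_set_scope.
Local Open Scope ring_scope.

(** Everything is reduced to one property of a family G of volume-preserving
    Henon maps: [steerable G] says that finite words in G lead every point of
    C^2 into the region where |y| is large and |y| > |x|.  There the second
    coordinate of every orbit grows superlinearly, so that orbits tend to
    [0 : 1 : 0].  An inverse map is, after exchange of the coordinates, again a
    map of the same kind ([flip]); statements on backward orbits and on the
    inverse measure are therefore statements on forward orbits of another family.

    Mean stability of a measure means that its support and the flipped support
    are steerable.  If points can be steered to infinity, one can take for U a
    small neighbourhood of [0 : 1 : 0], which is superattracting for all the
    maps at once ([steerable_mean_stable]).  Conversely, if the contracting words
    of a mean stable family kept a point in a bounded part of C^2, they would
    shrink small boxes around it, although the maps preserve volume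
    ([mean_stable_steerable]).

    Steerability is open: outside of a large bidisk orbits either escape or come
    back to the bidisk, and by compactness finitely many words serve all points
    of the bidisk, so nearby families can use nearby words ([steerable_open]).
    It is dense: mix the measure with a small proportion of a measure carried by
    the kicked maps F + v, where F is in the support and v runs through a small
    ball.  If the new family were not steerable, the points reachable from some
    starting point would form a bounded set, which contains an open set O with
    F(O) + v in O for all small v; but F(O) has the same volume as O, and adding
    the kicks makes it strictly larger ([no_bounded_absorbing]).

    For a steerable support there are N and e > 0 such that a random orbit
    starting in the bidisk has escaped after N steps with probability at least
    e.  By independence of the successive blocks of N steps the probability of
    not having escaped decays geometrically ([survival_decay]), hence every
    fixed starting point almost surely escapes and its orbit converges to
    [0 : 1 : 0].  By Fubini almost every sequence of maps has a Lebesgue null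
    set K of points with bounded orbit; K is closed and has empty interior, so K
    is its own boundary.  Independence is exploited through the
    uniqueness of the product measure ([power_restart]), and its existence is
    the theorem of Kolmogorov and Ionescu-Tulcea ([power_measureP]). *)

(** * Powers of a probability measure *)
Section InfiniteProduct.
Context d (Y : measurableType d) (R : realType) (tau : probability Y R).

Definition seq_cylinders : set (set (nat -> Y)) :=
  [set B | exists i (A : set Y), measurable A /\ B = [set u | A (u i)]].

Definition seqspace : Type := g_sigma_algebraType seq_cylinders.

HB.instance Definition _ := Measurable.on seqspace.

Definition scons (p : Y * seqspace) : seqspace :=
  fun n => if n is k.+1 then p.2 k else p.1.

Lemma measurable_coord (i : nat) :
  measurable_fun setT ((fun u => u i) : seqspace -> Y).
Proof.
move=> _ A mA; rewrite setTI; apply: sub_sigma_algebra.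
by exists i, A.
Qed.

Lemma measurable_seqspace d' (X : measurableType d') (f : X -> seqspace) :
  (forall i, measurable_fun setT (fun x => f x i)) -> measurable_fun setT f.
Proof.
move=> mf; apply: (@measurability _ _ X seqspace setT f seq_cylinders) => //.
by move=> _ [_ [i [A [mA ->]]] <-]; exact: mf.
Qed.

Lemma measurable_scons : measurable_fun setT scons.
Proof.
apply: measurable_seqspace => -[|i] /=; first exact: measurable_fst.
apply: (@measurableT_comp _ _ _ _ _ _ (fun u : seqspace => u i)).
  exact: measurable_coord.
exact: measurable_snd.
Qed.

(** The law of a sequence whose first n terms are independent with law tau and
    whose other terms are a fixed point; on events depending on the first n
    terms it agrees with the law of an infinite independent sequence. *)
Fixpoint head_law (n : nat) : probability seqspace R :=
  if n is k.+1 then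
    distribution (tau \x head_law k)%E
      (mfun_Sub (mem_set measurable_scons))
  else dirac (point : seqspace).

Definition tail_section (A : set seqspace) (t : Y) : set seqspace :=
  [set u | A (scons (t, u))].

Lemma measurable_tail_section A t :
  measurable A -> measurable (tail_section A t).
Proof.
move=> mA.
have -> : tail_section A t = xsection (scons @^-1` A) t.
  by apply/seteqP; split=> u; rewrite /xsection/= inE.
apply: measurable_xsection.
by rewrite -[X in measurable X]setTI; exact: measurable_scons.
Qed.

Lemma measurable_tail_law n A : measurable A ->
  measurable_fun [set: Y] (fun t => head_law n (tail_section A t) : \bar R).
Proof.
move=> mA; rewrite (_ : (fun _ => _) =
    head_law n \o xsection (scons @^-1` A)); last first.
  apply/funext => t /=; congr (head_law n _).
  by apply/seteqP; split=> u; rewrite /xsection/= inE.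
apply: measurable_fun_xsection.
by rewrite -[X in measurable X]setTI; exact: measurable_scons.
Qed.

Lemma head_lawS n A : measurable A ->
  head_law n.+1 A = (\int[tau]_t head_law n (tail_section A t))%E.
Proof.
move=> mA; rewrite /= /distribution /pushforward /=.
rewrite /product_measure1.
apply: eq_integral => t _ /=; congr (head_law n _).
by apply/seteqP; split=> u; rewrite /xsection/= inE.
Qed.

Definition depends_on_head (n : nat) (A : set seqspace) : Prop :=
  forall u v, (forall i, (i < n)%N -> u i = v i) -> A u -> A v.

Lemma depends_on_headW m n A :
  (m <= n)%N -> depends_on_head m A -> depends_on_head n A.
Proof.
by move=> mn dA u v uv; apply: dA => i im; exact: uv (leq_trans im mn).
Qed.

Lemma depends_on_head_tail n A t :
  depends_on_head n A -> depends_on_head n.-1 (tail_section A t).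
Proof.
move=> dA u v uv; apply: dA => -[|i]//= iS; apply: uv.
by case: n iS.
Qed.

Lemma depends_on_head0 A : depends_on_head 0 A -> A = set0 \/ A = setT.
Proof.
move=> dA; have [[u Au]|nA] := pselect (A !=set0).
  by right; apply/seteqP; split=> // v _; exact: dA Au.
by left; apply/seteqP; split=> // v Av; apply: nA; exists v.
Qed.

Lemma head_law_stable n m A : measurable A -> depends_on_head n A ->
  (n <= m)%N -> head_law m A = head_law n A.
Proof.
elim: n m A => [m A mA /depends_on_head0[->|->] _|n ih [//|m] A mA dA nm].
- by rewrite !measure0.
- by rewrite !probability_setT.
- rewrite !head_lawS//; apply: eq_integral => t _.
  apply: ih => //; first exact: measurable_tail_section.
  exact: depends_on_head_tail dA.
Qed.

(** The same sequences, with the events depending on finitely many terms as an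
    algebra of sets on which a content is defined. *)
Definition headspace : Type := seqspace.
HB.instance Definition _ := Pointed.on headspace.

Definition head_event : set (set headspace) :=
  [set A | measurable (A : set seqspace) /\ exists n, depends_on_head n A].

Fact head_event0 : head_event set0.
Proof. by split; [exact: measurable0|exists 0%N => u v _]. Qed.

Fact head_eventU : setU_closed head_event.
Proof.
move=> A B [mA [n dA]] [mB [m dB]]; split; first exact: measurableU.
exists (maxn n m) => u v uv [Au|Bu]; [left|right].
  by apply: (depends_on_headW (leq_maxl n m) dA) Au.
by apply: (depends_on_headW (leq_maxr n m) dB) Bu.
Qed.

Fact head_eventC : setC_closed head_event.
Proof.
move=> A [mA [n dA]]; split; first exact: measurableC.
exists n => u v uv nAu Av; apply: nAu; apply: dA Av => i /uv; exact: esym.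
Qed.

HB.instance Definition _ := @isAlgebraOfSets.Build d headspace
  head_event head_event0 head_eventU head_eventC.

Definition head_content (A : set headspace) : \bar R :=
  if pselect (exists n, depends_on_head n A) is left e then
    head_law (projT1 (cid e)) A
  else 0%E.

Lemma head_contentE n (A : set headspace) :
  measurable (A : set seqspace) -> depends_on_head n A ->
  head_content A = head_law n A.
Proof.
move=> mA dA; rewrite /head_content; case: pselect => [e|]; last first.
  by case; exists n.
case: cid => m dAm /=.
by have [nm|/ltnW mn] := leqP n m; [|apply/esym]; exact: head_law_stable.
Qed.

Lemma head_content_int A : head_event A ->
  head_content A = (\int[tau]_t head_content (tail_section A t))%E.
Proof.
move=> [mA [n dA]].
rewrite (head_contentE mA (depends_on_headW (leqnSn n) dA)) head_lawS//.
apply: eq_integral => t _; apply/esym/head_contentE.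
  exact: measurable_tail_section.
exact: (depends_on_headW (leq_pred n)) (depends_on_head_tail dA).
Qed.

Lemma head_content_ge0 A : (0 <= head_content A)%E.
Proof. by rewrite /head_content; case: pselect. Qed.

Lemma head_content0 : head_content set0 = 0%E.
Proof. by have [mA [n dA]] := head_event0; rewrite (head_contentE mA dA). Qed.

Lemma head_content_le1 A : head_event A -> (head_content A <= 1)%E.
Proof.
by move=> [mA [n dA]]; rewrite (head_contentE mA dA) probability_le1.
Qed.

Lemma head_contentU A B : head_event A -> head_event B -> A `&` B = set0 ->
  head_content (A `|` B) = (head_content A + head_content B)%E.
Proof.
move=> hA hB AB; have [mA [n dA]] := hA; have [mB [m dB]] := hB.
have {}dA := depends_on_headW (leq_maxl n m) dA.
have {}dB := depends_on_headW (leq_maxr n m) dB.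
rewrite (head_contentE mA dA) (head_contentE mB dB).
rewrite (@head_contentE (maxn n m)) ?measureU//; first exact: measurableU.
by move=> u v uv [Au|Bu]; [left; exact: dA Au|right; exact: dB Bu].
Qed.

Lemma head_event_tail A t : head_event A -> head_event (tail_section A t).
Proof.
move=> [mA [n dA]]; split; first exact: measurable_tail_section.
by exists n.-1; exact: depends_on_head_tail.
Qed.

Definition persistent (A : nat -> set seqspace) : Prop :=
  (forall k, head_event (A k)) /\
  ~ (head_content (A k) @[k --> \oo] --> (0 : \bar R)).

(** Otherwise all the sections would have contents tending to 0, and by dominated
    convergence so would the events themselves. *)
Lemma persistent_tail A : persistent A ->
  exists t, persistent (fun k => tail_section (A k) t).
Proof.
move=> [hA nA]; apply: contrapT => nt; apply: nA.
have cvg0 t : head_content (tail_section (A k) t) @[k --> \oo] --> (0 : \bar R).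
  apply: contrapT => nc; apply: nt; exists t; split=> // k.
  exact: head_event_tail.
have mf k : measurable_fun [set: Y] (fun t => head_content (tail_section (A k) t) : \bar R).
  have [mA [n dA]] := hA k.
  rewrite (_ : (fun _ => _) = fun t => head_law n (tail_section (A k) t)).
    exact: measurable_tail_law.
  apply/funext => t; apply: head_contentE; first exact: measurable_tail_section.
  exact: (depends_on_headW (leq_pred n)) (depends_on_head_tail dA).
have [||||_ _] := @dominated_convergence _ Y R tau setT measurableT
  (fun k t => head_content (tail_section (A k) t)) (cst 0%E) (cst 1%E) mf.
- exact: measurable_cst.
- by apply: aeW => t _; exact: cvg0.
- by apply: finite_measure_integrable_cst.
- apply: aeW => t k _; rewrite gee0_abs ?head_content_ge0//.
  by apply: head_content_le1; exact: head_event_tail.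
rewrite integral0; apply: cvg_trans; apply: near_eq_cvg.
by apply: nearW => k /=; rewrite [RHS]head_content_int.
Qed.

(** If the contents do not tend to 0, one chooses the terms of a sequence u one
    after the other so that the successive sections stay persistent.  An event
    depending on the first m terms has become trivial after m choices, and being
    persistent it is then full; so u belongs to all the events. *)
Lemma head_content_continuous (A : nat -> set seqspace) :
  (forall k, head_event (A k)) -> nonincreasing_seq A ->
  \bigcap_k A k = set0 -> head_content (A k) @[k --> \oo] --> (0 : \bar R).
Proof.
move=> hA niA A0; apply: contrapT => nA.
pose state := {B : nat -> set seqspace | persistent B}.
pose head (B : state) := projT1 (cid (persistent_tail (projT2 B))).
pose next (B : state) : state :=
  exist _ (fun k => tail_section (projT1 B k) (head B))
    (projT2 (cid (persistent_tail (projT2 B)))).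
pose st n : state := iter n next (exist _ A (conj hA nA)).
pose u : seqspace := fun n => head (st n).
pose shift n : seqspace := fun i => u (n + i)%N.
have uE n k : projT1 (st n) k (shift n) <-> A k u.
  elim: n => [|n <-].
    suff -> : shift 0 = u by [].
    by apply/funext => i; rewrite /shift add0n.
  rewrite {1}/st iterS -/(st n) /= /tail_section /=.
  suff -> : scons (head (st n), shift n.+1) = shift n by [].
  by apply/funext => -[|i]; rewrite /shift/= ?addn0 ?addnS.
have sub n j k : (j <= k)%N -> projT1 (st n) k `<=` projT1 (st n) j.
  move=> jk; elim: n => [|n ih]; first by apply/subsetPset/niA.
  by rewrite {1 2}/st iterS -/(st n) => v; exact: ih.
have dep n k m : depends_on_head m (A k) ->
    depends_on_head (m - n) (projT1 (st n) k).
  move=> dA; elim: n => [|n ih]; first by rewrite subn0.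
  by rewrite {1}/st iterS -/(st n) subnS; exact: depends_on_head_tail.
suff : (\bigcap_k A k) u by rewrite A0.
move=> k _; have [_ [m dA]] := hA k; apply/(uE m k).
have [B0|->//] : projT1 (st m) k = set0 \/ projT1 (st m) k = setT.
  by apply: depends_on_head0; have := dep m k m dA; rewrite subnn.
have [_ []] := projT2 (st m).
apply: cvg_near_cst; near=> j.
have kj : (k <= j)%N by near: j; exact: nbhs_infty_ge.
have -> : projT1 (st m) j = set0.
  by apply/seteqP; split=> // v /(sub _ _ _ kj); rewrite B0.
exact: head_content0.
Unshelve. all: by end_near. Qed.

Lemma head_content_additive (F : nat -> set headspace) n :
  (forall k, head_event (F k)) -> trivIset setT F ->
  head_content (\big[setU/set0]_(i < n) F i) =
  (\sum_(i < n) head_content (F i))%E.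
Proof.
move=> hF tF; elim: n => [|n ih]; first by rewrite !big_ord0 head_content0.
rewrite !big_ord_recr/= -ih head_contentU//.
  elim: n {ih} => [|n ihn]; first by rewrite big_ord0; exact: head_event0.
  by rewrite big_ord_recr/=; exact: head_eventU.
rewrite -bigcup_mkord setI_bigcupl bigcup0// => i /= ilt.
apply/eqP/negPn/negP => /set0P[u [Fiu Fnu]].
by have := tF i n I I (ex_intro _ u (conj Fiu Fnu)) => iE; rewrite iE ltnn in ilt.
Qed.

Lemma head_content_sigma_additive : semi_sigma_additive head_content.
Proof.
move=> F hF tF hU; pose U := \bigcup_n F n.
have hFn n : head_event (\big[setU/set0]_(i < n) F i).
  elim: n => [|n ihn]; first by rewrite big_ord0; exact: head_event0.
  by rewrite big_ord_recr/=; apply: (head_eventU ihn); exact: hF.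
pose B n := U `\` \big[setU/set0]_(i < n) F i.
have hB n : head_event (B n).
  exact: (@measurableD _ headspace _ _ hU (hFn n)).
have : head_content (B n) @[n --> \oo] --> (0 : \bar R).
  apply: head_content_continuous => //.
    move=> m n mn; apply/subsetPset; apply: setDS.
    by apply: subset_bigsetU.
  apply/seteqP; split=> // u Bu; have [[n _ Fnu] _] := Bu 0%N I.
  have [_] := Bu n.+1 I; apply; rewrite big_ord_recr/=; by right.
have fin A : head_event A -> head_content A \is a fin_num.
  move=> hA; rewrite ge0_fin_numE ?head_content_ge0//.
  exact: le_lt_trans (head_content_le1 hA) (ltry 1).
have UE n : head_content U = (\sum_(i < n) head_content (F i) +
    head_content (B n))%E.
  rewrite -head_content_additive// -head_contentU//; last first.
    by apply/seteqP; split=> // u [Fu [_]]; apply.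
  by congr head_content; rewrite /B setDUK//; exact: bigsetU_bigcup.
move=> B0; have : (head_content U - head_content (B n))%E @[n --> \oo] -->
    (head_content U - 0)%E.
  apply: cvgeB => //; last exact: cvg_cst.
  by rewrite fin_num_adde_defr// fin.
rewrite sube0; apply: cvg_trans; apply: near_eq_cvg; apply: nearW => n /=.
by rewrite (UE n) addeK ?fin// big_mkord.
Qed.

HB.instance Definition _ := isMeasure.Build _ headspace R head_content
  head_content0 head_content_ge0 head_content_sigma_additive.

Definition iid_law := measure_extension head_content.

HB.instance Definition _ := Measure.on iid_law.

Lemma iid_lawE A : head_event A -> iid_law A = head_content A.
Proof. by move=> hA; rewrite /iid_law /measure_extension measurable_mu_extE. Qed.

Fact iid_law_setT : iid_law setT = 1%E.
Proof.
rewrite iid_lawE; last exact: (@measurableT _ headspace).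
by rewrite (@head_contentE 0)// ?probability_setT.
Qed.

HB.instance Definition _ := Measure_isProbability.Build _ _ _ iid_law iid_law_setT.

Lemma head_event_box n (A : nat -> set Y) : (forall i, measurable (A i)) ->
  head_event [set u | forall i, (i < n)%N -> A i (u i)].
Proof.
move=> mA; split.
  rewrite (_ : mkset _ =
      \bigcap_(i in [set i | (i < n)%N]) ((fun u : seqspace => u i) @^-1` A i)).
    apply: bigcap_measurableType => i _.
    by rewrite -[X in measurable X]setTI; exact: measurable_coord.
  by apply/seteqP; split=> u h i; apply: h.
by exists n => u v uv h i lt_in; rewrite -uv//; exact: h.
Qed.

Lemma head_law_box n (A : nat -> set Y) : (forall i, measurable (A i)) ->
  head_law n [set u | forall i, (i < n)%N -> A i (u i)] =
  (\prod_(i < n) tau (A i))%E.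
Proof.
elim: n A => [|n ih] A mA.
  rewrite big_ord0 -(probability_setT (head_law 0)); congr (head_law 0 _).
  by apply/seteqP; split.
have [mB _] := head_event_box n.+1 mA.
rewrite head_lawS// big_ord_recl -(ih (fun i => A i.+1)); last by move=> i.
set p := head_law n _.
rewrite (eq_integral (fun t => (\1_(A 0%N) t)%:E * p)%E); last first.
  move=> t _; rewrite indicE; have [At|At] := boolP (t \in A 0%N).
    rewrite mul1e; congr (head_law n _); apply/seteqP; split=> u.
      by move=> h i lt_in; exact: (h i.+1).
    by move=> h [|i] lt_in; [exact: set_mem|exact: h].
  rewrite mul0e (_ : tail_section _ _ = set0) ?measure0//.
  by apply/seteqP; split=> // u /(_ 0%N isT)/mem_set; rewrite (negPf At).
rewrite ge0_integralZr ?integral_indic ?setIT//; first exact: measurableT_comp.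
exact: measure_ge0.
Qed.

Lemma iid_law_box n (A : nat -> set Y) : (forall i, measurable (A i)) ->
  iid_law [set u | forall i, (i < n)%N -> A i (u i)] =
  (\prod_(i < n) tau (A i))%E.
Proof.
move=> mA; have hB := head_event_box n mA; have [mB _] := hB.
rewrite iid_lawE// (@head_contentE n) ?head_law_box//.
by move=> u v uv h i lt_in; rewrite -uv//; exact: h.
Qed.

End InfiniteProduct.

Section PowerMeasureExists.
Context {R : realType} (Y : ptopologicalType) (tau : probability (borel Y) R).

Let coords (u : nat -> Y) : biseq Y := fun i => u (pickle i).

Lemma measurable_biseq d' (X : measurableType d') (f : X -> biseq Y) :
  (forall i, measurable_fun setT ((fun x => f x i) : X -> borel Y)) ->
  measurable_fun setT f.
Proof.
move=> mf; apply: (@measurability _ _ X (biseq Y) setT f (@cylinders Y)) => //.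
by move=> _ [_ [i [A [mA ->]]] <-]; exact: mf.
Qed.

Lemma measurable_coords : measurable_fun setT
  (coords : g_sigma_algebraType (@measurable _ (headspace (borel Y))) -> biseq Y).
Proof.
apply: measurable_biseq => i _ A mA; rewrite setTI.
apply: sub_sigma_algebra; split.
  by have /(_ measurableT A mA) := @measurable_coord _ (borel Y) (pickle i);
    rewrite setTI.
by exists (pickle i).+1 => u v uv; rewrite /coords/= uv.
Qed.

(** The integers are enumerated by [pickle]; coordinates of the sequence outside
    of the image of the enumeration are ignored. *)
Lemma is_power_exists : exists P : probability (biseq Y) R, is_power tau P.
Proof.
exists (distribution (iid_law tau) (mfun_Sub (mem_set measurable_coords))).
move=> s A us mA; rewrite /distribution /pushforward /=.
pose B (k : nat) : set (borel Y) :=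
  if k \in map pickle s then (if unpickle k is Some i then A i else setT)
  else setT.
have mB k : measurable (B k).
  by rewrite /B; case: ifP => // _; case: unpickle.
pose n := (\max_(i <- s) pickle i).+1.
have ltn i : i \in s -> (pickle i < n)%N.
  by move=> si; rewrite ltnS; apply: leq_bigmax_seq.
rewrite (_ : _ @^-1` _ = [set u | forall i, (i < n)%N -> B i (u i)]); last first.
  apply/seteqP; split=> u /= h i.
    move=> _; rewrite /B; case: ifP => // /mapP[j js ->].
    by rewrite pickleK; exact: h.
  by move=> si; have := h (pickle i) (ltn i si); rewrite /B map_f// pickleK.
rewrite iid_law_box// -(big_mkord xpredT (fun k => tau (B k))).
rewrite (bigID (mem (map pickle s)))/= [X in (_ * X)%E]big1; last first.
  by move=> k /negPf ks; rewrite /B ks probability_setT.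
rewrite mule1 -big_filter (perm_big (map pickle s)).
  rewrite big_map big_seq [RHS]big_seq; apply: eq_bigr => i si.
  by rewrite /B map_f// pickleK.
apply: uniq_perm.
- by rewrite filter_uniq// iota_uniq.
- by rewrite map_inj_uniq//; exact: pcan_inj pickleK.
- move=> k; rewrite mem_filter mem_index_iota leq0n/=.
  by have [/mapP[i si ->]|//] := boolP (k \in map pickle s); rewrite ltn.
Qed.

Lemma power_measureP : is_power tau (power_measure tau).
Proof.
rewrite /power_measure; have [P tP] := is_power_exists.
exact: (xgetPex _ (ex_intro [set P | is_power tau P] P tP)).
Qed.

End PowerMeasureExists.

(** * The modulus and the Fubini-Study distance *)
Section ComplexFilter.
Context {R : realType}.

Local Instance nbhs_complex_pfilter (x : R[i]) : ProperFilter (nbhs x) :=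
  nbhs_pfilter x.

End ComplexFilter.
#[global] Existing Instance nbhs_complex_pfilter.

Section Modulus.
Context {R : realType}.
Local Notation C := R[i].
Implicit Types x y z : C.

Lemma cnormM x y : cnorm (x * y) = cnorm x * cnorm y.
Proof. by apply: (@complexI R); rewrite rmorphM/= !cnormE normrM. Qed.

Lemma cnorm1 : cnorm (1 : C) = 1.
Proof. by apply: (@complexI R); rewrite cnormE normr1. Qed.

Lemma cnormX x n : cnorm (x ^+ n) = cnorm x ^+ n.
Proof. by elim: n => [|n ih]; rewrite ?expr0 ?cnorm1// !exprS cnormM ih. Qed.

Lemma cnormN x : cnorm (- x) = cnorm x.
Proof. by rewrite /cnorm normrN. Qed.

Lemma cnorm_eq0 x : (cnorm x == 0) = (x == 0).
Proof. by rewrite -(inj_eq (@complexI R)) cnormE normr_eq0. Qed.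

Lemma cnorm_gt0 x : (0 < cnorm x) = (x != 0).
Proof. by rewrite lt0r cnorm_eq0 cnorm_ge0 andbT. Qed.

Lemma cnormV x : cnorm x^-1 = (cnorm x)^-1.
Proof. by apply: (@complexI R); rewrite fmorphV/= !cnormE normfV. Qed.

Lemma cnorm_div x y : cnorm (x / y) = cnorm x / cnorm y.
Proof. by rewrite cnormM cnormV. Qed.

Lemma cnormD x y : cnorm (x + y) <= cnorm x + cnorm y.
Proof. by rewrite -lecR rmorphD/= !cnormE ler_normD. Qed.

Lemma cnormB_le x y : cnorm (x - y) <= cnorm x + cnorm y.
Proof. by rewrite -(cnormN y) cnormD. Qed.

Lemma cnorm_sub_le x y : cnorm x - cnorm y <= cnorm (x - y).
Proof. by have := cnormD (x - y) y; rewrite subrK; lra. Qed.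

Lemma cnorm_sum (I : finType) (F : I -> C) :
  cnorm (\sum_i F i) <= \sum_i cnorm (F i).
Proof.
elim/big_ind2 : _ => [|a b c d ab cd|//]; first by rewrite cnorm0.
by rewrite (le_trans (cnormD _ _))// lerD.
Qed.

Lemma cnorm_sqr x : (cnorm x ^+ 2)%:C%C = x * x^*.
Proof. by rewrite rmorphXn/= cnormE normCK. Qed.

Lemma cnorm_ReIm x : cnorm x ^+ 2 = complex.Re x ^+ 2 + complex.Im x ^+ 2.
Proof.
case: x => a b; apply: (@complexI R); rewrite cnorm_sqr.
by apply/eqP; rewrite eq_complex/=; apply/andP; split; apply/eqP; ring.
Qed.

Lemma Re_le_cnorm x : `|complex.Re x| <= cnorm x.
Proof.
rewrite -(@ler_pXn2r _ 2)// ?nnegrE ?cnorm_ge0//.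
by rewrite real_normK ?num_real// cnorm_ReIm lerDl sqr_ge0.
Qed.

Lemma Im_le_cnorm x : `|complex.Im x| <= cnorm x.
Proof.
rewrite -(@ler_pXn2r _ 2)// ?nnegrE ?cnorm_ge0//.
by rewrite real_normK ?num_real// cnorm_ReIm lerDr sqr_ge0.
Qed.

Lemma cnorm_le_ReIm x : cnorm x <= `|complex.Re x| + `|complex.Im x|.
Proof.
rewrite -(@ler_pXn2r _ 2)// ?nnegrE ?cnorm_ge0 ?addr_ge0//.
rewrite cnorm_ReIm -(real_normK (num_real (complex.Re x))).
rewrite -(real_normK (num_real (complex.Im x))).
have := mulr_ge0 (normr_ge0 (complex.Re x)) (normr_ge0 (complex.Im x)).
by rewrite sqrrD; lra.
Qed.

End Modulus.

Section FubiniStudyChart.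
Context {R : realType}.
Local Notation C := R[i].
Implicit Types (x y z : C) (L M : P2 R).

Lemma sin_le_id (t : R) : 0 <= t -> sin t <= t.
Proof.
rewrite le_eqVlt => /predU1P[<-|t0]; first by rewrite sin0.
have [c _] := MVT t0 (fun r _ => is_derive_sin r)
  (continuous_subspaceT (@continuous_sin R)).
rewrite sin0 !subr0 => ->; rewrite ger_pMl//; exact: cos_le1.
Qed.

Lemma id_le_sin (t : R) : 0 <= t -> t <= pi / 2 -> t <= 4 * sin t.
Proof.
rewrite le_eqVlt => /predU1P[<-|t0] tpi; first by rewrite sin0 mulr0.
have pi0 : 0 < pi :> R by exact: pi_gt0.
have tpi' : t <= pi by lra.
have s0 : 0 <= sin t by apply: sin_ge0_pi; rewrite ltW.
have [ct|ct] := leP (1 / 2) (cos t).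
  have [c] := MVT t0 (fun r _ => is_derive_sin r)
    (continuous_subspaceT (@continuous_sin R)).
  rewrite in_itv/= => /andP[c0 c_t]; rewrite sin0 !subr0 => ->.
  have : cos t <= cos c.
    by rewrite leNgt ltr_cos ?in_itv/= -?leNgt ?ltW//; lra.
  move=> ctc; have : 1 / 2 * t <= cos c * t by rewrite ler_pM2r//; lra.
  by lra.
have c0 : 0 <= cos t by apply: cos_ge0_pihalf; rewrite tpi andbT; lra.
have c2 : cos t ^+ 2 < 1 / 4.
  by rewrite expr2; nra.
have := cos2Dsin2 t; have p2 := @pihalf_lt2 R.
have [s1|s1] := leP (1 / 2) (sin t); first by lra.
have : sin t ^+ 2 <= 1 / 4.
  by rewrite expr2; nra.
by lra.
Qed.

Definition hnorm2 x y z : R := cnorm x ^+ 2 + cnorm y ^+ 2 + cnorm z ^+ 2.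

(** Squared norm of the exterior product of (x, y, z) and (x', y', z'). *)
Definition wedge2 x y z x' y' z' : R :=
  cnorm (x * y' - x' * y) ^+ 2 + cnorm (x * z' - x' * z) ^+ 2 +
  cnorm (y * z' - y' * z) ^+ 2.

Lemma dotmx_hvec x y z x' y' z' :
  dotmx (hvec x y z) (hvec x' y' z') = x * x'^* + y * y'^* + z * z'^*.
Proof.
by rewrite dotmxE !mxE !big_ord_recl big_ord0 !mxE/= addr0 addrA.
Qed.

Lemma cosangleZ (a b : C) (u v : 'rV[C]_3) : a != 0 -> b != 0 ->
  cosangle (a *: u) (b *: v) = cosangle u v.
Proof.
move=> a0 b0; rewrite /cosangle !linearZl_LR/= !linearZr_LR/= !normrM norm_conjC.
have sq (c s : C) : sqrtC (c^* *: (c * s)) = `|c| * sqrtC s.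
  rewrite -[c^* *: _]/(c^* * _) mulrA [c^* * c]mulrC -normCK rootCMl ?exprn_ge0//.
  by rewrite -/(sqrtC _) sqrCK.
move: (dotmx u v) (dotmx u u) (dotmx v v) => p q r.
rewrite (sq a) (sq b) mulrACA mulrA [`|b| * _]mulrC -mulf_div divff ?mul1r//.
by rewrite mulf_neq0 ?normr_eq0.
Qed.

Lemma fubini_study_hpoint x y z x' y' z' :
  hvec x y z != 0 -> hvec x' y' z' != 0 ->
  fubini_study (hpoint x y z) (hpoint x' y' z') =
  acos (complex.Re (cosangle (hvec x y z) (hvec x' y' z'))).
Proof.
move=> n0 n0'; rewrite /fubini_study.
have [c c0 ->] := rep_hpoint n0; have [c' c'0 ->] := rep_hpoint n0'.
by rewrite cosangleZ.
Qed.

Lemma fubini_study_ge0 L M : 0 <= fubini_study L M.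
Proof. by rewrite /fubini_study acos_ge0// cosangle_itv. Qed.

Lemma fubini_study_pihalf L M : fubini_study L M <= pi / 2.
Proof.
have pi0 : 0 < pi :> R by exact: pi_gt0.
rewrite leNgt -ltr_cos ?in_itv/= ?fubini_study_ge0 ?acos_lepi ?cosangle_itv//;
  last by apply/andP; split; lra.
rewrite cos_pihalf -leNgt /fubini_study acosK ?in_itv/= ?cosangle_itv//.
by rewrite -(@lecR R) Re_cosangle cosangle_ge0.
Qed.

(** Lagrange's identity turns the cosine of the angle between two lines into
    the exterior product of spanning vectors, whose coordinates are explicit
    in every affine chart. *)
Lemma sin_fubini_study x y z x' y' z' :
  hvec x y z != 0 -> hvec x' y' z' != 0 ->
  sin (fubini_study (hpoint x y z) (hpoint x' y' z')) ^+ 2 *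
    (hnorm2 x y z * hnorm2 x' y' z') = wedge2 x y z x' y' z'.
Proof.
move=> n0 n0'; rewrite fubini_study_hpoint//.
have kE : (complex.Re (cosangle (hvec x y z) (hvec x' y' z')))%:C%C =
    cosangle (hvec x y z) (hvec x' y' z').
  by apply: RRe_real; apply: ger0_real; exact: cosangle_ge0.
have kitv : -1 <= complex.Re (cosangle (hvec x y z) (hvec x' y' z')) <= 1.
  have k0 : 0 <= complex.Re (cosangle (hvec x y z) (hvec x' y' z')).
    by rewrite -(@lecR R) kE cosangle_ge0.
  have : complex.Re (cosangle (hvec x y z) (hvec x' y' z')) <= 1.
    by rewrite -(@lecR R) kE cosangle_le1.
  by move=> k1; rewrite k1 andbT; lra.
have := cos2Dsin2 (acos (complex.Re (cosangle (hvec x y z) (hvec x' y' z')))).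
rewrite acosK ?in_itv//= => /(canRL (addKr _)) ->.
have uu : dotmx (hvec x y z) (hvec x y z) != 0 by rewrite dnorm_eq0.
have vv : dotmx (hvec x' y' z') (hvec x' y' z') != 0 by rewrite dnorm_eq0.
have kE2 : cosangle (hvec x y z) (hvec x' y' z') ^+ 2 *
    (dotmx (hvec x y z) (hvec x y z) * dotmx (hvec x' y' z') (hvec x' y' z')) =
    dotmx (hvec x y z) (hvec x' y' z') * (dotmx (hvec x y z) (hvec x' y' z'))^*.
  rewrite /cosangle; move: (dotmx _ (hvec x y z)) (dotmx (hvec x' y' z') _) uu vv.
  move: (dotmx _ _) => p q r q0 r0.
  by rewrite expr_div_n exprMn !sqrtCK divfK ?mulf_neq0// normCK.
move: kE kE2 {kitv uu vv}; move: (cosangle _ _) => k kE.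
rewrite !dotmx_hvec => kE2; apply: (@complexI R).
rewrite rmorphM rmorphD/= rmorphN rmorphXn/= rmorph1 kE rmorphM/=.
rewrite mulrDl mul1r mulNr /hnorm2 /wedge2 !rmorphD/= !cnorm_sqr kE2.
by rewrite !rmorphB/= !rmorphD/= !rmorphM/= !conjCK; ring.
Qed.

End FubiniStudyChart.

(** * Affine charts of the projective plane *)
Section ProjectiveCharts.
Context {R : realType}.
Local Notation C := R[i].
Implicit Types (x y z : C) (L M : P2 R).

Lemma P2_hpoint L : exists x y z, hvec x y z != 0 /\ L = hpoint x y z.
Proof.
pose v := rep L; exists (v 0 0), (v 0 1), (v 0 2%:R).
have vE : hvec (v 0 0) (v 0 1) (v 0 2%:R) = v.
  apply/rowP => -[[|[|[|//]]] i]; rewrite !mxE/=; congr (v _ _);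
  exact: val_inj.
have v0 : hvec (v 0 0) (v 0 1) (v 0 2%:R) != 0 by rewrite vE rep_neq0.
by split=> //; apply: val_inj; rewrite val_hpoint// vE val_rep.
Qed.

Lemma P2_cases L : (exists w : C * C, L = embed w) \/
  (exists x y, (x != 0) || (y != 0) /\ L = hpoint x y 0).
Proof.
have [x [y [z [n0 ->]]]] := P2_hpoint L.
have [z0|z0] := eqVneq z 0.
  by right; exists x, y; move: n0; rewrite hvec_neq0 z0 eqxx orbF.
left; exists (x / z, y / z); rewrite /embed/=.
by rewrite -[RHS](@hpoint_scale _ z)// mulr1 ![z * (_ / z)]mulrC !divfK.
Qed.

Lemma cnorm2_gt0 x : x != 0 -> 0 < cnorm x ^+ 2.
Proof. by move=> x0; rewrite exprn_gt0// cnorm_gt0. Qed.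

Lemma hnorm2_ge0 x y z : 0 <= hnorm2 x y z.
Proof. by rewrite !addr_ge0 ?sqr_ge0. Qed.

Lemma hnorm2_gt0 x y z : hvec x y z != 0 -> 0 < hnorm2 x y z.
Proof.
have := sqr_ge0 (cnorm x); have := sqr_ge0 (cnorm y); have := sqr_ge0 (cnorm z).
by rewrite hvec_neq0 /hnorm2 => ? ? ? /or3P[] /cnorm2_gt0; lra.
Qed.

Lemma sin_fs_ge0 L M : 0 <= sin (fubini_study L M).
Proof.
have pi0 : 0 < pi :> R by exact: pi_gt0.
apply: sin_ge0_pi; rewrite fubini_study_ge0/=.
by rewrite (le_trans (fubini_study_pihalf L M))//; lra.
Qed.

Lemma sin_fs_le L M : sin (fubini_study L M) <= fubini_study L M.
Proof. exact/sin_le_id/fubini_study_ge0. Qed.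

Lemma fs_le_sin L M : fubini_study L M <= 4 * sin (fubini_study L M).
Proof. exact: id_le_sin (fubini_study_ge0 _ _) (fubini_study_pihalf _ _). Qed.

Lemma hpoint_eqP x y z x' y' z' : hvec x y z != 0 -> hvec x' y' z' != 0 ->
  hpoint x y z = hpoint x' y' z' <-> wedge2 x y z x' y' z' = 0.
Proof.
move=> n0 n0'; rewrite -sin_fubini_study//; split=> [->|/eqP].
  by rewrite fubini_studyxx sin0 expr0n mul0r.
have /gt_eqF hh0 : 0 < hnorm2 x y z * hnorm2 x' y' z'.
  by rewrite mulr_gt0 ?hnorm2_gt0.
rewrite mulf_eq0 hh0 orbF expf_eq0/= => /eqP s0; apply: fubini_study_positivity.
apply/eqP; rewrite eq_le fubini_study_ge0 andbT.
by rewrite (le_trans (fs_le_sin _ _))// s0 mulr0.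
Qed.

Lemma cnorm2_eq0 x : (cnorm x ^+ 2 == 0) = (x == 0).
Proof. by rewrite expf_eq0/= cnorm_eq0. Qed.

Lemma embed_inj : injective (@embed R).
Proof.
move=> [x y] [x' y'] /hpoint_eqP /=; rewrite !hvec_neq0 oner_neq0 !orbT.
move=> /(_ isT isT); rewrite /wedge2 !mulr1 => w0.
have := sqr_ge0 (cnorm (x * y' - x' * y)); have := sqr_ge0 (cnorm (x - x')).
have := sqr_ge0 (cnorm (y - y')) => q1 q2 q3.
apply/eqP; rewrite xpair_eqE -(subr_eq0 x) -(subr_eq0 y) -!cnorm2_eq0.
by apply/andP; split; apply/eqP; lra.
Qed.

Lemma embed_neq_infinity (w : C * C) x y : (x != 0) || (y != 0) ->
  embed w <> hpoint x y 0.
Proof.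
move=> xy0 /hpoint_eqP; rewrite !hvec_neq0 oner_neq0 !orbT orbA xy0.
move=> /(_ isT isT); rewrite /wedge2 !mulr0 !mulr1 !sub0r !cnormN.
have := sqr_ge0 (cnorm (w.1 * y - x * w.2)).
have := sqr_ge0 (cnorm x); have := sqr_ge0 (cnorm y).
by case/orP : xy0 => /cnorm2_gt0; lra.
Qed.

Lemma hpoint_infinity_y x y : y != 0 -> hpoint x y 0 <> pt100 :> P2 R.
Proof.
move=> y0 /hpoint_eqP; rewrite !hvec_neq0 y0 oner_neq0 !orbT.
move=> /(_ isT isT); rewrite /wedge2 !(mulr0, mul0r, mul1r, mulr1, subr0, sub0r, oppr0, cnormN, cnorm0).
by rewrite expr0n/=; move/cnorm2_gt0 : y0; lra.
Qed.

Lemma P2_caseU L : L <> pt100 -> (exists w : C * C, L = embed w) \/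
  (exists x y, y != 0 /\ L = hpoint x y 0).
Proof.
move=> L1; have [|[x [y [xy0 LE]]]] := P2_cases L; first by left.
right; exists x, y; split=> //; apply/eqP => y0.
move: xy0; rewrite y0 eqxx orbF => x0; apply: L1; rewrite LE y0.
by rewrite -(@hpoint_scale _ x^-1) ?invr_eq0// mulVf// !mulr0.
Qed.

Lemma embed_neq_pt100 (w : C * C) : embed w <> pt100.
Proof. by apply: embed_neq_infinity; rewrite oner_neq0. Qed.

(** Points close to the centre (a, b) of an affine chart lie in that chart,
    where their distance to the centre is controlled by the angle; s stands for
    the square of its sine. *)
Lemma chart_estimate (B s : R) (a b a' b' c' : C) :
  0 <= s -> 4 * s * B <= 1 -> hnorm2 a b 1 <= B -> 0 < hnorm2 a' b' c' ->
  cnorm (a * c' - a') ^+ 2 + cnorm (b * c' - b') ^+ 2 <=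
    s * (hnorm2 a b 1 * hnorm2 a' b' c') ->
  c' != 0 /\
  cnorm (a' / c' - a) ^+ 2 + cnorm (b' / c' - b) ^+ 2 <= 4 * s * B ^+ 2.
Proof.
move=> s0 sB hB h'0 le.
have hpos : 1 <= hnorm2 a b 1.
  rewrite /hnorm2 cnorm1 expr1n.
  by have := sqr_ge0 (cnorm a); have := sqr_ge0 (cnorm b); lra.
have B1 : 1 <= B by lra.
have sh : s * hnorm2 a b 1 <= 1 / 4.
  have : s * hnorm2 a b 1 <= s * B by rewrite ler_wpM2l.
  by lra.
have c0 : c' != 0.
  apply/eqP => c0; move: le h'0; rewrite c0 !mulr0 !sub0r !cnormN.
  have -> : hnorm2 a' b' 0 = cnorm a' ^+ 2 + cnorm b' ^+ 2.
    by rewrite /hnorm2 cnorm0 expr0n/= addr0.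
  set k := _ + _ => le k0.
  have : s * hnorm2 a b 1 * k <= 1 / 4 * k by rewrite ler_pM2r.
  by rewrite mulrA in le; lra.
split=> //; have c2 := cnorm2_gt0 c0.
set u := a' / c'; set v := b' / c'.
have aE : a' = c' * u by rewrite /u mulrC divfK.
have bE : b' = c' * v by rewrite /v mulrC divfK.
move: le; rewrite aE bE [a * _]mulrC [b * _]mulrC -!mulrBr !cnormM !exprMn.
rewrite (cnormB a) (cnormB b) -mulrDr.
have -> : hnorm2 (c' * u) (c' * v) c' = cnorm c' ^+ 2 * hnorm2 u v 1.
  by rewrite /hnorm2 !cnormM !exprMn cnorm1; ring.
rewrite [X in _ <= X -> _](_ : _ = cnorm c' ^+ 2 *
  (s * (hnorm2 a b 1 * hnorm2 u v 1))); last by ring.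
rewrite ler_pM2l//; set D := _ + _ => le.
have uD : hnorm2 u v 1 <= 2 * B + 2 * D.
  have tri (p q : C) : cnorm p ^+ 2 <= 2 * cnorm q ^+ 2 + 2 * cnorm (p - q) ^+ 2.
    have := cnormD (p - q) q; rewrite subrK.
    have := cnorm_ge0 p; have := cnorm_ge0 q; have := cnorm_ge0 (p - q).
    by have := sqr_ge0 (cnorm (p - q) - cnorm q); nra.
  move: hB; rewrite /hnorm2 cnorm1 expr1n /D.
  by have := tri u a; have := tri v b; lra.
have D0 : 0 <= D by rewrite addr_ge0 ?sqr_ge0.
have h1 : s * (hnorm2 a b 1 * hnorm2 u v 1) <= s * (B * (2 * B + 2 * D)).
  by rewrite ler_wpM2l// ler_pM ?hnorm2_ge0.
have h2 : s * B * D <= 1 / 4 * D by rewrite ler_wpM2r//; lra.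
have : D <= 2 * s * B ^+ 2 + 2 * (s * B * D).
  by rewrite (le_trans le)// (le_trans h1)//; lra.
by lra.
Qed.

Definition chart010 (u v : C) : P2 R := hpoint u 1 v.

Lemma hvec_chart010 (u v : C) : hvec u 1 v != 0.
Proof. by rewrite hvec_neq0 oner_neq0 orbT. Qed.

(** The embedding of C^2 is open, uniformly on bounded sets. *)
Lemma near_embed (B e : R) : 0 < e -> exists2 d : R, 0 < d &
  forall (w : C * C) L, hnorm2 w.1 w.2 1 <= B -> fubini_study (embed w) L < d ->
  exists w' : C * C, [/\ L = embed w', cnorm (w'.1 - w.1) < e &
    cnorm (w'.2 - w.2) < e].
Proof.
move=> e0; wlog B1 : B / 1 <= B.
  move=> h; have [|d d0 dP] := h (Num.max 1 B); first by rewrite le_max lexx.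
  by exists d => // w L wB; apply: dP; rewrite le_max wB orbT.
have B0 : 0 < B by lra.
pose d := Num.min 1 (Num.min (1 / (4 * B)) (e / (4 * B))).
have d0 : 0 < d by rewrite !lt_min ltr01 !divr_gt0// mulr_gt0.
exists d => // w L wB wL.
have [x [y [z [n0 LE]]]] := P2_hpoint L.
have n1 : hvec w.1 w.2 1 != 0 by rewrite hvec_neq0 oner_neq0 !orbT.
set s := sin (fubini_study (embed w) L).
have s0 : 0 <= s by exact: sin_fs_ge0.
have sd : s < d by exact: le_lt_trans (sin_fs_le _ _) wL.
have /and3P[s1 s2 s3] : [&& s < 1, s * (4 * B) < 1 & s * (4 * B) < e].
  by move: sd; rewrite !lt_min !ltr_pdivlMr ?mulr_gt0// => /and3P[-> -> ->].
have le : cnorm (w.1 * z - x) ^+ 2 + cnorm (w.2 * z - y) ^+ 2 <=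
    s ^+ 2 * (hnorm2 w.1 w.2 1 * hnorm2 x y z).
  rewrite /s {1}LE sin_fubini_study// /wedge2 !mulr1.
  by have := sqr_ge0 (cnorm (w.1 * y - x * w.2)); lra.
have sq : s ^+ 2 <= s by rewrite expr2; nra.
have sB : 4 * s ^+ 2 * B <= 1.
  have : s ^+ 2 * B <= s * B by rewrite ler_pM2r.
  by lra.
have [z0 est] := chart_estimate (sqr_ge0 s) sB wB (hnorm2_gt0 n0) le.
have est2 : 4 * s ^+ 2 * B ^+ 2 < e ^+ 2.
  have : (s * (4 * B)) ^+ 2 < e ^+ 2.
    by rewrite ltr_pXn2r ?nnegrE ?mulr_ge0// ltW.
  have : 0 <= s ^+ 2 * B ^+ 2 by rewrite mulr_ge0 ?sqr_ge0.
  by rewrite !exprMn; lra.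
exists (x / z, y / z); split => /=.
- rewrite LE /embed/= -[RHS](@hpoint_scale _ z)// mulr1.
  by rewrite ![z * (_ / z)]mulrC !divfK.
- rewrite -(@ltr_pXn2r _ 2) ?nnegrE ?cnorm_ge0 ?ltW//.
  by have := sqr_ge0 (cnorm (y / z - w.2)); lra.
- rewrite -(@ltr_pXn2r _ 2) ?nnegrE ?cnorm_ge0 ?ltW//.
  by have := sqr_ge0 (cnorm (x / z - w.1)); lra.
Qed.

Lemma hvec_swap_yz x y z : (hvec x z y != 0) = (hvec x y z != 0).
Proof. by rewrite !hvec_neq0 [(z != 0) || _]orbC. Qed.

Lemma hvec_swap_xy x y z : (hvec y x z != 0) = (hvec x y z != 0).
Proof. by rewrite !hvec_neq0 orbCA. Qed.

Lemma fs_swap_yz x y z x' y' z' : hvec x y z != 0 -> hvec x' y' z' != 0 ->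
  fubini_study (hpoint x z y) (hpoint x' z' y') =
  fubini_study (hpoint x y z) (hpoint x' y' z').
Proof.
move=> n0 n0'; have n1 := n0; have n1' := n0'; rewrite -hvec_swap_yz in n1.
rewrite -hvec_swap_yz in n1'; rewrite (fubini_study_hpoint n1 n1').
rewrite (fubini_study_hpoint n0 n0') /cosangle.
have e a b c a' b' c' : dotmx (hvec a c b) (hvec a' c' b') =
    dotmx (hvec a b c) (hvec a' b' c') :> C by rewrite !dotmx_hvec addrAC.
by rewrite (e x y z x' y' z') (e x y z x y z) (e x' y' z' x' y' z').
Qed.

Lemma fs_swap_xy x y z x' y' z' : hvec x y z != 0 -> hvec x' y' z' != 0 ->
  fubini_study (hpoint y x z) (hpoint y' x' z') =
  fubini_study (hpoint x y z) (hpoint x' y' z').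
Proof.
move=> n0 n0'; have n1 := n0; have n1' := n0'; rewrite -hvec_swap_xy in n1.
rewrite -hvec_swap_xy in n1'; rewrite (fubini_study_hpoint n1 n1').
rewrite (fubini_study_hpoint n0 n0') /cosangle.
have e a b c a' b' c' : dotmx (hvec b a c) (hvec b' a' c') =
    dotmx (hvec a b c) (hvec a' b' c') :> C.
  by rewrite !dotmx_hvec [b * _ + _]addrC.
by rewrite (e x y z x' y' z') (e x y z x y z) (e x' y' z' x' y' z').
Qed.

Lemma near_chart010 (B e : R) : 0 < e -> exists2 d : R, 0 < d &
  forall (u v : C) L, hnorm2 u v 1 <= B -> fubini_study (chart010 u v) L < d ->
  exists u' v', [/\ L = chart010 u' v', cnorm (u' - u) < e & cnorm (v' - v) < e].
Proof.
move=> e0; have [d d0 dP] := near_embed B e0; exists d => // u v L uB.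
have [x [y [z [n0 ->]]]] := P2_hpoint L.
have n1 : hvec u 1 v != 0 := hvec_chart010 u v.
rewrite /chart010 -fs_swap_yz// => /(dP (u, v) _ uB)[[u' v'] [LE ue ve]].
exists u', v'; split=> //; apply/(hpoint_eqP n0 (hvec_chart010 u' v')).
have n2 : hvec x z y != 0 by rewrite hvec_swap_yz.
have n3 : hvec u' v' 1 != 0 by rewrite hvec_swap_yz hvec_chart010.
have /(hpoint_eqP n2 n3) := LE; rewrite /wedge2 => <-.
rewrite (_ : y * v' - 1 * z = - (z * 1 - v' * y)) ?cnormN; ring.
Qed.

(** The involution [x : y : z] |-> [y : x : z], which conjugates the inverse of
    a volume-preserving Henon map to another such map. *)
Definition swapP2 L : P2 R :=
  let v := rep L in hpoint (v 0 1) (v 0 0) (v 0 2%:R).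

Lemma swapP2_hpoint x y z : hvec x y z != 0 ->
  swapP2 (hpoint x y z) = hpoint y x z.
Proof.
move=> n0; rewrite /swapP2; have [c c0 ->] := rep_hpoint n0.
by rewrite !mxE/= hpoint_scale.
Qed.

Lemma swapP2_embed (w : C * C) : swapP2 (embed w) = embed (w.2, w.1).
Proof. by rewrite /embed swapP2_hpoint ?hvec_neq0 ?oner_neq0 ?orbT. Qed.

Lemma swapP2K : involutive swapP2.
Proof.
move=> L; have [x [y [z [n0 ->]]]] := P2_hpoint L.
by rewrite (swapP2_hpoint n0) swapP2_hpoint// hvec_swap_xy.
Qed.

Lemma fs_swapP2 L M : fubini_study (swapP2 L) (swapP2 M) = fubini_study L M.
Proof.
have [x [y [z [n0 ->]]]] := P2_hpoint L.
have [x' [y' [z' [n0' ->]]]] := P2_hpoint M.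
by rewrite (swapP2_hpoint n0) (swapP2_hpoint n0') (fs_swap_xy n0 n0').
Qed.

Lemma swapP2_pt100 : swapP2 pt100 = pt010 :> P2 R.
Proof. by rewrite swapP2_hpoint ?hvec_neq0 ?oner_neq0. Qed.

Lemma swapP2_pt010 : swapP2 pt010 = pt100 :> P2 R.
Proof. by rewrite -swapP2_pt100 swapP2K. Qed.

End ProjectiveCharts.

(** * Compact families of maps near [0 : 1 : 0] *)
Section TameMaps.
Context {R : realType}.
Local Notation C := R[i].
Implicit Types (g : Xplus R) (K : nat).

(** Uniform bounds on the coefficients; every map of a compact family satisfies
    them for a common K. *)
Definition tame K g : Prop :=
  [/\ (size (hpoly g) <= K)%N, cnorm (hshift g) <= K%:R,
      forall i, cnorm (hpoly g)`_i <= K%:R &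
      1 <= K%:R * cnorm (lead_coef (hpoly g))].

Lemma tameW K K' g : (K <= K')%N -> tame K g -> tame K' g.
Proof.
move=> KK' [s a c l]; have KR : K%:R <= K'%:R :> R by rewrite ler_nat.
split=> [||i|]; first exact: leq_trans KK'.
- exact: le_trans KR.
- exact: le_trans (c i) KR.
- by rewrite (le_trans l)// ler_wpM2r ?cnorm_ge0.
Qed.

Lemma tame_gt2 K g : tame K g -> (2 < K)%N.
Proof. by case=> s _ _ _; exact: leq_trans (hpoly_deg g) s. Qed.

Lemma tame_ge3 K g : tame K g -> 3 <= K%:R :> R.
Proof. by move=> /tame_gt2 K2; rewrite ler_nat. Qed.

(** The degree is at least 2, so the leading term beats any multiple of |y|, with
    constants that depend on the bounds for the coefficients only. *)
Lemma tame_growth K (T : R) : 0 <= T -> exists2 R0 : R, 1 <= R0 &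
  forall g, tame K g -> forall y : C, R0 <= cnorm y ->
  T * cnorm y <= cnorm (hpoly g).[y].
Proof.
move=> T0; pose k : R := K%:R.
have k0 : 0 <= k by rewrite ler0n.
exists (k * (T + k ^+ 2) + 1); first by rewrite lerDr mulr_ge0 ?addr_ge0 ?sqr_ge0.
move=> g gK y yR; have k3 := tame_ge3 gK; rewrite -/k in k3.
have [s a c l] := gK; have g2 := hpoly_deg g.
set Y := cnorm y in yR *; have Y0 : 0 <= Y by exact: cnorm_ge0.
have kT : 0 <= k * (T + k ^+ 2) by rewrite mulr_ge0 ?addr_ge0 ?sqr_ge0.
have Y1 : 1 <= Y by lra.
set n := (size (hpoly g)).-1; have nS : size (hpoly g) = n.+1.
  by rewrite prednK// (ltn_trans _ g2).
have n2 : (1 < n)%N by rewrite -ltnS -nS.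
have nk : n%:R <= k by rewrite ler_nat (leq_trans _ s)// nS.
rewrite horner_coef nS big_ord_recr/= addrC.
set S := \sum_(i < n) _.
have -> : (hpoly g)`_n = lead_coef (hpoly g) by rewrite lead_coefE.
set L := lead_coef _ in l *.
have S_le : cnorm S <= k * (k * Y ^+ n.-1).
  apply: (le_trans (cnorm_sum _)).
  apply: (@le_trans _ _ (\sum_(i < n) (k * Y ^+ n.-1))).
    apply: ler_sum => i _; rewrite cnormM cnormX ler_pM ?cnorm_ge0 ?exprn_ge0//.
    by rewrite ler_weXn2l// -ltnS prednK// ltnW.
  rewrite sumr_const card_ord -[_ *+ n]mulr_natl ler_wpM2r//.
  by rewrite mulr_ge0// exprn_ge0.
have Ln : Y ^+ n <= k * cnorm (L * y ^+ n).
  rewrite cnormM cnormX mulrA -[leLHS]mul1r ler_wpM2r// exprn_ge0//.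
have := cnorm_sub_le (L * y ^+ n) (- S); rewrite opprK cnormN.
set p := cnorm (_ + S) => p_ge.
have Yn : Y ^+ n = Y * Y ^+ n.-1 by rewrite -exprS prednK// ltnW.
have Yp : Y <= Y ^+ n.-1.
  by rewrite -[leLHS]expr1 ler_weXn2l// -ltnS prednK// ltnW.
set Z := Y ^+ n.-1 in Yn Yp S_le.
have kp : Y * Z - k * (k * (k * Z)) <= k * p.
  rewrite -Yn; have : k * cnorm S <= k * (k * (k * Z)) by rewrite ler_wpM2l.
  have : k * (cnorm (L * y ^+ n) - cnorm S) <= k * p by rewrite ler_wpM2l.
  by rewrite mulrBr; lra.
have Z0 : 0 <= Z by exact: le_trans Yp.
have kpos : 0 < k by exact: lt_le_trans k3.
rewrite -(ler_pM2l kpos).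
have h1 : k * (T + k ^+ 2) * Z <= Y * Z by rewrite ler_wpM2r//; lra.
have h2 : k * T * Y <= k * T * Z by rewrite ler_wpM2l// mulr_ge0.
by rewrite !mulrA in kp *; nra.
Qed.

Lemma homogenize_scale2 (p : {poly C}) (c y z : C) :
  homogenize p (c * y) (c * z) = c ^+ (size p).-1 * homogenize p y z.
Proof.
rewrite /homogenize mulr_sumr; apply: eq_bigr => i _.
have ip : (i <= (size p).-1)%N.
  by rewrite -ltnS prednK ?(leq_ltn_trans _ (ltn_ord i)).
have -> : c ^+ (size p).-1 = c ^+ i * c ^+ ((size p).-1 - i).
  by rewrite -exprD subnKC.
by rewrite !exprMn; ring.
Qed.

Lemma expr_lip (w w' : C) n : cnorm w <= 1 -> cnorm w' <= 1 ->
  cnorm (w ^+ n - w' ^+ n) <= n%:R * cnorm (w - w').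
Proof.
move=> w1 w1'; elim: n => [|n ih]; first by rewrite !expr0 subrr cnorm0 mul0r.
have -> : w ^+ n.+1 - w' ^+ n.+1 = w * (w ^+ n - w' ^+ n) + (w - w') * w' ^+ n.
  by rewrite !exprS; ring.
rewrite (le_trans (cnormD _ _))// !cnormM cnormX -natr1 mulrDl mul1r.
have := cnorm_ge0 (w - w'); have := cnorm_ge0 (w ^+ n - w' ^+ n).
have : cnorm w' ^+ n <= 1 by rewrite exprn_ile1// cnorm_ge0.
have := exprn_ge0 n (cnorm_ge0 w'); have := cnorm_ge0 w.
move: (cnorm w' ^+ n) (cnorm (w ^+ n - _)) (cnorm (w - w')) ih => e f h ih.
by nra.
Qed.

Lemma homogenize_lip K g (w w' : C) : tame K g ->
  cnorm w <= 1 -> cnorm w' <= 1 ->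
  cnorm (homogenize (hpoly g) 1 w - homogenize (hpoly g) 1 w') <=
  K%:R ^+ 3 * cnorm (w - w').
Proof.
move=> [s a c l] w1 w1'; rewrite /homogenize -sumrB.
apply: (le_trans (cnorm_sum _)).
apply: (@le_trans _ _ (\sum_(i < size (hpoly g)) (K%:R ^+ 2 * cnorm (w - w')))).
  apply: ler_sum => i _; rewrite expr1n mulr1 -mulrBr cnormM expr2 -mulrA.
  rewrite ler_pM ?cnorm_ge0//; apply: le_trans (expr_lip _ w1 w1') _.
  rewrite ler_wpM2r ?cnorm_ge0// ler_nat.
  by rewrite (leq_trans (leq_subr _ _))// (leq_trans (leq_pred _)).
rewrite sumr_const card_ord -[_ *+ _]mulr_natl [K%:R ^+ 3]exprS -mulrA.
by rewrite ler_wpM2r ?mulr_ge0 ?sqr_ge0 ?cnorm_ge0// ler_nat.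
Qed.

(** The extension of g in the chart centred at its superattracting fixed point
    [0 : 1 : 0]. *)
Definition chart_den g (u w : C) : C :=
  homogenize (hpoly g) 1 w - u * w ^+ (size (hpoly g)).-2.

Definition chart_quot g (u w : C) : C :=
  w ^+ (size (hpoly g)).-2 / chart_den g u w.

Definition chart_map g (uw : C * C) : C * C :=
  ((1 + hshift g * uw.2) * chart_quot g uw.1 uw.2,
   uw.2 * chart_quot g uw.1 uw.2).

Lemma extend_chart010 g (u w : C) : hjac g = 1 -> chart_den g u w != 0 ->
  extend g (chart010 u w) =
  chart010 (chart_map g (u, w)).1 (chart_map g (u, w)).2.
Proof.
move=> g1 D0; rewrite /extend /chart010 /chart_map /=.
have [c c0 ->] := rep_hpoint (hvec_chart010 u w); rewrite !mxE/= g1 mul1r.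
rewrite homogenize_scale2 hpolyS /= /chart_quot; move: D0; rewrite /chart_den.
set P := homogenize _ _ _; set n := (size _).-2; set D := P - _ => D0.
rewrite -[RHS](@hpoint_scale _ (c ^+ n.+1 * D)) ?mulf_neq0 ?expf_neq0//.
have qD : w ^+ n / D * D = w ^+ n by rewrite divfK.
have DE : P - u * w ^+ n = D by [].
set q := w ^+ n / D in qD *; clearbody q; clearbody D; rewrite !exprMn.
congr hpoint.
- by rewrite -{1}qD !exprS; ring.
- by rewrite mulr1 -DE !exprS; ring.
- by rewrite exprS [w ^+ n.+1]exprS -{1}qD; ring.
Qed.

End TameMaps.

Section ChartContraction.
Context {R : realType}.
Local Notation C := R[i].
Implicit Types (g : Xplus R) (K : nat).

(** When the degree is 2 the derivative at [0 : 1 : 0] is nilpotent but not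
    zero; giving the second coordinate a large weight makes a single
    application contracting. *)
Definition wnorm (A : R) (a : C * C) : R := cnorm a.1 + A * cnorm a.2.

(** At the centre the denominator is the leading coefficient, which bounds it away
    from 0 nearby; the numerator is small because its exponent, the degree minus
    one, is positive. *)
Lemma chart_quot_lip K g (r : R) (u w u' w' : C) : tame K g -> 0 < r -> r <= 1 ->
  2 * K%:R * (r * (K%:R ^+ 3 + 1)) <= 1 ->
  cnorm u <= 1 -> cnorm u' <= 1 -> cnorm w <= r -> cnorm w' <= r ->
  [/\ chart_den g u w != 0,
    cnorm (chart_quot g u w) <= 2 * K%:R * r &
    cnorm (chart_quot g u w - chart_quot g u' w') <=
      (2 * K%:R ^+ 2 + 4 * K%:R ^+ 2 * (K%:R ^+ 3 + K%:R)) * cnorm (w - w') +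
      4 * K%:R ^+ 2 * r * cnorm (u - u')].
Proof.
move=> gK r0 r1; have k3 := tame_ge3 gK; have [s a c l] := gK.
have nK : ((size (hpoly g)).-2)%:R <= K%:R :> R.
  by rewrite ler_nat (leq_trans _ s)// -subn2 leq_subr.
have n1 : (0 < (size (hpoly g)).-2)%N.
  by have := hpoly_deg g; case: (size _) => [|[|[|]]].
rewrite /chart_quot /chart_den; set n := (size _).-2 in nK n1 *.
set k : R := K%:R in k3 l nK *; set P := homogenize _ 1.
have k0 : 0 < k by lra.
move=> kr u1 u1' wr wr'.
have powle (v : C) : cnorm v <= r -> cnorm (v ^+ n) <= cnorm v.
  move=> vr; rewrite cnormX -[leRHS]expr1 ler_wiXn2l ?cnorm_ge0//.
  exact: le_trans vr r1.
have Dbound (v x : C) : cnorm x <= r -> cnorm v <= 1 ->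
    1 <= 2 * k * cnorm (P x - v * x ^+ n).
  move=> xr v1; have xn := le_trans (powle _ xr) xr.
  have := homogenize_lip gK (le_trans xr r1) (_ : cnorm (0 : C) <= 1).
  rewrite cnorm0 -/k subr0 -/P => /(_ ler01) h1.
  have P0 : P 0 = lead_coef (hpoly g) by rewrite /P homogenize0 expr1n mulr1.
  have h2 : cnorm (v * x ^+ n) <= r.
    by rewrite cnormM -[leRHS]mul1r ler_pM ?cnorm_ge0.
  have h3 : k ^+ 3 * cnorm x <= k ^+ 3 * r.
    by rewrite ler_wpM2l ?exprn_ge0// ltW.
  have h4 : cnorm (lead_coef (hpoly g)) <=
      cnorm (P x - v * x ^+ n) + (k ^+ 3 * r + r).
    have := cnormD (P x - v * x ^+ n) (v * x ^+ n - (P x - P 0)).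
    have -> : P x - v * x ^+ n + (v * x ^+ n - (P x - P 0)) = P 0 by ring.
    have := cnormB_le (v * x ^+ n) (P x - P 0).
    by rewrite P0; move: h1 h2 h3; rewrite P0; clear; lra.
  have h5 : k * cnorm (lead_coef (hpoly g)) <=
      k * (cnorm (P x - v * x ^+ n) + (k ^+ 3 * r + r)).
    by rewrite ler_pM2l.
  by move: h5 l kr; clear; rewrite !mulrDr; lra.
have nz (v x : C) : cnorm x <= r -> cnorm v <= 1 -> P x - v * x ^+ n != 0.
  move=> xr v1; apply/eqP => D0; have := Dbound v x xr v1.
  by rewrite D0 cnorm0 mulr0 ler10.
have Ibound (v x : C) : cnorm x <= r -> cnorm v <= 1 ->
    cnorm (P x - v * x ^+ n)^-1 <= 2 * k.
  move=> xr v1; rewrite cnormV -[_^-1]mul1r ler_pdivrMr ?cnorm_gt0 ?nz//.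
  exact: Dbound.
have D1 := nz _ _ wr u1; have D1' := nz _ _ wr' u1'.
have I1 := Ibound _ _ wr u1; have I1' := Ibound _ _ wr' u1'.
split=> //.
  by rewrite cnormM mulrC ler_pM ?cnorm_ge0// (le_trans (powle _ wr)).
set X := w ^+ n; set X' := w' ^+ n.
set D := P w - u * X in D1 I1 *; set D' := P w' - u' * X' in D1' I1' *.
have -> : X / D - X' / D' = (X - X') * D^-1 + X' * (D' - D) * (D^-1 * D'^-1).
  by field; rewrite D1 D1'.
set dw := cnorm (w - w'); set du := cnorm (u - u').
have dw0 : 0 <= dw by exact: cnorm_ge0.
have du0 : 0 <= du by exact: cnorm_ge0.
have dX : cnorm (X - X') <= k * dw.
  apply: le_trans (expr_lip n (le_trans wr r1) (le_trans wr' r1)) _.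
  by rewrite ler_wpM2r.
have X'r : cnorm X' <= r := le_trans (powle _ wr') wr'.
have dD : cnorm (D' - D) <= (k ^+ 3 + k) * dw + r * du.
  have -> : D' - D = (u * (X - X') + (u - u') * X') - (P w - P w').
    by rewrite /D /D'; ring.
  rewrite (le_trans (cnormB_le _ _))//.
  have := homogenize_lip gK (le_trans wr r1) (le_trans wr' r1).
  rewrite -/P -/k -/dw => h1.
  have := cnormD (u * (X - X')) ((u - u') * X'); rewrite !cnormM -/du => h2.
  have h3 : cnorm u * cnorm (X - X') <= 1 * (k * dw).
    by rewrite ler_pM ?cnorm_ge0.
  have h4 : du * cnorm X' <= du * r by rewrite ler_wpM2l.
  by move: h1 h2 h3 h4; clear; lra.
rewrite (le_trans (cnormD _ _))// !cnormM.
have e1 : cnorm (X - X') * cnorm D^-1 <= (k * dw) * (2 * k).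
  by rewrite ler_pM ?cnorm_ge0.
have e2 : cnorm X' * cnorm (D' - D) * (cnorm D^-1 * cnorm D'^-1) <=
    r * ((k ^+ 3 + k) * dw + r * du) * ((2 * k) * (2 * k)).
  rewrite ler_pM ?mulr_ge0 ?cnorm_ge0//; first by rewrite ler_pM ?cnorm_ge0.
  by rewrite ler_pM ?cnorm_ge0.
have e3 : r * ((k ^+ 3 + k) * dw + r * du) * ((2 * k) * (2 * k)) <=
    (1 * ((k ^+ 3 + k) * dw) + r * du) * ((2 * k) * (2 * k)).
  have f1 : r * ((k ^+ 3 + k) * dw) <= 1 * ((k ^+ 3 + k) * dw).
    by rewrite ler_wpM2r// mulr_ge0// addr_ge0 ?exprn_ge0// ltW.
  have f2 : r * (r * du) <= 1 * (r * du) by rewrite ler_wpM2r// mulr_ge0// ltW.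
  have k2 : 0 <= 2 * k * (2 * k) by rewrite mulr_ge0// mulr_ge0// ltW.
  rewrite ler_wpM2r//.
  by move: f1 f2; clear; rewrite mulrDr; lra.
by move: e1 e2 e3; clear; lra.
Qed.

(** The weight A absorbs the derivative in w of the first coordinate, and r is so
    small that the remaining derivatives are small: the four summands of 1 / r
    are used one by one. *)
Lemma chart_contraction K : exists A r : R, [/\ 1 <= A, 0 < r, r <= 1 &
  forall g, tame K g -> forall a b : C * C, wnorm A a < r -> wnorm A b < r ->
  chart_den g a.1 a.2 != 0 /\
  wnorm A (chart_map g a - chart_map g b) <= 1 / 2 * wnorm A (a - b)].
Proof.
have [K3|K3] := leqP 3 K; last first.
  exists 1, 1; split=> // g /tame_gt2; rewrite ltnNge; have : (K <= 2)%N by [].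
  by move=> ->.
pose k : R := K%:R; have k3 : 3 <= k by rewrite ler_nat.
have k0 : 0 < k by lra.
pose A1 : R := 2 * k ^+ 2 + 4 * k ^+ 2 * (k ^+ 3 + k).
pose A : R := 4 * ((1 + k) * A1 + 2 * k ^+ 2).
have kn n : 1 <= k ^+ n by rewrite exprn_ege1//; lra.
have A10 : 0 <= A1.
  by rewrite /A1 addr_ge0 ?mulr_ge0 ?addr_ge0 ?exprn_ge0// ltW.
have A1' : 1 <= A.
  have : 0 <= (1 + k) * A1 by rewrite mulr_ge0//; lra.
  by rewrite /A; have := kn 2; lra.
pose m1 : R := 2 * k * (k ^+ 3 + 1); pose m2 : R := 16 * k ^+ 2 * (1 + k).
pose m3 : R := 4 * (A1 + 2 * k); pose m4 : R := 16 * A * k ^+ 2.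
have m10 : 1 <= m1.
  have : 1 <= k * k ^+ 3 by rewrite -exprS.
  by rewrite /m1; lra.
have m20 : 0 <= m2 by rewrite /m2 mulr_ge0 ?mulr_ge0 ?sqr_ge0//; lra.
have m30 : 0 <= m3 by rewrite /m3; lra.
have A0 : 0 <= A by exact: le_trans A1'.
have m40 : 0 <= m4 by rewrite /m4 mulr_ge0 ?sqr_ge0// mulr_ge0.
pose r := (m1 + m2 + m3 + m4)^-1.
have r0 : 0 < r by rewrite invr_gt0; lra.
have rm : r * (m1 + m2 + m3 + m4) = 1 by rewrite mulVf// gt_eqF//; lra.
have rm1 : 0 <= r * m1 by rewrite mulr_ge0//; lra.
have rm2 : 0 <= r * m2 by rewrite mulr_ge0//; lra.
have rm3 : 0 <= r * m3 by rewrite mulr_ge0//; lra.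
have rm4 : 0 <= r * m4 by rewrite mulr_ge0//; lra.
rewrite !mulrDr in rm.
have le2 : r * m2 <= 1 by move: rm rm1 rm3 rm4; clear; lra.
have le3 : r * m3 <= 1 by move: rm rm1 rm2 rm4; clear; lra.
have le4 : r * m4 <= 1 by move: rm rm1 rm2 rm3; clear; lra.
have r1 : r <= 1.
  have : r * 1 <= r * m1 by rewrite ler_pM2l.
  by lra.
exists A, r; split=> // g gK [u w] [u' w']; rewrite /wnorm /= => ar br.
have small (v x : C) : cnorm v + A * cnorm x < r -> cnorm v <= 1 /\ cnorm x <= r.
  move=> h; have : 1 * cnorm x <= A * cnorm x by rewrite ler_wpM2r ?cnorm_ge0.
  by have := cnorm_ge0 v; have := cnorm_ge0 x; split; lra.
have [u1 wr] := small _ _ ar; have [u1' wr'] := small _ _ br.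
have kr : 2 * k * (r * (k ^+ 3 + 1)) <= 1.
  have -> : 2 * k * (r * (k ^+ 3 + 1)) = r * m1 by rewrite /m1; ring.
  by move: rm rm2 rm3 rm4; clear; lra.
have [D0 q dq] := chart_quot_lip gK r0 r1 kr u1 u1' wr wr'.
have [_ q' _] := chart_quot_lip gK r0 r1 kr u1' u1 wr' wr.
have [_ a _ _] := gK.
split=> //.
rewrite -/k -/A1 in q q' dq a.
set Q := chart_quot g u w in q dq *; set Q' := chart_quot g u' w' in q' dq *.
clearbody Q Q'.
set al := hshift g in a *.
set dw := cnorm (w - w') in dq *; set du := cnorm (u - u') in dq *.
have dw0 : 0 <= dw by exact: cnorm_ge0.
have du0 : 0 <= du by exact: cnorm_ge0.
have -> : (1 + al * w) * Q - (1 + al * w') * Q' =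
    (1 + al * w) * (Q - Q') + al * (w - w') * Q' by ring.
have -> : w * Q - w' * Q' = w * (Q - Q') + (w - w') * Q' by ring.
have e1 : cnorm ((1 + al * w) * (Q - Q') + al * (w - w') * Q') <=
    (1 + k) * (A1 * dw + 4 * k ^+ 2 * r * du) + k * dw * (2 * k * 1).
  rewrite (le_trans (cnormD _ _))// !cnormM lerD// ler_pM ?mulr_ge0 ?cnorm_ge0//.
  - rewrite (le_trans (cnormD _ _))// cnorm1 lerD2l cnormM -[leRHS]mulr1.
    by rewrite ler_pM ?cnorm_ge0// (le_trans wr).
  - by rewrite ler_pM ?cnorm_ge0.
  - by rewrite (le_trans q')// ler_pM2l// mulr_gt0.
have e2 : cnorm (w * (Q - Q') + (w - w') * Q') <=
    r * (A1 * dw + 4 * k ^+ 2 * 1 * du) + dw * (2 * k * r).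
  rewrite (le_trans (cnormD _ _))// !cnormM lerD// ler_pM ?cnorm_ge0//.
  rewrite (le_trans dq)// lerD2l ler_wpM2r// ler_wpM2l// mulr_ge0 ?sqr_ge0//.
have e3 : A * cnorm (w * (Q - Q') + (w - w') * Q') <=
    A * (r * (A1 * dw + 4 * k ^+ 2 * 1 * du) + dw * (2 * k * r)).
  by rewrite ler_wpM2l//; lra.
have b2 : r * m2 * du <= 1 * du by rewrite ler_wpM2r.
have b3 : r * m3 * (A * dw) <= 1 * (A * dw).
  by rewrite ler_wpM2r// mulr_ge0.
have b4 : r * m4 * du <= 1 * du by rewrite ler_wpM2r.
have AE : A * dw = 4 * ((1 + k) * A1 * dw + 2 * k ^+ 2 * dw).
  by rewrite {1}/A; ring.
move: e1 e3 b2 b3 b4 AE; rewrite /m2 /m3 /m4.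
by clearbody A A1; clearbody r; clear; lra.
Qed.

End ChartContraction.

(** * Topology of the plane and of the space of maps *)
Section C2Topology.
Context {R : realType}.
Local Notation C := R[i].

Lemma nbhs_CP (x : C) (A : set C) : nbhs x A <->
  exists2 e : R, 0 < e & forall x', cnorm (x' - x) < e -> A x'.
Proof.
split=> [xA|[e e0 eA]].
  apply: contrapT => nA; have choose (n : nat) : exists x' : C,
      cnorm (x' - x) < n.+1%:R^-1 /\ ~ A x'.
    apply: contrapT => h; apply: nA; exists n.+1%:R^-1 => // x' xx'.
    by apply: contrapT => nAx; apply: h; exists x'.
  have [u uP] := boolp.choice choose.
  have ux : u n @[n --> \oo] --> x.
    apply/near_cnormP => e e0; near=> n.
    rewrite cnormB (lt_trans (uP n).1)//.
    by near: n; exact: near_infty_natSinv_lt (PosNum e0).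
  have [n _ /(_ n (leqnn n))] := ux _ xA.
  exact: (uP n).2.
have xe := (@near_cnormP R C (nbhs x) _ id x).1 cvg_id e e0.

have sub : [set x' | cnorm (x - x') < e] `<=` A.
  by move=> x' xx'; apply: eA; rewrite cnormB.
have xA := @filterS _ _ (@nbhs_filter _ x) _ _ sub; apply: xA; exact: xe.
Unshelve. all: by end_near. Qed.

Lemma nbhs_C2P (z : C * C) (A : set (C * C)) : nbhs z A <->
  exists2 e : R, 0 < e & forall z',
    cnorm (z'.1 - z.1) < e -> cnorm (z'.2 - z.2) < e -> A z'.
Proof.
split=> [[[U V] /= [/nbhs_CP[e e0 eU] /nbhs_CP[f f0 fV]] UV]|[e e0 eA]].
  exists (Num.min e f); first by rewrite lt_min e0.
  move=> z'; rewrite !lt_min => /andP[z1 _] /andP[_ z2].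
  by apply: UV; split; [exact: eU|exact: fV].
exists ([set x | cnorm (x - z.1) < e], [set x | cnorm (x - z.2) < e]) => /=.
  by split; apply/nbhs_CP; exists e.
by move=> z' [z1 z2]; exact: eA.
Qed.

Lemma open_C2P (A : set (C * C)) : open A <-> forall z, A z ->
  exists2 e : R, 0 < e & forall z',
    cnorm (z'.1 - z.1) < e -> cnorm (z'.2 - z.2) < e -> A z'.
Proof.
by split=> h; [move=> z Az; apply/nbhs_C2P; apply: open_nbhs_nbhs|
  rewrite openE => z /h/nbhs_C2P].
Qed.

Lemma cvg_CP T (F : set_system T) {FF : Filter F} (u : T -> C) (l : C) :
  u @ F --> l <-> forall e : R, 0 < e -> \forall n \near F, cnorm (u n - l) < e.
Proof.
split=> [/near_cnormP h e /h|h]; first by apply: filterS => n; rewrite cnormB.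
by apply/near_cnormP => e /h; apply: filterS => n; rewrite cnormB.
Qed.

Lemma cvg_C2 T (F : set_system T) {FF : Filter F} (u : T -> C * C) (l : C * C) :
  (fun t => (u t).1) @ F --> l.1 -> (fun t => (u t).2) @ F --> l.2 -> u @ F --> l.
Proof.
move=> /cvg_CP u1 /cvg_CP u2 A /nbhs_C2P[e e0 eA].
by apply: filterS2 (u1 e e0) (u2 e e0) => t; exact: eA.
Qed.

Lemma continuous_cnorm : continuous (@cnorm R : C -> R).
Proof.
move=> x A /nbhs_ballP[e e0 eA]; apply/nbhs_CP; exists e => // y xy; apply: eA.
rewrite /ball/= ltr_norml.
have := cnorm_sub_le x y; have := cnorm_sub_le y x; rewrite [cnorm (x - y)]cnormB.
by move=> h1 h2; apply/andP; split; lra.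
Qed.

Definition complex_of_pair (t : R * R) : C := (t.1 +i* t.2)%C.

Lemma continuous_complex_of_pair : continuous complex_of_pair.
Proof.
move=> [a b]; apply/cvg_CP => e e0.
have e2 : 0 < e / 2 by rewrite divr_gt0.
have : nbhs (a, b) (ball a (e / 2) `*` ball b (e / 2)).
  by exists (ball a (e / 2), ball b (e / 2)) => //=; split; exact: nbhsx_ballx.
apply: filterS => -[a' b'] [/= aa bb].
rewrite (le_lt_trans (cnorm_le_ReIm _))//=.
rewrite /ball/= distrC in aa; rewrite /ball/= distrC in bb.
by rewrite -!/(_ - _); lra.
Qed.

Definition c2_of_r4 (t : (R * R) * (R * R)) : C * C :=
  (complex_of_pair t.1, complex_of_pair t.2).

Lemma continuous_c2_of_r4 : continuous c2_of_r4.
Proof.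
move=> t; apply: cvg_C2.
  apply: (@continuous_comp _ _ _ fst complex_of_pair); first exact: cvg_fst.
  exact: continuous_complex_of_pair.
apply: (@continuous_comp _ _ _ snd complex_of_pair); first exact: cvg_snd.
exact: continuous_complex_of_pair.
Qed.

Definition bidisk (r : R) : set (C * C) :=
  [set z | cnorm z.1 <= r /\ cnorm z.2 <= r].

Lemma closed_bidisk r : closed (bidisk r).
Proof.
have -> : bidisk r = (fun z => cnorm z.1) @^-1` [set x | x <= r] `&`
  (fun z => cnorm z.2) @^-1` [set x | x <= r] by [].
apply: closedI; apply: preimage_closed; try exact: closed_le.
- move=> z _; apply: (@continuous_comp _ _ _ fst (@cnorm R)); first exact: cvg_fst.
  exact: continuous_cnorm.
- move=> z _; apply: (@continuous_comp _ _ _ snd (@cnorm R)); first exact: cvg_snd.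
  exact: continuous_cnorm.
Qed.

Lemma compact_bidisk r : compact (bidisk r).
Proof.
pose I : set R := `[- r, r]%classic.
have cI : compact ((I `*` I) `*` (I `*` I)).
  by do 2 apply: compact_setX; apply: segment_compact.
apply: (@subclosed_compact _ _ (c2_of_r4 @` ((I `*` I) `*` (I `*` I)))).
- exact: closed_bidisk.
- apply: continuous_compact => //; apply: continuous_subspaceT.
  exact: continuous_c2_of_r4.
- move=> [[a b] [c d]] [/= z1 z2]; exists ((a, b), (c, d)) => //=.
  have := Re_le_cnorm (a +i* b)%C; have := Im_le_cnorm (a +i* b)%C.
  have := Re_le_cnorm (c +i* d)%C; have := Im_le_cnorm (c +i* d)%C.
  move=> /= h1 h2 h3 h4.
  by split; split; rewrite /I set_itvE/= -ler_norml;
    [exact: le_trans h4 z1|exact: le_trans h3 z1|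
     exact: le_trans h2 z2|exact: le_trans h1 z2].
Qed.

End C2Topology.

Lemma nbhs_Xplus1_pfilter (R : realType) (g : Xplus1 R) : ProperFilter (nbhs g).
Proof. exact: nbhs_pfilter. Qed.
#[local] Existing Instance nbhs_Xplus1_pfilter.

Section XplusTopologyFacts.
Context {R : realType}.
Local Notation C := R[i].
Implicit Types (g : Xplus1 R).

Lemma ball_Xplus1 g (e : R) g' : ball g e g' <-> ball (Xplus1_val g) e (Xplus1_val g').
Proof. by []. Qed.

Lemma Xplus1_val_inj : injective (@Xplus1_val R).
Proof. by move=> g g' /val_inj. Qed.

Lemma hjac1 g : hjac (Xplus1_val g) = 1.
Proof. by case: g => f fP /=; exact: (set_mem fP). Qed.

Lemma near_size g :
  \forall g' \near g, size (hpoly (Xplus1_val g')) = size (hpoly (Xplus1_val g)).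
Proof.
have := nbhsx_ballx g 1 ltr01.
by apply: filterS => g' /ball_Xplus1[].
Qed.

Lemma continuous_hshift : continuous (fun g => hshift (Xplus1_val g)).
Proof.
move=> g; apply/(cvg_CP (FF := nbhs_filter g)) => e e0.
by have := nbhsx_ballx g e e0; apply: filterS => g' /ball_Xplus1[]; rewrite cnormB.
Qed.

Lemma continuous_hcoef i : continuous (fun g => (hpoly (Xplus1_val g))`_i).
Proof.
move=> g; apply/(cvg_CP (FF := nbhs_filter g)) => e e0.
have := nbhsx_ballx g e e0; apply: filterS => g' /ball_Xplus1[_ _ _ c].
by rewrite cnormB; exact: c.
Qed.

(** Half of the leading coefficient survives a perturbation of the map. *)
Lemma tame_ball g : exists K (e : R), 0 < e /\
  forall g', ball g e g' -> tame K (Xplus1_val g').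
Proof.
set f := Xplus1_val g; set l := cnorm (lead_coef (hpoly f)).
have l0 : 0 < l.
  by rewrite cnorm_gt0 lead_coef_eq0 -size_poly_gt0 (ltn_trans _ (hpoly_deg f)).
pose S : R := \sum_(i < size (hpoly f)) cnorm (hpoly f)`_i.
have S0 : 0 <= S by apply: sumr_ge0 => i _; exact: cnorm_ge0.
have a0 := cnorm_ge0 (hshift f).
pose M : R := (size (hpoly f))%:R + cnorm (hshift f) + S + 1 + 2 / l.
have l20 : 0 <= 2 / l by rewrite divr_ge0 ?ltW.
have n0 : 0 <= (size (hpoly f))%:R :> R by [].
have M0 : 0 <= M by rewrite /M !addr_ge0.
exists (Num.bound M), (Num.min 1 (l / 2)).
have MK : M <= (Num.bound M)%:R by rewrite ltW// archi_boundP.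
split; first by rewrite lt_min ltr01 divr_gt0.
move=> g' /ball_Xplus1; rewrite -/f; set f' := Xplus1_val g'.
case; rewrite !lt_min => s /andP[a _] _ c.
have cl i : cnorm ((hpoly f)`_i - (hpoly f')`_i) < 1 /\
    cnorm ((hpoly f)`_i - (hpoly f')`_i) < l / 2.
  by have := c i; rewrite lt_min => /andP.
split.
- rewrite -s -(ler_nat R); apply: le_trans MK.
  by rewrite /M; move: a0 S0 l20; clear; lra.
- apply: le_trans MK; have := cnorm_triangle (hshift f) (hshift f') 0.
  rewrite !subr0 cnormB => h; move: h a S0 n0 l20 a0; rewrite /M; clear; lra.
- move=> i; apply: le_trans MK.
  have Si : cnorm (hpoly f)`_i <= S.
    have [li|il] := ltnP i (size (hpoly f)); last first.
      by rewrite nth_default// cnorm0.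
    rewrite /S (bigD1 (Ordinal li))//= lerDl.
    by apply: sumr_ge0 => j _; exact: cnorm_ge0.
  have := cnorm_triangle (hpoly f)`_i (hpoly f')`_i 0.
  rewrite !subr0 cnormB => h; have [h' _] := cl i.
  by move: h h' Si S0 n0 l20 a0; rewrite /M; clear; lra.
- have -> : lead_coef (hpoly f') = (hpoly f')`_(size (hpoly f)).-1.
    by rewrite lead_coefE s.
  have [_] := cl (size (hpoly f)).-1; rewrite -lead_coefE => h.
  have h1 : l / 2 <= cnorm (hpoly f')`_(size (hpoly f)).-1.
    have := cnorm_sub_le (lead_coef (hpoly f))
      (lead_coef (hpoly f) - (hpoly f')`_(size (hpoly f)).-1).
    by rewrite subKr -/l; move: h; rewrite -/l; lra.
  have h2 : 1 <= M * (l / 2).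
    have : 2 / l * (l / 2) <= M * (l / 2).
      rewrite ler_wpM2r ?divr_ge0 ?ltW//.
      by rewrite /M; move: S0 n0 a0 l20; clear; lra.
    by apply: le_trans; rewrite mulrA divfK ?gt_eqF// divff.
  by rewrite (le_trans h2)// ler_pM// divr_ge0 ?ltW.
Qed.

Lemma tame_compact (G : set (Xplus1 R)) : compact G ->
  exists K (e : R), 0 < e /\
  forall g g', G g -> ball g e g' -> tame K (Xplus1_val g').
Proof.
move/compact_near_coveringP => cG.
have /(_ _)[|N _ NP] := cG nat \oo
  (fun n g => forall g', ball g n.+1%:R^-1 g' -> tame n (Xplus1_val g')) _.
  move=> g _; have [K [e [e0 gK]]] := tame_ball g.
  have e20 : 0 < e / 2 by rewrite divr_gt0.
  exists (ball g (e / 2), [set n | (K <= n)%N /\ n.+1%:R^-1 < e / 2]).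
    split=> /=; first by apply: nbhsx_ballx; rewrite divr_gt0.
    near=> n; split; first by near: n; exact: nbhs_infty_ge.
    by near: n; exact: near_infty_natSinv_lt (PosNum e20).
  move=> [g1 n] [/= gg1 [Kn ne]] g' g1g'; apply: (tameW Kn); apply: gK.
  by rewrite (splitr e); apply: ball_triangle gg1 _; apply: le_ball g1g'; exact: ltW.
exists N, N.+1%:R^-1; split=> // g g' Gg.
exact: (NP N (leqnn N) g Gg g').
Unshelve. all: by end_near. Qed.

End XplusTopologyFacts.

(** * Escape to infinity and steering *)
Section Filtration.
Context {R : realType}.
Local Notation C := R[i].
Implicit Types (g : Xplus1 R) (z : C * C) (r : R).

Definition hen g z : C * C := henon (Xplus1_val g) z.

Lemma henE g z : hen g z =
  (z.2 + hshift (Xplus1_val g), (hpoly (Xplus1_val g)).[z.2] - z.1).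
Proof. by rewrite /hen /henon hjac1 mul1r. Qed.

(** The region from which the maps of a compact family push all points off to
    [0 : 1 : 0]. *)
Definition escaping r : set (C * C) :=
  [set z | r < cnorm z.2 /\ cnorm z.1 < cnorm z.2].

Definition good r g : Prop := [/\ 1 <= r, cnorm (hshift (Xplus1_val g)) <= r &
  forall y : C, r <= cnorm y -> 8 * cnorm y <= cnorm (hpoly (Xplus1_val g)).[y]].

Lemma tame_good K : exists r, forall g, tame K (Xplus1_val g) -> good r g.
Proof.
have [r r1 rP] := @tame_growth R K 8 (ler0n _ _).
exists (r + K%:R) => g gK; have K0 : 0 <= K%:R :> R by exact: ler0n.
split; first by lra.
- by have [_ a _ _] := gK; lra.
- by move=> y yr; apply: rP gK _ _; lra.
Qed.

Lemma goodW (r r' : R) g : r <= r' -> good r g -> good r' g.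
Proof.
move=> rr [h1 h2 h3]; split; [exact: le_trans rr|exact: le_trans rr|].
by move=> y /(le_trans rr)/h3.
Qed.

Lemma compact_good (G : set (Xplus1 R)) : compact G ->
  exists r : R, forall g, G g -> good r g.
Proof.
move=> /tame_compact[K [e [e0 tK]]]; have [r gr] := tame_good K.
by exists r => g Gg; apply: gr; apply: tK Gg _; exact: ballxx.
Qed.

Lemma escaping_step r g z : good r g -> escaping (2 * r) z ->
  [/\ escaping (2 * r) (hen g z), 7 * cnorm z.2 <= cnorm (hen g z).2 &
    cnorm (hen g z).1 <= 2 * cnorm z.2].
Proof.
move=> [r1 a p] [z2 z1]; rewrite henE /=.
have := p z.2; have := cnorm_sub_le (hpoly (Xplus1_val g)).[z.2] z.1.
have := cnormD z.2 (hshift (Xplus1_val g)).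
by move=> h1 h2 /(_ _) h3; have {}h3 := h3 ltac:(lra); split; [split|..]; rewrite /=; lra.
Qed.

(** For the image to have a dominating first coordinate, the large value of the
    polynomial must be compensated by a large x. *)
Lemma backward_step r g z : good r g -> 2 * r <= cnorm (hen g z).1 ->
  cnorm (hen g z).2 <= cnorm (hen g z).1 -> 3 * cnorm (hen g z).1 <= cnorm z.1.
Proof.
move=> [r1 a p]; rewrite henE /= => x1 x2.
have := p z.2; have := cnormD (hpoly (Xplus1_val g)).[z.2] (- z.1).
have := cnorm_triangle z.1 (hpoly (Xplus1_val g)).[z.2] 0; rewrite !subr0.
have := cnormD z.2 (hshift (Xplus1_val g)).
by move=> h1 h2 h3 h4; have {}h4 := h4 ltac:(lra); lra.
Qed.

Fixpoint orbit (gam : nat -> Xplus1 R) (n : nat) z : C * C :=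
  if n is k.+1 then hen (gam k) (orbit gam k z) else z.

Lemma orbit_escaping r gam n m z : (forall k, good r (gam k)) ->
  escaping (2 * r) (orbit gam n z) ->
  escaping (2 * r) (orbit gam (n + m) z) /\
  7 ^+ m <= cnorm (orbit gam (n + m) z).2.
Proof.
move=> gr zn; elim: m => [|m [ih1 ih2]].
  rewrite addn0 expr0; split=> //; have [r1 _ _] := gr 0%N.
  by case: zn => h _; lra.
rewrite addnS /=; have [h1 h2 _] := escaping_step (gr (n + m)%N) ih1.
by split=> //; rewrite exprS; lra.
Qed.

Lemma exp7_large (M : R) : exists m : nat, M < 7 ^+ m.
Proof.
exists (Num.bound `|M|); apply: (le_lt_trans (ler_norm _)).
apply: (lt_le_trans (archi_boundP (normr_ge0 M))).
rewrite -natrX ler_nat; apply: ltnW; exact: ltn_expl.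
Qed.

(** Outside of the escaping region a large first coordinate comes from one that
    is three times as large ([backward_step]), so that it cannot exceed its
    initial value. *)
Lemma orbit_bounded r gam z n : (forall k, good r (gam k)) ->
  (forall k, (k <= n)%N -> ~ escaping (2 * r) (orbit gam k z)) ->
  bidisk (Num.max (cnorm z.1) (2 * r)) (orbit gam n z).
Proof.
move=> gr nz; set M := Num.max _ _.
have Mr : 2 * r <= M by rewrite le_max lexx orbT.
have y_of_x (w : C * C) : ~ escaping (2 * r) w -> cnorm w.1 <= M -> cnorm w.2 <= M.
  move=> nw w1; have [le|lt] := leP (cnorm w.2) (2 * r); first exact: le_trans Mr.
  have [le|lt'] := leP (cnorm w.2) (cnorm w.1); first exact: le_trans w1.
  by case: nw.
suff x_le : cnorm (orbit gam n z).1 <= M by split=> //; apply: y_of_x => //; apply: nz.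
elim: n nz => [|n ih] nz; first by rewrite le_max lexx.
have {}ih := ih (fun k kn => nz k (leqW kn)).
have [le|lt] := leP (cnorm (orbit gam n.+1 z).1) (2 * r); first exact: le_trans Mr.
have := nz n.+1 (leqnn _) => nzn.
have [le2|lt2] := leP (cnorm (orbit gam n.+1 z).2) (cnorm (orbit gam n.+1 z).1).
  have := backward_step (gr n) (ltW lt) le2.
  by have := cnorm_ge0 (orbit gam n.+1 z).1; rewrite /= in lt *; lra.
by case: nzn; split=> //; exact: lt_trans lt2.
Qed.

(** While an orbit stays out of both sets, its first coordinate is at least
    2 * r and is divided by at least 3 at each step. *)
Lemma orbit_enters r gam z : (forall k, good r (gam k)) ->
  exists n, escaping (2 * r) (orbit gam n z) \/ bidisk (2 * r) (orbit gam n z).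
Proof.
move=> gr; apply: contrapT => nz.
have big n : 2 * r < cnorm (orbit gam n z).1 /\
    cnorm (orbit gam n z).2 <= cnorm (orbit gam n z).1.
  have ne : ~ escaping (2 * r) (orbit gam n z) by move=> e; apply: nz; exists n; left.
  have nb : ~ bidisk (2 * r) (orbit gam n z) by move=> e; apply: nz; exists n; right.
  have [le|lt] := leP (cnorm (orbit gam n z).2) (2 * r).
    have lt : 2 * r < cnorm (orbit gam n z).1.
      by rewrite ltNge; apply/negP => h; apply: nb.
    by split=> //; rewrite (le_trans le)// ltW.
  have [le'|lt'] := leP (cnorm (orbit gam n z).2) (cnorm (orbit gam n z).1).
    by split=> //; exact: lt_le_trans le'.
  by case: ne.
have shrink n : 3 ^+ n * cnorm (orbit gam n z).1 <= cnorm z.1.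
  elim: n => [|n ih]; first by rewrite expr0 mul1r.
  apply: le_trans ih; rewrite exprSr -mulrA ler_wpM2l ?exprn_ge0//.
  by have [b1 b2] := big n.+1; apply: (backward_step (gr n)) => //; exact: ltW.
have [r1 _ _] := gr 0%N; pose n := Num.bound (cnorm z.1).
have := shrink n; apply/negP; rewrite -ltNge.
apply: (lt_le_trans (archi_boundP (cnorm_ge0 _))).
have [b1 _] := big n; rewrite -[leLHS]mulr1 ler_pM//; last by lra.
by rewrite -natrX ler_nat; apply: ltnW; exact: ltn_expl.
Qed.

End Filtration.

Section ComplexLimits.
Context {R : realType} {T : Type} (F : set_system T) {FF : Filter F}.
Implicit Types (u v : T -> R[i]) (a b : R[i]).

Lemma cvg_CD u v a b : u @ F --> a -> v @ F --> b ->
  (fun t => u t + v t) @ F --> a + b.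
Proof. exact: cvgD. Qed.

Lemma cvg_CB u v a b : u @ F --> a -> v @ F --> b ->
  (fun t => u t - v t) @ F --> a - b.
Proof. exact: cvgB. Qed.

Lemma cvg_CM u v a b : u @ F --> a -> v @ F --> b ->
  (fun t => u t * v t) @ F --> a * b.
Proof. exact: cvgM. Qed.

Lemma cvg_CX u a n : u @ F --> a -> (fun t => u t ^+ n) @ F --> a ^+ n.
Proof.
move=> ua; elim: n => [|n ih].
  by rewrite expr0; under eq_fun do rewrite expr0; exact: cvg_cst.
by rewrite exprS; under eq_fun do rewrite exprS; exact: cvg_CM.
Qed.

Lemma cvg_Csum n (u : 'I_n -> T -> R[i]) (a : 'I_n -> R[i]) :
  (forall i, u i @ F --> a i) -> (fun t => \sum_i u i t) @ F --> \sum_i a i.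
Proof.
elim: n u a => [|n ih] u a ua.
  by rewrite big_ord0; under eq_fun do rewrite big_ord0; exact: cvg_cst.
rewrite big_ord_recr /=; under eq_fun do rewrite big_ord_recr /=.
by apply: cvg_CD => //; apply: ih => i; exact: ua.
Qed.

End ComplexLimits.

Section Words.
Context {R : realType}.
Local Notation C := R[i].
Implicit Types (g : Xplus1 R) (z : C * C) (s : seq (Xplus1 R)) (G : set (Xplus1 R)).

Definition hen_seq s z : C * C := foldl (fun z g => hen g z) z s.

Lemma hen_seq_cat s s' z : hen_seq (s ++ s') z = hen_seq s' (hen_seq s z).
Proof. exact: foldl_cat. Qed.

Lemma orbit_mkseq (gam : nat -> Xplus1 R) n z :
  orbit gam n z = hen_seq (mkseq gam n) z.
Proof.
by elim: n => [//|n ih]; rewrite mkseqS -cats1 hen_seq_cat -ih.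
Qed.

Definition word_in G s : Prop := forall g, g \in s -> G g.

Lemma word_in_mkseq G gam n : (forall k, G (gam k)) -> word_in G (mkseq gam n).
Proof. by move=> h g /mapP[k _ ->]. Qed.

Lemma word_in_cat G s s' : word_in G s -> word_in G s' -> word_in G (s ++ s').
Proof. by move=> h h' g; rewrite mem_cat => /orP[/h|/h']. Qed.

(** Mean stability in dynamical terms: a condition on finite words that only
    involves points of C^2, so that volume arguments apply to it. *)
Definition steerable G : Prop :=
  forall z (r : R), exists2 s, word_in G s & escaping r (hen_seq s z).

Lemma steerable_neq0 G : steerable G -> G !=set0.
Proof.
move=> /(_ (0, 0) 0)[[|g s] sG]; last by exists g; apply: sG; rewrite mem_head.
by rewrite /escaping /= cnorm0 ltxx => -[].
Qed.

(** Iteration of a single map leads any point to the bidisk or to the escaping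
    region, and further iteration makes the second coordinate arbitrarily
    large. *)
Lemma steerable_from_bidisk G (r : R) : G !=set0 -> (forall g, G g -> good r g) ->
  (forall z, bidisk (2 * r) z ->
    exists2 s, word_in G s & escaping (2 * r) (hen_seq s z)) ->
  steerable G.
Proof.
move=> [g0 Gg0] gG h z M; pose gam (k : nat) := g0.
have gr k : good r (gam k) by exact: gG.
have wg n : word_in G (mkseq gam n) by exact: word_in_mkseq.
have [s sG es] : exists2 s, word_in G s & escaping (2 * r) (hen_seq s z).
  have [n] := orbit_enters z gr; rewrite orbit_mkseq => -[e|/h[s sG es]].
    by exists (mkseq gam n).
  by exists (mkseq gam n ++ s); [exact: word_in_cat|rewrite hen_seq_cat].
have [m Mm] := exp7_large M.
have [[_ e2] e3] := @orbit_escaping _ r gam 0 m (hen_seq s z) gr es.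
exists (s ++ mkseq gam m); first exact: word_in_cat.
by rewrite hen_seq_cat -orbit_mkseq; split=> //; exact: lt_le_trans e3.
Qed.

Lemma cvg_hen T (F : set_system T) {FF : Filter F} (gam : T -> Xplus1 R)
    (zeta : T -> C * C) g z : gam @ F --> g -> zeta @ F --> z ->
  (fun t => hen (gam t) (zeta t)) @ F --> hen g z.
Proof.
move=> cg cz.
have c1 : (fun t => (zeta t).1) @ F --> z.1.
  move=> A /nbhs_CP[e e0 eA]; have zA : nbhs z (fst @^-1` A).
    by apply/nbhs_C2P; exists e => // z' h _; exact: eA.
  exact: (cz _ zA).
have c2 : (fun t => (zeta t).2) @ F --> z.2.
  move=> A /nbhs_CP[e e0 eA]; have zA : nbhs z (snd @^-1` A).
    by apply/nbhs_C2P; exists e => // z' _ h; exact: eA.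
  exact: (cz _ zA).
have ca : (fun t => hshift (Xplus1_val (gam t))) @ F --> hshift (Xplus1_val g).
  by move=> A /continuous_hshift; exact: cg.
have cc i : (fun t => (hpoly (Xplus1_val (gam t)))`_i) @ F
    --> (hpoly (Xplus1_val g))`_i.
  by move=> A /continuous_hcoef; exact: cg.
have cp : (fun t => (hpoly (Xplus1_val (gam t))).[(zeta t).2]) @ F
    --> (hpoly (Xplus1_val g)).[z.2].
  rewrite [X in _ --> X]horner_coef.
  have cs := cvg_Csum (fun i : 'I_(size (hpoly (Xplus1_val g))) =>
    cvg_CM (cc i) (cvg_CX (n := i) c2)).
  move=> A nA; have h2 : F (fun t => size (hpoly (Xplus1_val (gam t))) =
      size (hpoly (Xplus1_val g))) := cg _ (near_size g).
  have h1 : F (fun t => A (\sum_(i < size (hpoly (Xplus1_val g)))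
      (hpoly (Xplus1_val (gam t)))`_i * (zeta t).2 ^+ i)) := cs FF FF FF A nA.
  suff : F (fun t => A (hpoly (Xplus1_val (gam t))).[(zeta t).2]) by [].
  by apply: filterS2 h1 h2 => t At tn; rewrite horner_coef tn.
rewrite henE (_ : (fun t => _) = fun t =>
    ((zeta t).2 + hshift (Xplus1_val (gam t)),
     (hpoly (Xplus1_val (gam t))).[(zeta t).2] - (zeta t).1)); last first.
  by apply/funext => t; rewrite henE.
by apply: cvg_C2; [exact: (cvg_CD c2 ca)|exact: (cvg_CB cp c1)].
Qed.

Fixpoint near_word (e : R) s s' : Prop :=
  match s, s' with
  | [::], [::] => True
  | g :: t, g' :: t' => ball g e g' /\ near_word e t t'
  | _, _ => False
  end.

Lemma near_wordW (d e : R) s s' : d <= e -> near_word d s s' -> near_word e s s'.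
Proof.
move=> de; elim: s s' => [|g s ih] [|g' s']//= [b w].
by split; [exact: le_ball b|exact: ih].
Qed.

Lemma hen_near g z (A : set (C * C)) : nbhs (hen g z) A ->
  exists2 e : R, 0 < e & forall g' z', ball g e g' ->
    cnorm (z'.1 - z.1) < e -> cnorm (z'.2 - z.2) < e -> A (hen g' z').
Proof.
move=> hA.
have cg : (fun p : Xplus1 R * (C * C) => p.1) @ filter_prod (nbhs g) (nbhs z) --> g.
  exact: cvg_fst.
have cz : (fun p : Xplus1 R * (C * C) => p.2) @ filter_prod (nbhs g) (nbhs z) --> z.
  exact: cvg_snd.
have [[U W] /= [gU /nbhs_C2P[e e0 eW]] UW] :=
  cvg_hen (FF := filter_prod_filter (nbhs_filter g) (nbhs_filter z)) cg cz hA.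
have [d d0 dU] := (nbhs_ballP _ _).1 gU.
exists (Num.min d e); first by rewrite lt_min d0.
move=> g' z' b; rewrite !lt_min => /andP[_ z1] /andP[_ z2].
apply: (UW (g', z')); split; last exact: eW.
by apply: dU; apply: le_ball b; rewrite ge_min lexx.
Qed.

(** Joint continuity in the word and the point. *)
Lemma hen_seq_near s z (A : set (C * C)) : nbhs (hen_seq s z) A ->
  exists2 e : R, 0 < e & forall s' z', near_word e s s' ->
    cnorm (z'.1 - z.1) < e -> cnorm (z'.2 - z.2) < e -> A (hen_seq s' z').
Proof.
elim: s z => [|g s ih] z /=.
  by move=> /nbhs_C2P[e e0 eA]; exists e => // -[|//] z' _ /=; exact: eA.
move=> /ih[e e0 eP].
have [|d d0 dP] := @hen_near g z
  [set w | cnorm (w.1 - (hen g z).1) < e /\ cnorm (w.2 - (hen g z).2) < e].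
  by apply/nbhs_C2P; exists e.
exists (Num.min d e); first by rewrite lt_min d0.
move=> [//|g' s'] z' /= [b w]; rewrite !lt_min => /andP[z1 _] /andP[z2 _].
have [|w1 w2] := dP g' z' _ z1 z2.
  by apply: le_ball b; rewrite ge_min lexx.
by apply: eP => //; apply: near_wordW w; rewrite ge_min lexx orbT.
Qed.

Lemma open_escaping (r : R) : open (escaping r).
Proof.
apply/open_C2P => z [z2 z1].
pose e := Num.min ((cnorm z.2 - r) / 1) ((cnorm z.2 - cnorm z.1) / 2).
exists e; first by rewrite lt_min !divr_gt0 ?subr_gt0.
move=> w; rewrite !lt_min !divr1 => /andP[_ w1] /andP[w2 w2'].
have := cnorm_sub_le z.2 w.2; rewrite cnormB => h2.
have := cnorm_sub_le w.1 z.1 => h1.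
by split; lra.
Qed.

Lemma near_word_in (e : R) G G' s : hausdorff_ball (G : hset _) e G' ->
  word_in G s -> exists2 s', word_in G' s' & near_word e s s'.
Proof.
move=> [e' [e'0 e'e GG' _]]; elim: s => [|g s ih] sG; first by exists [::].
have [|s' s'G ss'] := ih; first by move=> x xs; apply: sG; rewrite inE xs orbT.
have [g' Gg' gg'] := GG' g (sG g (mem_head _ _)).
exists (g' :: s') => /=; last by split=> //; apply: le_ball gg'; exact: ltW.
by move=> x; rewrite inE => /predU1P[->|/s'G].
Qed.

(** Steering a point into the open escaping region is robust under small
    changes of the point and of the maps used; by compactness of the bidisk
    finitely many words suffice. *)
Lemma steerable_open G : compact G -> steerable G ->
  exists2 e : R, 0 < e & forall G', hausdorff_ball (G : hset _) e G' -> steerable G'.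
Proof.
move=> cG sG; have [K [e1 [e10 tK]]] := tame_compact cG.
have [r gr] := @tame_good R K.
have /compact_near_coveringP cB := @compact_bidisk R (2 * r).
have := cB nat \oo (fun n z => forall G', hausdorff_ball (G : hset _) n.+1%:R^-1 G' ->
  exists2 s, word_in G' s & escaping (2 * r) (hen_seq s z)) _.
case.
  move=> z _; have [s sGs es] := sG z (2 * r).
  have [e e0 eP] := hen_seq_near (open_nbhs_nbhs (conj (@open_escaping (2 * r)) es)).
  exists ([set w | cnorm (w.1 - z.1) < e /\ cnorm (w.2 - z.2) < e],
    [set n | n.+1%:R^-1 < e]).
    split=> /=; first by apply/nbhs_C2P; exists e.
    exact: near_infty_natSinv_lt (PosNum e0).
  move=> [w n] [/= [w1 w2] ne] G' /near_word_in/(_ sGs)[s' s'G' ss'].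
  by exists s' => //; apply: eP => //; apply: near_wordW ss'; exact: ltW.
move=> N _ NP; exists (Num.min e1 N.+1%:R^-1); first by rewrite lt_min e10 invr_gt0 ltr0Sn.
move=> G' [e' [e'0]]; rewrite lt_min => /andP[e'e1 e'N] GG' G'G.
apply: (@steerable_from_bidisk _ r).
- have [g Gg] := steerable_neq0 sG.
  by have [g' G'g' _] := GG' g Gg; exists g'.
- move=> g' /G'G[g Gg gg']; apply: gr; apply: tK Gg _.
  by apply: le_ball gg'; exact: ltW.
- move=> z zB; apply: (NP N (leqnn N) z zB); by exists e'.
Qed.

End Words.

(** * Preservation of volume *)
Section ProductSigmaFinite.
Context d1 d2 (T1 : measurableType d1) (T2 : measurableType d2) (R : realType).
Variable m1 : {sigma_finite_measure set T1 -> \bar R}.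
Variable m2 : {sigma_finite_measure set T2 -> \bar R}.

(** Lets the product of products be handled by Fubini and by uniqueness of
    product measures. *)
Lemma product_sigma_finite : sigma_finite setT (m1 \x m2)%E.
Proof.
have [F TF Ff] := sigma_finiteT m1; have [G TG Gf] := sigma_finiteT m2.
pose H (k : nat) : set (T1 * T2) :=
  if unpickle k is Some p then F p.1 `*` G p.2 else set0.
exists H.
  apply/seteqP; split=> // -[x y] _.
  have : [set: T1] x by []; rewrite TF => -[i _ Fx].
  have : [set: T2] y by []; rewrite TG => -[j _ Gy].
  by exists (pickle (i, j)) => //; rewrite /H pickleK.
move=> k; rewrite /H; case: unpickle => [[i j]|] /=; last by split; rewrite ?measure0.
have [mF fF] := Ff i; have [mG fG] := Gf j.
split; first exact: measurableX.
by rewrite product_measure1E// lte_mul_pinfty// ge0_fin_numE.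
Qed.

End ProductSigmaFinite.

Section Volume.
Context {R : realType}.
Local Notation T1 := (measurableTypeR R).
Local Notation T2 := (T1 * T1)%type.
Local Notation T4 := (T2 * T2)%type.
Local Notation C := R[i].

Definition lam2 : set T2 -> \bar R := (@lebesgue_measure R \x @lebesgue_measure R)%E.
HB.instance Definition _ := Measure.on lam2.
HB.instance Definition _ := Measure_isSigmaFinite.Build _ _ _ lam2
  (product_sigma_finite lebesgue_measure lebesgue_measure).

Definition lam4 : set T4 -> \bar R := (lam2 \x lam2)%E.
HB.instance Definition _ := Measure.on lam4.
HB.instance Definition _ := Measure_isSigmaFinite.Build _ _ _ lam4
  (product_sigma_finite lam2 lam2).

Lemma Leb4E (A : set (C * C)) : Leb4 A = lam4 (c2_of_r4 @^-1` A).
Proof. by []. Qed.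

Lemma measurable_shift (a : R) :
  measurable_fun [set: T1] ((fun x : T1 => x + a) : T1 -> T1).
Proof. exact: measurable_funD. Qed.

Lemma lebesgue_measure_shift (a : R) (A : set T1) : measurable A ->
  lebesgue_measure ((fun x : T1 => x + a : T1) @^-1` A) = lebesgue_measure A.
Proof.
move=> mA; suff : pushforward lebesgue_measure (fun x : T1 => x + a : T1) A =
    lebesgue_measure A by [].
apply/esym/lebesgue_measure_unique => //=.
  exact: measurable_shift.
move=> mf _ [[b c]] _ <-; rewrite /pushforward.
have -> : (fun x : T1 => x + a : T1) @^-1` `]b, c]%classic =
    `](b - a), (c - a)]%classic.
  by apply/seteqP; split=> x /=; rewrite !in_itv/= ltrBlDr lerBrDr.
rewrite /= !lebesgue_measure_itv/= !lte_fin ltrD2r; case: ifP => // _.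
by rewrite -!EFinD; congr EFin; ring.
Qed.

Lemma lebesgue_measure_reflect (a : R) (A : set T1) : measurable A ->
  lebesgue_measure ((fun x : T1 => a - x : T1) @^-1` A) = lebesgue_measure A.
Proof.
move=> mA; rewrite -[RHS](lebesgue_measure_shift a mA) -[RHS]lebesgue_measureN.
  by congr lebesgue_measure; apply/seteqP; split=> x /=; rewrite /= addrC.
by rewrite -[X in measurable X]setTI; exact: measurable_shift.
Qed.

Lemma lam2_shift (a : T2) (A : set T2) : measurable A ->
  lam2 ((fun t => (t.1 + a.1, t.2 + a.2)) @^-1` A) = lam2 A.
Proof.
move=> mA; have mf : measurable_fun [set: T2]
    ((fun t => (t.1 + a.1, t.2 + a.2)) : T2 -> T2).
  by apply: measurable_fun_pair; apply: measurable_funD.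
suff : pushforward lam2 ((fun t => (t.1 + a.1, t.2 + a.2)) : T2 -> T2) A = lam2 A.
  by [].
apply/esym/product_measure_unique => //= B D mB mD.
rewrite /pushforward (_ : _ @^-1` _ = ((fun x : T1 => x + a.1 : T1) @^-1` B) `*`
  ((fun x : T1 => x + a.2 : T1) @^-1` D)); last by apply/seteqP; split.
have mp b (E : set T1) : measurable E ->
    measurable ((fun x : T1 => x + b : T1) @^-1` E).
  by move=> mE; rewrite -[X in measurable X]setTI; exact: measurable_shift.
apply: (eq_trans (product_measure1E lebesgue_measure lebesgue_measure
  (mp a.1 _ mB) (mp a.2 _ mD))).
by congr (_ * _)%E; exact: lebesgue_measure_shift.
Qed.

Lemma lam2_reflect (a : T2) (A : set T2) : measurable A ->
  lam2 ((fun t => (a.1 - t.1, a.2 - t.2)) @^-1` A) = lam2 A.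
Proof.
move=> mA; have mf : measurable_fun [set: T2]
    ((fun t => (a.1 - t.1, a.2 - t.2)) : T2 -> T2).
  by apply: measurable_fun_pair; apply: measurable_funB.
suff : pushforward lam2 ((fun t => (a.1 - t.1, a.2 - t.2)) : T2 -> T2) A = lam2 A.
  by [].
apply/esym/product_measure_unique => //= B D mB mD.
rewrite /pushforward (_ : _ @^-1` _ = ((fun x : T1 => a.1 - x : T1) @^-1` B) `*`
  ((fun x : T1 => a.2 - x : T1) @^-1` D)); last by apply/seteqP; split.
have mp b (E : set T1) : measurable E ->
    measurable ((fun x : T1 => b - x : T1) @^-1` E).
  move=> mE; rewrite -[X in measurable X]setTI.
  by apply: (_ : measurable_fun [set: T1] _) => //; exact: measurable_funB.
apply: (eq_trans (product_measure1E lebesgue_measure lebesgue_measure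
  (mp a.1 _ mB) (mp a.2 _ mD))).
by congr (_ * _)%E; exact: lebesgue_measure_reflect.
Qed.

(** By Fubini: for fixed y the map is an isometry in x, and y is only
    translated. *)
Lemma lam4_henon (a : T2) (P : T2 -> T2) (A : set T4) :
  measurable_fun setT P -> measurable A ->
  lam4 ((fun t => ((t.2.1 + a.1, t.2.2 + a.2),
                   ((P t.2).1 - t.1.1, (P t.2).2 - t.1.2))) @^-1` A) = lam4 A.
Proof.
move=> mP mA; set f := (X in X @^-1` A).
have m1 : measurable_fun [set: T4] (fun t : T4 => t.1) by exact: measurable_fst.
have m2 : measurable_fun [set: T4] (fun t : T4 => t.2) by exact: measurable_snd.
have mP2 : measurable_fun [set: T4] (fun t : T4 => P t.2).
  exact: measurableT_comp mP m2.
have mf : measurable_fun [set: T4] (f : T4 -> T4).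
  apply: measurable_fun_pair; apply: measurable_fun_pair.
  - by apply: measurable_funD => //; exact: (measurableT_comp measurable_fst m2).
  - by apply: measurable_funD => //; exact: (measurableT_comp measurable_snd m2).
  - apply: measurable_funB; first exact: (measurableT_comp measurable_fst mP2).
    exact: (measurableT_comp measurable_fst m1).
  - apply: measurable_funB; first exact: (measurableT_comp measurable_snd mP2).
    exact: (measurableT_comp measurable_snd m1).
suff : pushforward lam4 (f : T4 -> T4) A = lam4 A by [].
apply/esym/product_measure_unique => //= B D mB mD.
have mBD : measurable (f @^-1` (B `*` D)).
  by rewrite -[X in measurable X]setTI; apply: mf => //; exact: measurableX.
rewrite /pushforward.
have -> : lam4 (f @^-1` (B `*` D)) = (lam2 \x^ lam2)%E (f @^-1` (B `*` D)).
  apply: product_measure_unique => //= E F mE mF.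
  exact: product_measure2E.
rewrite /product_measure2.
pose B' : set T2 := (fun t : T2 => (t.1 + a.1, t.2 + a.2) : T2) @^-1` B.
have mB' : measurable B'.
  rewrite -[X in measurable X]setTI.
  apply: (_ : measurable_fun [set: T2] _) => //.
  by apply: measurable_fun_pair; apply: measurable_funD.
rewrite (eq_integral (fun y => (\1_B' y)%:E * lam2 D)%E); last first.
  move=> y _ /=; rewrite indicE; have [By|nBy] := boolP (y \in B').
    rewrite mul1e -(lam2_reflect (P y) mD); congr (lam2 _).
    apply/seteqP; split=> x; rewrite /ysection/= inE /f /=; first by case.
    by move=> h; split=> //; exact: (set_mem By).
  rewrite mul0e (_ : ysection _ _ = set0) ?measure0//.
  apply/seteqP; split=> // x; rewrite /ysection/= inE /f /= => -[h _].
  by move/negP : nBy; apply; apply: mem_set.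
transitivity (lam2 B' * lam2 D)%E; last first.
  by congr (_ * _)%E; exact: lam2_shift.
have mI : measurable_fun [set: T2] (fun y => (\1_B' y)%:E : \bar R).
  exact: measurableT_comp.
have I0 (y : T2) : [set: T2] y -> (0 <= (\1_B' y)%:E :> \bar R)%E.
  by move=> _; rewrite lee_fin.
rewrite (ge0_integralZr lam2 measurableT mI I0 (measure_ge0 lam2 D)).
by congr (_ * _)%E; rewrite integral_indic// setIT.
Qed.

End Volume.

Section MeasurableComplex.
Context {R : realType} {d : measure_display} {X : measurableType d}.
Local Notation C := R[i].
Implicit Types f h : X -> C.

Definition cmeas f : Prop :=
  measurable_fun [set: X] (fun x => complex.Re (f x)) /\
  measurable_fun [set: X] (fun x => complex.Im (f x)).

Lemma cmeas_cst (c : C) : cmeas (fun=> c).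
Proof. by split; exact: measurable_cst. Qed.

Lemma cmeasD f h : cmeas f -> cmeas h -> cmeas (fun x => f x + h x).
Proof.
move=> [f1 f2] [h1 h2]; split.
  rewrite (_ : (fun x => _) = (fun x => complex.Re (f x)) \+ (fun x => complex.Re (h x))).
    exact: measurable_funD.
  by apply/funext => x /=; case: (f x) => ? ?; case: (h x).
rewrite (_ : (fun x => _) = (fun x => complex.Im (f x)) \+ (fun x => complex.Im (h x))).
  exact: measurable_funD.
by apply/funext => x /=; case: (f x) => ? ?; case: (h x).
Qed.

Lemma cmeasM f h : cmeas f -> cmeas h -> cmeas (fun x => f x * h x).
Proof.
move=> [f1 f2] [h1 h2]; split.
  rewrite (_ : (fun x => _) =
    ((fun x => complex.Re (f x)) \* (fun x => complex.Re (h x))) \-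
    ((fun x => complex.Im (f x)) \* (fun x => complex.Im (h x)))).
    by apply: measurable_funB; exact: measurable_funM.
  by apply/funext => x /=; case: (f x) => ? ?; case: (h x).
rewrite (_ : (fun x => _) =
  ((fun x => complex.Re (f x)) \* (fun x => complex.Im (h x))) \+
  ((fun x => complex.Im (f x)) \* (fun x => complex.Re (h x)))).
  by apply: measurable_funD; exact: measurable_funM.
by apply/funext => x /=; case: (f x) => ? ?; case: (h x).
Qed.

Lemma cmeasB f h : cmeas f -> cmeas h -> cmeas (fun x => f x - h x).
Proof.
move=> mf mh; under eq_fun do rewrite -[- h _]mulN1r.
by apply: cmeasD => //; apply: cmeasM => //; exact: cmeas_cst.
Qed.

Lemma cmeasX f n : cmeas f -> cmeas (fun x => f x ^+ n).
Proof.
move=> mf; elim: n => [|n ih].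
  by under eq_fun do rewrite expr0; exact: cmeas_cst.
by under eq_fun do rewrite exprS; exact: cmeasM.
Qed.

Lemma cmeas_sum n (F : 'I_n -> X -> C) : (forall i, cmeas (F i)) ->
  cmeas (fun x => \sum_i F i x).
Proof.
elim: n F => [|n ih] F mF.
  by under eq_fun do rewrite big_ord0; exact: cmeas_cst.
under eq_fun do rewrite big_ord_recr /=.
by apply: cmeasD => //; exact: (ih (fun i => F (widen_ord (leqnSn n) i))).
Qed.

Lemma horner_trunc (p : {poly C}) (y : C) n : (size p <= n)%N ->
  p.[y] = \sum_(i < n) p`_i * y ^+ i.
Proof.
move=> pn; rewrite horner_coef (big_ord_widen n (fun i => p`_i * y ^+ i))//.
rewrite [RHS](bigID (fun i : 'I_n => (i < size p)%N))/= [X in _ = _ + X]big1 ?addr0//.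
by move=> i; rewrite -leqNgt => ip; rewrite nth_default// mul0r.
Qed.

(** The degree is not bounded a priori, so evaluation is measurable as a limit
    of the partial sums. *)
Lemma cmeas_horner (p : X -> {poly C}) f : (forall i, cmeas (fun x => (p x)`_i)) ->
  cmeas f -> cmeas (fun x => (p x).[f x]).
Proof.
move=> mp mf.
have ms n : cmeas (fun x => \sum_(i < n) (p x)`_i * f x ^+ i).
  by apply: cmeas_sum => i; apply: cmeasM => //; exact: cmeasX.
have lim (h : C -> R) x :
    h (\sum_(i < n) (p x)`_i * f x ^+ i) @[n --> \oo] --> h (p x).[f x].
  apply: cvg_near_cst; near=> n; congr h; apply/esym/horner_trunc.
  by near: n; exact: nbhs_infty_ge.
split.
  apply: (@measurable_fun_cvg _ _ _ _
    (fun n x => complex.Re (\sum_(i < n) (p x)`_i * f x ^+ i))).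
    by move=> n; exact: (ms n).1.
  by move=> x _; exact: lim.
apply: (@measurable_fun_cvg _ _ _ _
  (fun n x => complex.Im (\sum_(i < n) (p x)`_i * f x ^+ i))).
  by move=> n; exact: (ms n).2.
by move=> x _; exact: lim.
Unshelve. all: by end_near. Qed.

Lemma cmeas_cnorm f : cmeas f -> measurable_fun [set: X] (fun x => cnorm (f x)).
Proof.
move=> [f1 f2]; rewrite (_ : (fun x => _) = Num.sqrt \o
  ((fun x => complex.Re (f x)) \* (fun x => complex.Re (f x)) \+
   (fun x => complex.Im (f x)) \* (fun x => complex.Im (f x)))).
  apply: measurableT_comp; first by apply: continuous_measurable_fun; exact: sqrt_continuous.
  by apply: measurable_funD; exact: measurable_funM.
apply/funext => x /=; rewrite -!expr2 -cnorm_ReIm sqrtr_sqr ger0_norm//.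
exact: cnorm_ge0.
Qed.

Lemma cmeas_hen (G : X -> Xplus1 R) (z : X -> C * C) :
  cmeas (fun x => hshift (Xplus1_val (G x))) ->
  (forall i, cmeas (fun x => (hpoly (Xplus1_val (G x)))`_i)) ->
  cmeas (fun x => (z x).1) -> cmeas (fun x => (z x).2) ->
  cmeas (fun x => (hen (G x) (z x)).1) /\ cmeas (fun x => (hen (G x) (z x)).2).
Proof.
move=> ma mc m1 m2; split; under eq_fun do rewrite henE /=.
  exact: cmeasD.
by apply: cmeasB => //; exact: cmeas_horner.
Qed.

Lemma measurable_escaping (r : R) (z : X -> C * C) :
  cmeas (fun x => (z x).1) -> cmeas (fun x => (z x).2) ->
  measurable (z @^-1` escaping r).
Proof.
move=> /cmeas_cnorm m1 /cmeas_cnorm m2.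
have mr : measurable_fun [set: X] (cst r) by exact: measurable_cst.
have := measurable_fun_ltr mr m2; have := measurable_fun_ltr m2 m2 => _.
move=> /(_ measurableT [set true] I); rewrite setTI => h1.
have := measurable_fun_ltr m1 m2.
move=> /(_ measurableT [set true] I); rewrite setTI => h2.
by have := measurableI _ _ h1 h2.
Qed.

End MeasurableComplex.

Section VolumePreserved.
Context {R : realType}.
Local Notation T1 := (measurableTypeR R).
Local Notation T2 := (T1 * T1)%type.
Local Notation T4 := (T2 * T2)%type.
Local Notation C := R[i].
Implicit Types (g : Xplus1 R) (A : set (C * C)).

Definition meas4 A : Prop := measurable (c2_of_r4 @^-1` A : set T4).

Lemma cmeas_c2_of_r4 : cmeas (fun t : T4 => (c2_of_r4 t).1) /\
  cmeas (fun t : T4 => (c2_of_r4 t).2).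
Proof.
have m1 : measurable_fun [set: T4] (fun t : T4 => t.1) by exact: measurable_fst.
have m2 : measurable_fun [set: T4] (fun t : T4 => t.2) by exact: measurable_snd.
split; split.
- exact: (measurableT_comp measurable_fst m1).
- exact: (measurableT_comp measurable_snd m1).
- exact: (measurableT_comp measurable_fst m2).
- exact: (measurableT_comp measurable_snd m2).
Qed.

Lemma volume_hen g A : meas4 A -> Leb4 (hen g @^-1` A) = Leb4 A.
Proof.
move=> mA; rewrite !Leb4E.
pose a : T2 := (complex.Re (hshift (Xplus1_val g)), complex.Im (hshift (Xplus1_val g))).
pose P (y : T2) : T2 :=
  (complex.Re (hpoly (Xplus1_val g)).[complex_of_pair y],
   complex.Im (hpoly (Xplus1_val g)).[complex_of_pair y]).
have mP : measurable_fun [set: T2] P.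
  have [h1 h2] : cmeas (fun y : T2 => (hpoly (Xplus1_val g)).[complex_of_pair y]).
    apply: cmeas_horner => [i|]; first exact: cmeas_cst.
    by split; [exact: measurable_fst|exact: measurable_snd].
  exact: measurable_fun_pair.
rewrite -(lam4_henon a mP mA); congr (lam4 _).
apply/seteqP; split=> -[[x1 x2] [y1 y2]]; rewrite /= henE /=;
by rewrite /c2_of_r4 /complex_of_pair /=; case: (hshift _) => ? ?;
  case: (_.[_]) => ? ?.
Qed.

Lemma meas4_hen g A : meas4 A -> meas4 (hen g @^-1` A).
Proof.
move=> mA; have [m1 m2] := cmeas_c2_of_r4.
have [[h1 h2] [h3 h4]] := @cmeas_hen R _ T4 (fun=> g) _ (cmeas_cst _)
  (fun i => cmeas_cst _) m1 m2.
pose r4 (w : C * C) : T4 :=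
  ((complex.Re w.1, complex.Im w.1), (complex.Re w.2, complex.Im w.2)).
have r4K w : c2_of_r4 (r4 w) = w by case: w => -[? ?] [? ?].
have mf : measurable_fun [set: T4] (fun t : T4 => r4 (hen g (c2_of_r4 t))).
  by apply: measurable_fun_pair; exact: measurable_fun_pair.
have := mf measurableT _ mA; rewrite setTI; congr measurable.
by apply/seteqP; split=> t; rewrite /preimage/= r4K.
Qed.

Lemma volume_hen_seq s A : meas4 A ->
  meas4 (hen_seq s @^-1` A) /\ Leb4 (hen_seq s @^-1` A) = Leb4 A.
Proof.
elim: s A => [//|g s ih] A mA; have [m1 v1] := ih A mA.
split; first exact: (meas4_hen g m1).
have -> : hen_seq (g :: s) @^-1` A = hen g @^-1` (hen_seq s @^-1` A) by [].
rewrite (volume_hen g m1).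
rewrite v1.
reflexivity.
Qed.

Definition box (z : C * C) (e : R) : set (C * C) := [set w |
  (`|complex.Re w.1 - complex.Re z.1| < e /\ `|complex.Im w.1 - complex.Im z.1| < e) /\
  (`|complex.Re w.2 - complex.Re z.2| < e /\ `|complex.Im w.2 - complex.Im z.2| < e)].

Lemma measurable_interval (a e : R) : measurable ([set x | `|x - a| < e] : set T1).
Proof.
rewrite (_ : mkset _ = `]a - e, a + e[%classic); first exact: measurable_itv.
by apply/seteqP; split=> x /=; rewrite in_itv/= ltr_distl.
Qed.

Lemma volume_interval (a e : R) : 0 < e ->
  lebesgue_measure ([set x | `|x - a| < e] : set T1) = (e *+ 2)%:E.
Proof.
move=> e0; rewrite (_ : mkset _ = `]a - e, a + e[%classic).
  rewrite lebesgue_measure_itv/= lte_fin; case: ifPn => [_|].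
    by rewrite -EFinD; congr EFin; rewrite mulr2n; ring.
  by rewrite -leNgt => h; exfalso; lra.
by apply/seteqP; split=> x /=; rewrite in_itv/= ltr_distl.
Qed.

Lemma meas4_box z e : meas4 (box z e).
Proof.
have h (a b : R) : measurable ([set t : T2 | `|t.1 - a| < e /\ `|t.2 - b| < e]).
  rewrite (_ : mkset _ = [set x | `|x - a| < e] `*` [set x | `|x - b| < e]).
    by apply: measurableX; exact: measurable_interval.
  by apply/seteqP; split.
exact: (measurableX (h (complex.Re z.1) (complex.Im z.1))
  (h (complex.Re z.2) (complex.Im z.2))).
Qed.

Lemma volume_box z e : 0 < e -> Leb4 (box z e) = ((e *+ 2) ^+ 4)%:E.
Proof.
move=> e0; have h (a b : R) :
    measurable ([set t : T2 | `|t.1 - a| < e /\ `|t.2 - b| < e]) /\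
    lam2 [set t : T2 | `|t.1 - a| < e /\ `|t.2 - b| < e] = ((e *+ 2) ^+ 2)%:E.
  rewrite (_ : mkset _ = [set x | `|x - a| < e] `*` [set x | `|x - b| < e]);
    last by apply/seteqP; split.
  split; first by apply: measurableX; exact: measurable_interval.
  apply: (eq_trans (product_measure1E lebesgue_measure lebesgue_measure _ _));
    try exact: measurable_interval.
  by rewrite expr2 EFinM; congr (_ * _)%E; exact: volume_interval.
have [m1 v1] := h (complex.Re z.1) (complex.Im z.1).
have [m2 v2] := h (complex.Re z.2) (complex.Im z.2).
apply: (eq_trans (product_measure1E lam2 lam2 m1 m2)).
rewrite (exprD _ 2 2) EFinM; congr (_ * _)%E; [exact: v1|exact: v2].
Qed.

(** An open set is the union of the rational boxes that it contains. *)
Lemma meas4_open A : open A -> meas4 A.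
Proof.
move=> /open_C2P oA.
pose q (k : (rat * rat) * (rat * rat)) : C * C :=
  ((ratr k.1.1 +i* ratr k.1.2)%C, (ratr k.2.1 +i* ratr k.2.2)%C).
pose B (n : nat) : set (C * C) :=
  if unpickle n is Some (k, m) then
    (if pselect (box (q k) m.+1%:R^-1 `<=` A) then box (q k) m.+1%:R^-1 else set0)
  else set0.
have -> : A = \bigcup_n B n.
  apply/seteqP; split=> [z Az|z [n _]]; last first.
    by rewrite /B; case: unpickle => [[k m]|//]; case: pselect => // h /h.
  have [e e0 eA] := oA z Az.
  have [m me] : exists m : nat, m.+1%:R^-1 < e / 4.
    have e40 : 0 < e / 4 by rewrite divr_gt0.
    have [m _ /(_ m (leqnn m)) h] := near_infty_natSinv_lt (PosNum e40).
    by exists m.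
  have m0 : 0 < m.+1%:R^-1 :> R by rewrite invr_gt0 ltr0Sn.
  have rat_near (x : R) : exists c : rat, `|x - ratr c| < m.+1%:R^-1.
    have [c] : exists c : rat, ratr c \in `]x - m.+1%:R^-1, x + m.+1%:R^-1[.
      by apply: rat_in_itvoo; rewrite ltrBlDr -addrA ltrDl addr_gt0.
    by rewrite in_itv/= -ltr_distl distrC => h; exists c.
  have close (u v c : C) :
      `|complex.Re u - complex.Re c| < m.+1%:R^-1 ->
      `|complex.Im u - complex.Im c| < m.+1%:R^-1 ->
      `|complex.Re v - complex.Re c| < m.+1%:R^-1 ->
      `|complex.Im v - complex.Im c| < m.+1%:R^-1 ->
      `|complex.Re (u - v)| + `|complex.Im (u - v)| < e.
    case: u v c => [u1 u2] [v1 v2] [b1 b2] /= a1 a2 a3 a4.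
    have := ler_distD b1 u1 v1; have := ler_distD b2 u2 v2.
    rewrite [`|b1 - _|]distrC [`|b2 - _|]distrC.
    by move: a1 a2 a3 a4 me; move: (m.+1%:R^-1) => r; clear; lra.
  have [c1 h1] := rat_near (complex.Re z.1); have [c2 h2] := rat_near (complex.Im z.1).
  have [c3 h3] := rat_near (complex.Re z.2); have [c4 h4] := rat_near (complex.Im z.2).
  pose k : (rat * rat) * (rat * rat) := ((c1, c2), (c3, c4)).
  have kz : box (q k) m.+1%:R^-1 z by [].
  exists (pickle (k, m)); first by [].
  rewrite /B pickleK.
  case: pselect => [yb|nb]; first exact: kz.
  case: nb => w wb; have [[w1 w2] [w3 w4]] := wb; apply: eA.
    apply: (le_lt_trans (cnorm_le_ReIm _)).
    apply: (@close _ _ (ratr c1 +i* ratr c2)%C); by [].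
  apply: (le_lt_trans (cnorm_le_ReIm _)).
  apply: (@close _ _ (ratr c3 +i* ratr c4)%C); by [].
rewrite /meas4 preimage_bigcup; apply: bigcupT_measurable => n.
rewrite /B; case: unpickle => [[k m]|]; last by rewrite preimage_set0.
case: pselect => h /=; first exact: meas4_box.
by rewrite preimage_set0.
Qed.

Lemma le_volume A B : meas4 A -> meas4 B -> A `<=` B -> (Leb4 A <= Leb4 B)%E.
Proof.
move=> mA mB AB; rewrite !Leb4E; apply: le_measure; rewrite ?inE.
- exact: mA.
- exact: mB.
- by move=> t; exact: AB.
Qed.

End VolumePreserved.

(** * Inverse maps *)
Section Flip.
Context {R : realType}.
Local Notation C := R[i].
Implicit Types (g : Xplus1 R) (z : C * C).

Definition swap z : C * C := (z.2, z.1).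

Lemma swapK : involutive swap. Proof. by case. Qed.

Fact flip_poly_deg g :
  (2 < size (hpoly (Xplus1_val g) \Po ('X - (hshift (Xplus1_val g))%:P)))%N.
Proof. by rewrite size_comp_poly2 ?size_XsubC// hpoly_deg. Qed.

Definition flip_val g : Xplus R :=
  Henon (- hshift (Xplus1_val g)) (oner_neq0 _) (flip_poly_deg g).

(** The inverse of g, conjugated by the exchange of the coordinates, is again of
    the same form; this reduces backward to forward dynamics. *)
Definition flip g : Xplus1 R :=
  exist (fun f => f \in [set f : Xplus R | hjac f = 1]) (flip_val g)
    (mem_set (erefl : hjac (flip_val g) = 1)).

Lemma flip_poly g y : (hpoly (Xplus1_val (flip g))).[y] =
  (hpoly (Xplus1_val g)).[y - hshift (Xplus1_val g)].
Proof. by rewrite /flip/= horner_comp !hornerE. Qed.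

Lemma hen_flip g z : hen (flip g) z = swap (henon_inv (Xplus1_val g) (swap z)).
Proof. by rewrite henE flip_poly /henon_inv /swap /= hjac1 divr1. Qed.

Lemma henK g z : hen (flip g) (swap (hen g z)) = swap z.
Proof. by rewrite hen_flip swapK /hen henonK. Qed.

Lemma flipK : involutive flip.
Proof.
move=> g; apply: Xplus1_val_inj; apply: Xplus_eq => /=.
- by rewrite opprK.
- by rewrite hjac1.
- have := comp_polyXaddC_K (hpoly (Xplus1_val g)) (- hshift (Xplus1_val g)).
  by rewrite polyCN.
Qed.

Lemma continuous_flip : continuous flip.
Proof.
move=> g A /nbhs_ballP[e e0 eA].
suff ne : nbhs g (fun g' => ball (flip g) e (flip g')).
  by have := @filterS _ _ (nbhs_filter g) _ (flip @^-1` A) (fun g' => eA _) ne.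
pose n := size (hpoly (Xplus1_val g)).
have ca : (fun g' => hshift (Xplus1_val g')) @ nbhs g --> hshift (Xplus1_val g).
  exact: continuous_hshift.
have cX j i : (fun g' => (('X - (hshift (Xplus1_val g'))%:P) ^+ j)`_i) @ nbhs g -->
    (('X - (hshift (Xplus1_val g))%:P) ^+ j)`_i.
  elim: j i => [|j ih] i.
    by under eq_fun do rewrite expr0; rewrite expr0; exact: cvg_cst.
  have E (a : C) : (('X - a%:P) ^+ j.+1)`_i =
      (if i == 0%N then 0 else (('X - a%:P) ^+ j)`_i.-1) - (('X - a%:P) ^+ j)`_i * a.
    by rewrite exprSr mulrBr coefB coefMX coefMC.
  rewrite E; under eq_fun do rewrite E.
  apply: (cvg_CB (FF := nbhs_filter g)).
    by case: eqP => _; [exact: cvg_cst|exact: ih].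
  exact: (cvg_CM (FF := nbhs_filter g) (ih i) ca).
have cc i : (fun g' => (hpoly (Xplus1_val (flip g')))`_i) @ nbhs g -->
    (hpoly (Xplus1_val (flip g)))`_i.
  have := cvg_Csum (FF := nbhs_filter g) (fun j : 'I_n =>
    cvg_CM (FF := nbhs_filter g) (@continuous_hcoef R j g) (cX j i)).
  rewrite /= coef_comp_poly -/n => cs B nB.
  have h1 : nbhs g (fun g' => B (\sum_(j < n) (hpoly (Xplus1_val g'))`_j *
     (('X - (hshift (Xplus1_val g'))%:P) ^+ j)`_i)) := cs B nB.
  have h2 := near_size g.
  suff : nbhs g (fun g' => B (hpoly (Xplus1_val (flip g')))`_i) by [].
  have := @filterS2 _ _ (nbhs_filter g) _ _ _ _ h1 h2; apply => g' Bg' sg'.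
  by rewrite /= coef_comp_poly sg'.
have small : \forall g' \near g, forall i : 'I_n,
    cnorm ((hpoly (Xplus1_val (flip g')))`_i - (hpoly (Xplus1_val (flip g)))`_i) < e.
  apply: (@filter_forall _ _ _ _ (nbhs_filter g)) => i.
  by have /(cvg_CP (FF := nbhs_filter g)) := cc i; exact.
have /(cvg_CP (FF := nbhs_filter g))/(_ e e0) a := ca.
have s := near_size g.
have := @filterS3 _ _ (nbhs_filter g) _ _ _ _ _ a s small; apply => g' ag' sg' cg'.
have sf h : size (hpoly (Xplus1_val (flip h))) = size (hpoly (Xplus1_val h)).
  by rewrite /flip/= size_comp_poly2 ?size_XsubC.
apply/ball_Xplus1; split.
- by rewrite !sf sg'.
- by rewrite /flip/= opprK addrC; exact: ag'.
- by rewrite !hjac1 subrr cnorm0.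
- move=> i; have [li|il] := ltnP i n.
    by rewrite cnormB; exact: (cg' (Ordinal li)).
  by rewrite !nth_default ?sf ?sg'// subrr cnorm0.
Qed.

(** Reduces mean stability of the inverse measure and backward orbits in the
    projective plane to the flipped maps. *)
Lemma extend_flip g (L : P2 R) : L <> pt010 ->
  extend_inv (Xplus1_val g) L = swapP2 (extend (Xplus1_val (flip g)) (swapP2 L)).
Proof.
move=> L0; have L1 : swapP2 L <> pt100.
  by move=> /(congr1 swapP2); rewrite swapP2K swapP2_pt100.
rewrite -{1}(swapP2K L); case: (P2_caseU L1) => [[w ->]|[x [y [y0 ->]]]].
  rewrite swapP2_embed extend_inv_embed extend_embed swapP2_embed.
  by rewrite -/(hen (flip g) w) hen_flip; case: w.
rewrite swapP2_hpoint ?hvec_neq0 ?y0 ?orbT// extend_inv_infinity//.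
by rewrite extend_infinity// swapP2_pt010.
Qed.

End Flip.

(** * Mean stability of families of maps *)
Section HausdorffImage.
Context {R : realType} {Y Z : pseudoMetricType R}.

(** The modulus of continuity of f is uniform near the compact set G. *)
Lemma hausdorff_image (f : Y -> Z) (G : set Y) (e : R) : continuous f ->
  compact G -> 0 < e -> exists2 d : R, 0 < d & forall G' : set Y,
  hausdorff_ball (G : hset Y) d G' -> hausdorff_ball (f @` G : hset Z) e (f @` G').
Proof.
move=> cf /compact_near_coveringP cG e0.
have e20 : 0 < e / 2 by rewrite divr_gt0.
have e40 : 0 < e / 2 / 2 by rewrite divr_gt0.
have := cG nat \oo (fun n g => forall g', ball g n.+1%:R^-1 g' ->
  ball (f g) (e / 2) (f g')) _.
case.
  move=> g _; have /nbhs_ballP[d d0 dP] : nbhs g (f @^-1` ball (f g) (e / 2 / 2)).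
    by apply: cf; exact: nbhsx_ballx.
  have d20 : 0 < d / 2 by rewrite divr_gt0.
  exists (ball g (d / 2), [set n | n.+1%:R^-1 < d / 2]).
    split=> /=; first exact: nbhsx_ballx.
    exact: near_infty_natSinv_lt (PosNum d20).
  move=> [g1 n] [/= gg1 nd] g' g1g'; rewrite (splitr (e / 2)).
  have f1 : ball (f g) (e / 2 / 2) (f g1).
    by apply: dP; apply: le_ball gg1; rewrite ler_pdivrMr// ler_pMr// ler1n.
  have f2 : ball (f g) (e / 2 / 2) (f g').
    apply: dP; rewrite (splitr d); apply: ball_triangle gg1 _.
    by apply: le_ball g1g'; exact: ltW.
  by apply: ball_triangle f2; exact: ball_sym.
move=> N _ NP; exists N.+1%:R^-1; first by rewrite invr_gt0 ltr0Sn.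
move=> G' [d [d0 dN GG' G'G]].
have fP g g' : G g -> ball g d g' -> ball (f g) (e / 2) (f g').
  by move=> Gg gg'; apply: (NP N (leqnn N) g Gg); apply: le_ball gg'; exact: ltW.
exists (e / 2); split=> //.
- by rewrite ltr_pdivrMr// ltr_pMr// ltr1n.
- move=> _ [g Gg <-]; have [g' G'g' gg'] := GG' g Gg.
  by exists (f g'); [exists g'|exact: fP].
- move=> _ [g' G'g' <-]; have [g Gg gg'] := G'G g' G'g'.
  by exists (f g); [exists g|exact: fP].
Qed.

End HausdorffImage.

Section MeanStableFamily.
Context {R : realType}.

Lemma ball_P2 (L M : P2 R) (e : R) : ball L e M <-> fubini_study L M < e.
Proof. by []. Qed.

Lemma continuous_isometry (psi : P2 R -> P2 R) :
  (forall L M, fubini_study (psi L) (psi M) = fubini_study L M) -> continuous psi.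
Proof.
move=> iso L A /nbhs_ballP[e e0 eA]; apply/nbhs_ballP; exists e; first exact: e0.
move=> M /ball_P2 LM; apply: eA; apply/ball_P2; rewrite iso; exact: LM.
Qed.

(** Mean stability depends on the support only.  Letters of words are tested
    with [List.In], which makes sense for maps of any type. *)
Definition family_mean_stable (Y : Type) (act : Y -> P2 R -> P2 R)
    (Lam : set (P2 R)) (G : set Y) : Prop :=
  (forall g, G g -> forall z, Lam z -> Lam (act g z)) /\
  exists (n m : nat) (U : 'I_m -> set (P2 R)) (Q : set (P2 R)) (c : R),
    let UU := \bigcup_j U j in
    [/\ (0 < n)%N /\ (0 < m)%N,
      forall j, U j !=set0 /\ exists2 O, open O & U j = Lam `&` O,
      [/\ Q !=set0, compact Q & Q `<=` UU],
      0 < c < 1 &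
      [/\ forall s : list Y, size s = n -> (forall g, List.In g s -> G g) ->
            compose_seq act s @` UU `<=` Q /\
            forall j x y, U j x -> U j y ->
              fubini_study (compose_seq act s x) (compose_seq act s y)
                <= c * fubini_study x y &
          forall z, Lam z -> exists s : list Y,
            [/\ (0 < size s)%N, (forall g, List.In g s -> G g) &
              UU (compose_seq act s z)]]].

Lemma in_InP (Y : eqType) (s : seq Y) g : g \in s <-> List.In g s.
Proof.
elim: s => [|h s ih] //=; rewrite inE; split.
  by move=> /predU1P[->|/ih]; [left|right].
by move=> [->|/ih->]; rewrite ?eqxx ?orbT.
Qed.

Lemma mean_stableE (Y : ptopologicalType) act (Lam : set (P2 R)) (tau : M1c R Y) :
  mean_stable act Lam Lam tau <-> family_mean_stable act Lam (tsupp tau).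
Proof.
have sub (s : seq Y) : [set` s] `<=` tsupp tau <->
    (forall g, List.In g s -> tsupp tau g).
  by split=> h g /in_InP; exact: h.
split=> [[_ inv [n [m [U [Q [c [nm UO QU c01 [h1 h2]]]]]]]]|].
  split=> //; exists n, m, U, Q, c; split=> //; split.
    by move=> s sn /sub; exact: h1.
  by move=> z /h2[s [s0 /sub sG sU]]; exists s.
move=> [inv [n [m [U [Q [c [nm UO QU c01 [h1 h2]]]]]]]].
split=> //; exists n, m, U, Q, c; split=> //; split.
  by move=> s sn /sub; exact: h1.
by move=> z /h2[s [s0 /sub sG sU]]; exists s.
Qed.

(** Mean stability is invariant under conjugation by an isometry psi; the two
    families are matched by a relation, since different maps of one family may
    act in the same way. *)
Lemma mean_stable_transfer (Y Y' : Type) (act : Y -> P2 R -> P2 R)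
    (act' : Y' -> P2 R -> P2 R) (psi : P2 R -> P2 R) (Lam Lam' : set (P2 R))
    (G : set Y) (G' : set Y') (rho : Y -> Y' -> Prop) :
  involutive psi ->
  (forall L M, fubini_study (psi L) (psi M) = fubini_study L M) ->
  (forall L, Lam L <-> Lam' (psi L)) ->
  (forall g, G g -> exists2 g', G' g' & rho g g') ->
  (forall g', G' g' -> exists2 g, G g & rho g g') ->
  (forall g g', rho g g' -> forall L, Lam L -> act g L = psi (act' g' (psi L))) ->
  family_mean_stable act' Lam' G' -> family_mean_stable act Lam G.
Proof.
move=> psiK iso LL GG' G'G rP [inv [n [m [U [Q [c [nm UO QU c01 [h1 h2]]]]]]]].
have cpsi := continuous_isometry iso.
have invG g : G g -> forall z, Lam z -> Lam (act g z).
  move=> /GG'[g' G'g' gg'] z Lz; rewrite (rP _ _ gg')//; apply/LL.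
  by rewrite psiK; apply: inv => //; apply/LL.
have wordG (s : list Y) : (forall g, List.In g s -> G g) ->
    exists s' : list Y', [/\ size s' = size s, (forall g, List.In g s' -> G' g) &
    forall L, Lam L -> compose_seq act s L = psi (compose_seq act' s' (psi L))].
  elim: s => [|g s ih] sG; first by exists [::]; split=> // L _; rewrite /= psiK.
  have [|s' [ss' s'G s'P]] := ih; first by move=> h hs; apply: sG; right.
  have [g' G'g' gg'] := GG' g (sG g (or_introl erefl)).
  exists (g' :: s'); split=> /=; first by rewrite ss'.
    by move=> h [<-//|/s'G].
  move=> L LamL; rewrite s'P; last by apply: invG => //; apply: sG; left.
  by rewrite (rP _ _ gg')// psiK.
have wordG' (s' : list Y') : (forall g, List.In g s' -> G' g) ->
    exists s : list Y, [/\ size s = size s', (forall g, List.In g s -> G g) &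
    forall L, Lam L -> compose_seq act s L = psi (compose_seq act' s' (psi L))].
  elim: s' => [|g' s' ih] s'G; first by exists [::]; split=> // L _; rewrite /= psiK.
  have [|s [ss' sG sP]] := ih; first by move=> h hs; apply: s'G; right.
  have [g Gg gg'] := G'G g' (s'G g' (or_introl erefl)).
  exists (g :: s); split=> /=; first by rewrite ss'.
    by move=> h [<-//|/sG].
  move=> L LamL; rewrite sP; last exact: invG.
  by rewrite (rP _ _ gg')// psiK.
have ULam j x : U j x -> Lam' x.
  by have [_ [W oW UE]] := UO j; rewrite UE => -[].
split=> //; exists n, m, (fun j => psi @^-1` U j), (psi @^-1` Q), c; split=> //.
- move=> j; have [[x Ux] [W oW UE]] := UO j; split.
    by exists (psi x); rewrite /= psiK.
  exists (psi @^-1` W); first by apply: open_comp => // L _; exact: cpsi.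
  by rewrite UE; apply/seteqP; split=> L [h ?]; split=> //; apply/LL.
- have [[q Qq] cQ QUU] := QU; split.
  + by exists (psi q); rewrite /= psiK.
  + rewrite (_ : psi @^-1` Q = psi @` Q).
      by apply: continuous_compact => //; exact: continuous_subspaceT.
    apply/seteqP; split=> [L QL|_ [L QL <-]]; last by rewrite /= psiK.
    by exists (psi L); rewrite ?psiK.
  + by move=> L /QUU[j _ Uj]; exists j.
- split.
    move=> s sn sG; have [s' [ss' s'G s'P]] := wordG s sG; rewrite -ss' in sn.
    have [i1 i2] := h1 s' sn s'G; split.
      move=> _ [L [j _ /= Uj] <-]; rewrite /= s'P ?psiK; last first.
        by apply/LL; exact: ULam Uj.
      by apply: i1; exists (psi L) => //; exists j.
    move=> j x y /= Ux Uy; rewrite !s'P; [|by apply/LL; exact: ULam Uy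
      |by apply/LL; exact: ULam Ux].
    by rewrite iso -(iso x y); exact: (i2 j _ _ Ux Uy).
  move=> z Lz; have [s' [s'0 s'G [j _ Uj]]] := h2 _ ((LL z).1 Lz).
  have [s [ss' sG sP]] := wordG' s' s'G.
  exists s; split=> //; first by rewrite ss'.
  by exists j => //=; rewrite sP ?psiK.
Qed.

End MeanStableFamily.

(** * Mean stability is steerability *)
Section SteerableMeanStable.
Context {R : realType}.
Local Notation C := R[i].
Implicit Types (g : Xplus1 R) (G : set (Xplus1 R)) (s : seq (Xplus1 R)).

Definition act1 g (L : P2 R) : P2 R := extend (Xplus1_val g) L.

Lemma act1_embed g (w : C * C) : act1 g (embed w) = embed (hen g w).
Proof. exact: extend_embed. Qed.

Lemma compose_embed s (w : C * C) :
  compose_seq act1 s (embed w) = embed (hen_seq s w).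
Proof.
by elim: s w => [//|g s ih] w; rewrite /compose_seq/= act1_embed; exact: ih.
Qed.

Lemma act1_neq_pt100 g L : L <> pt100 -> act1 g L <> pt100.
Proof.
move=> /P2_caseU[[w ->]|[x [y [y0 ->]]]].
  by rewrite act1_embed; exact: embed_neq_pt100.
by rewrite /act1 extend_infinity//; apply: hpoint_infinity_y; rewrite oner_neq0.
Qed.

Definition chart (a : C * C) : P2 R := chart010 a.1 a.2.

Lemma pt010_chart : pt010 = chart (0, 0).
Proof. by []. Qed.

(** Both Lipschitz bounds between the chart and the plane come from the
    exterior product, up to the normalisation of the vectors. *)
Lemma fs_chart_le (a b : C * C) : fubini_study (chart a) (chart b) <=
  8 * (1 + cnorm a.1 + cnorm a.2) * (cnorm (b.1 - a.1) + cnorm (b.2 - a.2)).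
Proof.
set s := sin (fubini_study (chart a) (chart b)).
have s0 : 0 <= s by exact: sin_fs_ge0.
have sE := sin_fubini_study (hvec_chart010 a.1 a.2) (hvec_chart010 b.1 b.2).
rewrite -/(chart010 _ _) -/(chart010 _ _) -/(chart a) -/(chart b) -/s in sE.
have h1 (c : C * C) : 1 <= hnorm2 c.1 1 c.2.
  rewrite /hnorm2 cnorm1 expr1n.
  by have := sqr_ge0 (cnorm c.1); have := sqr_ge0 (cnorm c.2); lra.
set M := 1 + _ + _; set D := _ + cnorm (b.2 - a.2).
have du0 := cnorm_ge0 (b.1 - a.1); have dw0 := cnorm_ge0 (b.2 - a.2).
have a10 := cnorm_ge0 a.1; have a20 := cnorm_ge0 a.2.
have D0 : 0 <= D by rewrite /D; lra.
have M1 : 1 <= M by rewrite /M; lra.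
have w3 : cnorm (a.1 * b.2 - b.1 * a.2) <= M * D.
  have -> : a.1 * b.2 - b.1 * a.2 = a.1 * (b.2 - a.2) - a.2 * (b.1 - a.1) by ring.
  rewrite (le_trans (cnormB_le _ _))// !cnormM /M /D.
  have := mulr_ge0 a10 du0; have := mulr_ge0 a20 dw0.
  by move: du0 dw0; clear; nra.
have wle : wedge2 a.1 1 a.2 b.1 1 b.2 <= (2 * (M * D)) ^+ 2.
  rewrite /wedge2 !mulr1 !mul1r (cnormB a.1).
  have e1 : cnorm (b.1 - a.1) <= M * D.
    have : 1 * D <= M * D by rewrite ler_wpM2r.
    by rewrite /D; move: du0 dw0; clear; lra.
  have e2 : cnorm (b.2 - a.2) <= M * D.
    have : 1 * D <= M * D by rewrite ler_wpM2r.
    by rewrite /D; move: du0 dw0; clear; lra.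
  have sq (x y : R) : 0 <= x -> x <= y -> x ^+ 2 <= y ^+ 2.
    by move=> x0 xy; rewrite lerXn2r ?nnegrE// (le_trans x0).
  have := sq _ _ du0 e1; have := sq _ _ dw0 e2; have := sq _ _ (cnorm_ge0 _) w3.
  by have := sqr_ge0 (M * D); rewrite [(2 * _) ^+ 2]exprMn; lra.
have s2 : s ^+ 2 <= (2 * (M * D)) ^+ 2.
  apply: le_trans wle; rewrite -sE -[leLHS]mulr1 ler_wpM2l ?sqr_ge0//.
  by rewrite -[leLHS]mulr1 ler_pM.
have MD : 0 <= 2 * (M * D) by rewrite mulr_ge0// mulr_ge0//; lra.
have : s <= 2 * (M * D) by rewrite -(@ler_pXn2r _ 2) ?nnegrE.
have := fs_le_sin (chart a) (chart b); rewrite -/s.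
by rewrite -[8 * M * D]mulrA; lra.
Qed.

Lemma fs_chart_ge (a b : C * C) : cnorm a.1 <= 1 -> cnorm a.2 <= 1 ->
  cnorm b.1 <= 1 -> cnorm b.2 <= 1 ->
  cnorm (a.1 - b.1) + cnorm (a.2 - b.2) <= 6 * fubini_study (chart a) (chart b).
Proof.
move=> a1 a2 b1 b2; set s := sin (fubini_study (chart a) (chart b)).
have s0 : 0 <= s by exact: sin_fs_ge0.
have sE := sin_fubini_study (hvec_chart010 a.1 a.2) (hvec_chart010 b.1 b.2).
rewrite -/(chart010 _ _) -/(chart010 _ _) -/(chart a) -/(chart b) -/s in sE.
have h3 (c : C * C) : cnorm c.1 <= 1 -> cnorm c.2 <= 1 -> hnorm2 c.1 1 c.2 <= 3.
  move=> c1 c2; rewrite /hnorm2 cnorm1 expr1n.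
  have : cnorm c.1 ^+ 2 <= 1 by rewrite expr_le1 ?cnorm_ge0.
  have : cnorm c.2 ^+ 2 <= 1 by rewrite expr_le1 ?cnorm_ge0.
  by lra.
have hh : hnorm2 a.1 1 a.2 * hnorm2 b.1 1 b.2 <= 3 * 3.
  by rewrite ler_pM ?hnorm2_ge0// h3.
have : wedge2 a.1 1 a.2 b.1 1 b.2 <= s ^+ 2 * (3 * 3).
  by rewrite -sE ler_wpM2l ?sqr_ge0.
rewrite /wedge2 !mulr1 !mul1r (cnormB b.2) => w.
have w3 := sqr_ge0 (cnorm (a.1 * b.2 - b.1 * a.2)).
have q1 := sqr_ge0 (cnorm (a.1 - b.1)); have q2 := sqr_ge0 (cnorm (a.2 - b.2)).
have sq (x : R) : x ^+ 2 <= (3 * s) ^+ 2 -> x <= 3 * s.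
  move=> h; rewrite leNgt; apply/negP => lt.
  have s30 : 0 <= 3 * s by rewrite mulr_ge0.
  have : (3 * s) ^+ 2 < x ^+ 2 by rewrite ltrXn2r ?nnegrE// (le_trans s30)// ltW.
  by rewrite ltNge h.
have e1 : cnorm (a.1 - b.1) <= 3 * s by apply: sq; rewrite exprMn; lra.
have e2 : cnorm (a.2 - b.2) <= 3 * s by apply: sq; rewrite exprMn; lra.
by have := sin_fs_le (chart a) (chart b); rewrite -/s; lra.
Qed.

Lemma fs_chart_small (a : C * C) (e : R) : 0 < e -> exists2 d : R, 0 < d &
  forall b : C * C, cnorm (b.1 - a.1) < d -> cnorm (b.2 - a.2) < d ->
  fubini_study (chart a) (chart b) < e.
Proof.
move=> e0; have M0 : 0 < 8 * (1 + cnorm a.1 + cnorm a.2).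
  by have := cnorm_ge0 a.1; have := cnorm_ge0 a.2; lra.
exists (e / (8 * (1 + cnorm a.1 + cnorm a.2)) / 2); first by rewrite !divr_gt0.
move=> b b1 b2; apply: (le_lt_trans (fs_chart_le a b)).
by rewrite mulrC -ltr_pdivlMr//; lra.
Qed.

Lemma continuous_chart : continuous chart.
Proof.
move=> a A /nbhs_ballP[e e0 eA]; have [d d0 dP] := fs_chart_small a e0.
apply/nbhs_C2P; exists d; first exact: d0.
by move=> b b1 b2; apply: eA; exact: dP.
Qed.

Lemma fs_embed (a b : C * C) :
  fubini_study (embed a) (embed b) = fubini_study (chart a) (chart b).
Proof. exact: (fs_swap_yz (hvec_chart010 a.1 a.2) (hvec_chart010 b.1 b.2)). Qed.

Lemma open_chart_image (A : set (C * C)) : open A -> open (chart @` A).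
Proof.
move=> /open_C2P oA; rewrite openE => _ [a Aa <-].
have [e e0 eA] := oA a Aa.
have [d d0 dP] := @near_chart010 R (hnorm2 a.1 a.2 1) e e0.
apply/nbhs_ballP; exists d => // M /ball_P2/(dP _ _ _ (lexx _))[u [v [-> ue ve]]].
by exists (u, v) => //; exact: eA.
Qed.

Lemma wnorm_ge0 (A : R) (a : C * C) : 0 <= A -> 0 <= wnorm A a.
Proof. by move=> A0; rewrite addr_ge0 ?mulr_ge0 ?cnorm_ge0. Qed.

Lemma wnorm_coord (A : R) (a : C * C) : 1 <= A ->
  cnorm a.1 + cnorm a.2 <= wnorm A a.
Proof.
move=> A1; rewrite /wnorm lerD2l -[leLHS]mul1r ler_wpM2r//; exact: cnorm_ge0.
Qed.

Lemma open_wnorm (A r : R) : 1 <= A -> open [set a : C * C | wnorm A a < r].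
Proof.
move=> A1; apply/open_C2P => a ar; exists ((r - wnorm A a) / (1 + A)).
  by rewrite divr_gt0 ?subr_gt0//; lra.
have A0 : 0 < 1 + A by lra.
move=> b; rewrite !ltr_pdivlMr// => b1 b2; rewrite /= /wnorm in ar *.
have := cnormD (b.1 - a.1) a.1; have := cnormD (b.2 - a.2) a.2; rewrite !subrK.
have := cnorm_ge0 (b.1 - a.1); have := cnorm_ge0 (b.2 - a.2).
move: b1 b2 ar; move: (cnorm (b.1 - a.1)) (cnorm (b.2 - a.2)) => x y b1 b2 ar y0 x0 h2 h1.
have e1 : A * cnorm b.2 <= A * (y + cnorm a.2) by rewrite ler_wpM2l//; lra.
have -> : r = cnorm a.1 + A * cnorm a.2 + (r - (cnorm a.1 + A * cnorm a.2)) by ring.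
set t := r - _ in b1 b2 *.
have e2 : x + A * y < t.
  have lex : x <= Num.max x y by rewrite le_max lexx.
  have ley : y <= Num.max x y by rewrite le_max lexx orbT.
  have : Num.max x y * (1 + A) < t by rewrite /Num.max; case: ifP.
  have : A * y <= A * Num.max x y by rewrite ler_wpM2l//; lra.
  by lra.
by rewrite mulrDr in e1; lra.
Qed.

Lemma closed_wnorm (A r : R) : closed [set a : C * C | wnorm A a <= r].
Proof.
apply: (@preimage_closed _ _ (wnorm A) [set x | x <= r]); last exact: closed_le.
move=> a _; apply: cvgD.
  apply: (@continuous_comp _ _ _ fst (@cnorm R)); first exact: cvg_fst.
  exact: continuous_cnorm.
apply: cvgM; first exact: cvg_cst.
apply: (@continuous_comp _ _ _ snd (@cnorm R)); first exact: cvg_snd.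
exact: continuous_cnorm.
Qed.

(** All the maps contract a common neighbourhood of [0 : 1 : 0]; if every point
    can be steered to infinity, it can be steered into that neighbourhood. *)
Lemma steerable_mean_stable G : compact G -> steerable G ->
  family_mean_stable act1 (~` [set pt100]) G.
Proof.
move=> cG sG; have [K [e [e0 tK]]] := tame_compact cG.
have {tK} tK g : G g -> tame K (Xplus1_val g).
  by move=> Gg; apply: (tK g g) => //; exact: ballxx.
have [A [r [A1 r0 r1 contr]]] := @chart_contraction R K.
have A0 : 0 <= A by lra.
have zeroE g : chart_map (Xplus1_val g) (0, 0) = (0, 0).
  have n1 : (0 < (size (hpoly (Xplus1_val g))).-2)%N.
    by have := hpoly_deg (Xplus1_val g); case: (size _) => [|[|[|]]].
  by rewrite /chart_map /chart_quot /= expr0n gtn_eqF//= mul0r mulr0 mul0r.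
have w00 : wnorm A (0, 0) < r by rewrite /wnorm /= cnorm0 mulr0 addr0.
have step g a : G g -> wnorm A a < r ->
    act1 g (chart a) = chart (chart_map (Xplus1_val g) a) /\
    wnorm A (chart_map (Xplus1_val g) a) <= 1 / 2 * wnorm A a.
  move=> Gg ar; have [D0 h] := contr _ (tK g Gg) a (0, 0) ar w00.
  split; last by move: h; rewrite zeroE !subr0.
  by rewrite /act1 /chart extend_chart010 ?hjac1//; case: a ar D0 h.
have word s a b : (forall g, List.In g s -> G g) -> wnorm A a < r -> wnorm A b < r ->
  exists a' b', [/\ compose_seq act1 s (chart a) = chart a',
    compose_seq act1 s (chart b) = chart b',
    wnorm A a' <= (1 / 2) ^+ size s * wnorm A a,
    wnorm A b' <= (1 / 2) ^+ size s * wnorm A b &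
    wnorm A (a' - b') <= (1 / 2) ^+ size s * wnorm A (a - b)].
  elim: s a b => [|g s ih] a b sGs ar br.
    by exists a, b; rewrite !expr0 !mul1r.
  have Gg : G g by apply: sGs; left.
  have [aE a2] := step g a Gg ar; have [bE b2] := step g b Gg br.
  have [_ ab2] := contr _ (tK g Gg) a b ar br.
  have wa := wnorm_ge0 a A0; have wb := wnorm_ge0 b A0.
  have [||a' [b' [aE' bE' a3 b3 ab3]]] := ih (chart_map (Xplus1_val g) a)
    (chart_map (Xplus1_val g) b) (fun h hs => sGs h (or_intror hs)).
  - by lra.
  - by lra.
  exists a', b'; rewrite /compose_seq /= aE bE; split=> //.
  - by rewrite (le_trans a3)// exprSr -mulrA ler_wpM2l ?exprn_ge0.
  - by rewrite (le_trans b3)// exprSr -mulrA ler_wpM2l ?exprn_ge0.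
  - by rewrite (le_trans ab3)// exprSr -mulrA ler_wpM2l ?exprn_ge0.
have [n [n0 nP]] : exists n : nat, (0 < n)%N /\ (1 / 2) ^+ n * (144 * A) <= 1 / 2.
  have : (1 / 2 : R) ^+ k @[k --> \oo] --> (0 : R).
    by apply: cvg_expr; rewrite ger0_norm//; lra.
  have e0' : 0 < 1 / 2 / (144 * A) by rewrite !divr_gt0//; lra.
  move=> /cvgr0Pnorm_lt/(_ _ e0')[k _ /(_ k.+1 (leqnSn k))].
  rewrite ger0_norm ?exprn_ge0// ltr_pdivlMr; last by lra.
  by move=> h; exists k.+1; split=> //; exact: ltW.
pose V : set (C * C) := [set a | wnorm A a < r].
have halfn : (1 / 2 : R) ^+ n <= 1 / 2.
  by rewrite -[leRHS]expr1 ler_wiXn2l//; lra.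
have Vchart a : V a -> chart a <> pt100.
  move=> _ /hpoint_eqP; rewrite !hvec_neq0 oner_neq0 !orbT => /(_ isT isT).
  rewrite /wedge2 !(mulr0, mul0r, mul1r, mulr1, subr0, sub0r, oppr0, cnormN, cnorm0, cnorm1).
  by have := sqr_ge0 (cnorm a.2); rewrite expr0n/= expr1n; lra.
split; first by move=> g _ z; exact: act1_neq_pt100.
exists n, 1%N, (fun=> chart @` V), (chart @` [set a | wnorm A a <= r / 2]), (1 / 2).
have UUE : \bigcup_(_ : 'I_1) (chart @` V) = chart @` V.
  by apply/seteqP; split=> [z [j _]//|z Vz]; exists ord0.
split=> //.
- move=> _; split; first by exists (chart (0, 0)); exists (0, 0).
  exists (chart @` V); first by apply: open_chart_image; exact: open_wnorm.
  by apply/seteqP; split=> [_ [a Va <-]|_ [_]//]; split; [exact: Vchart|exists a].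
- rewrite UUE; split.
  + exists (chart (0, 0)); exists (0, 0) => //=; rewrite /wnorm /= cnorm0 mulr0 addr0.
    by rewrite divr_ge0// ltW.
  + apply: continuous_compact; first exact: (continuous_subspaceT continuous_chart).
    apply: (@subclosed_compact _ _ (bidisk r)).
    * exact: closed_wnorm.
    * exact: compact_bidisk.
    * move=> a /= ar; have := wnorm_coord a A1.
      by have := cnorm_ge0 a.1; have := cnorm_ge0 a.2; split; lra.
  + move=> _ [a ar <-]; exists a => //=; apply: le_lt_trans ar _.
    by rewrite ltr_pdivrMr// ltr_pMr// ltr1n.
- by apply/andP; split; lra.
- rewrite UUE; split.
    move=> s sn sGs; split.
      move=> _ [_ [a Va <-] <-]; have [a' [_ [-> _ h _ _]]] := word s a a sGs Va Va.
      exists a' => //=; rewrite (le_trans h)// sn.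
      have : (1 / 2) ^+ n * wnorm A a <= 1 / 2 * r.
        by rewrite ler_pM ?exprn_ge0 ?wnorm_ge0//; exact: ltW.
      by lra.
    move=> _ _ _ [a Va <-] [b Vb <-].
    have [a' [b' [-> -> ha hb hab]]] := word s a b sGs Va Vb.
    have small (c c' : C * C) : wnorm A c < r ->
        wnorm A c' <= (1 / 2) ^+ size s * wnorm A c -> cnorm c'.1 + cnorm c'.2 <= 1.
      move=> cr c'c; apply: (le_trans (wnorm_coord c' A1)).
      apply: (le_trans c'c); rewrite sn.
      have : (1 / 2) ^+ n * wnorm A c <= 1 / 2 * r.
        by rewrite ler_pM ?exprn_ge0 ?wnorm_ge0//; exact: ltW.
      by lra.
    have one (c : C * C) : wnorm A c < r -> cnorm c.1 <= 1 /\ cnorm c.2 <= 1.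
      move=> cr; have := wnorm_coord c A1.
      by have := cnorm_ge0 c.1; have := cnorm_ge0 c.2; split; lra.
    have [a1 a2] := one a Va; have [b1 b2] := one b Vb.
    have up := fs_chart_le a' b'; have sa := small _ _ Va ha.
    have lo := fs_chart_ge a1 a2 b1 b2.
    have d1 : cnorm (b'.1 - a'.1) + cnorm (b'.2 - a'.2) <= wnorm A (a' - b').
      rewrite (cnormB b'.1) (cnormB b'.2).
      exact: (wnorm_coord (a' - b') A1).
    have d2 : wnorm A (a - b) <= A * (cnorm (a.1 - b.1) + cnorm (a.2 - b.2)).
      rewrite mulrDr lerD2r -[leLHS]mul1r ler_wpM2r//; exact: cnorm_ge0.
    set F := fubini_study (chart a) (chart b) in lo *.
    have F0 : 0 <= F by exact: fubini_study_ge0.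
    set D' := cnorm (b'.1 - a'.1) + _ in up d1.
    have D'0 : 0 <= D' by rewrite addr_ge0 ?cnorm_ge0.
    have u1 : 8 * (1 + cnorm a'.1 + cnorm a'.2) * D' <= 16 * D'.
      by rewrite ler_wpM2r//; lra.
    have u2 : D' <= (1 / 2) ^+ n * (A * (6 * F)).
      rewrite (le_trans d1)// (le_trans hab)// sn ler_wpM2l ?exprn_ge0//.
      by rewrite (le_trans d2)// ler_wpM2l.
    have u3 : (1 / 2) ^+ n * (144 * A) * F <= 1 / 2 * F by rewrite ler_wpM2r.
    have u4 : 16 * D' <= 16 * ((1 / 2) ^+ n * (A * (6 * F))) by rewrite ler_wpM2l.
    have pos : 0 <= (1 / 2) ^+ n * (A * F) by rewrite !mulr_ge0 ?exprn_ge0.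
    by move: up u1 u3 u4 pos; clear; lra.
  have [g Gg] := steerable_neq0 sG.
  move=> z /P2_caseU[[w ->]|[x [y [y0 ->]]]]; last first.
    exists [:: g]; split=> // [h [<-//|//]|].
    rewrite /compose_seq/= /act1 extend_infinity//.
    by exists (0, 0) => //; rewrite /V /= w00.
  (* Far enough in the escaping region one more map leads into V. *)
  pose T : R := 1 + 8 / r; have T0 : 0 <= T by rewrite addr_ge0// divr_ge0// ltW.
  have [R1 R11 growth] := @tame_growth R K T T0.
  have K0 : 0 <= K%:R :> R by exact: ler0n.
  have [s0 s0G [y_large x_small]] := sG w (R1 + K%:R + A).
  exists (rcons s0 g); split; first by rewrite size_rcons.
    by move=> h /in_InP; rewrite mem_rcons inE => /predU1P[->//|/s0G].
  rewrite compose_embed -cats1 hen_seq_cat /=.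
  move: (hen_seq s0 w) y_large x_small => [x y] /= y_large x_small.
  have [_ al _ _] := tK g Gg.
  have h1 := growth _ (tK g Gg) y ltac:(lra).
  have h2 := cnormD y (hshift (Xplus1_val g)).
  have h3 := cnorm_sub_le (hpoly (Xplus1_val g)).[y] x.
  have y0 : 0 < cnorm y by lra.
  rewrite henE /=; set x' := y + _ in h2 *; set y' := _ - x in h3 *.
  have y'_large : 8 / r * cnorm y <= cnorm y' by move: h1; rewrite /T; lra.
  have y'0 : 0 < cnorm y' by apply: lt_le_trans y'_large; rewrite mulr_gt0// divr_gt0.
  have y'n0 : y' != 0 by rewrite -cnorm_gt0.
  exists (x' / y', 1 / y'); last first.
    rewrite /chart /embed /chart010 /= -[RHS](@hpoint_scale _ y'^-1) ?invr_eq0//.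
    by rewrite mulVf// mulr1 mul1r mulrC.
  rewrite /V /= /wnorm /= !cnorm_div cnorm1 mulrA -mulrDl ltr_pdivrMr// mulr1.
  have : r * (8 / r * cnorm y) <= r * cnorm y' by rewrite ler_pM2l.
  by rewrite mulrA mulrCA mulfV ?gt_eqF// mulr1; lra.
Qed.

(** Invariance of volume, applied to the box of side rho around z and to the box
    around z' that contains its image. *)
Lemma box_shrink s (z z' : C * C) (rho e : R) : 0 < rho -> 0 < e ->
  (forall w, cnorm (w.1 - z.1) < rho -> cnorm (w.2 - z.2) < rho ->
     cnorm ((hen_seq s w).1 - z'.1) < e /\ cnorm ((hen_seq s w).2 - z'.2) < e) ->
  rho <= 2 * e.
Proof.
move=> rho0 e0 shr; have rho2 : 0 < rho / 2 by rewrite divr_gt0.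
have sub : box z (rho / 2) `<=` hen_seq s @^-1` box z' e.
  move=> w [[w1 w2] [w3 w4]].
  have ReB (u v : C) : complex.Re (u - v) = complex.Re u - complex.Re v.
    by case: u v => [? ?] [? ?].
  have ImB (u v : C) : complex.Im (u - v) = complex.Im u - complex.Im v.
    by case: u v => [? ?] [? ?].
  have [||h1 h2] := shr w.
  - by apply: le_lt_trans (cnorm_le_ReIm _) _; rewrite ReB ImB; lra.
  - by apply: le_lt_trans (cnorm_le_ReIm _) _; rewrite ReB ImB; lra.
  have r1 := Re_le_cnorm ((hen_seq s w).1 - z'.1).
  have r2 := Im_le_cnorm ((hen_seq s w).1 - z'.1).
  have r3 := Re_le_cnorm ((hen_seq s w).2 - z'.2).
  have r4 := Im_le_cnorm ((hen_seq s w).2 - z'.2).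
  rewrite ReB in r1; rewrite ImB in r2; rewrite ReB in r3; rewrite ImB in r4.
  by split; split; [exact: le_lt_trans r1 h1|exact: le_lt_trans r2 h1|
    exact: le_lt_trans r3 h2|exact: le_lt_trans r4 h2].
have [m v] := volume_hen_seq s (meas4_box z' e).
have := le_volume (meas4_box z (rho / 2)) m sub.
rewrite v (volume_box _ rho2) (volume_box _ e0) lee_fin => h.
clear v m sub shr; have p1 : 0 <= rho / 2 *+ 2 by rewrite mulrn_wge0// ltW.
have p2 : 0 <= e *+ 2 by rewrite mulrn_wge0// ltW.
move: h; rewrite ler_pXn2r ?nnegrE//.
by rewrite -[e *+ 2]mulr_natl -[X in X <= _ -> _]mulr_natl mulrC divfK.
Qed.

(** The maps preserve volume, so contraction on U excludes bounded orbits that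
    start in U; by the filtration the other orbits escape. *)
Lemma mean_stable_steerable G : compact G ->
  family_mean_stable act1 (~` [set pt100]) G -> steerable G.
Proof.
move=> cG [inv [n [m [U [Q [c [[n0 _] UO [_ cQ QUU] /andP[c0 c1] [h1 h2]]]]]]]].
have [r good_r] := compact_good cG.
have [g0 Gg0] : G !=set0.
  have [[|g s] [//]] := h2 _ (@embed_neq_pt100 R (0, 0)).
  by move=> _ sG _; exists g; apply: sG; left.
apply: (@steerable_from_bidisk _ _ r); [by exists g0|exact: good_r|].
move=> z _; have [s0 [_ s0G [j0 _]]] := h2 _ (@embed_neq_pt100 R z).
rewrite compose_embed; set z1 := hen_seq s0 z => Uz1.
pose gam (k : nat) := g0; have gg k : good r (gam k) by exact: good_r.
have wg k : word_in G (mkseq gam k) by exact: word_in_mkseq.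
suff [k ek] : exists k, escaping (2 * r) (orbit gam k z1).
  exists (s0 ++ mkseq gam k); last by rewrite hen_seq_cat -orbit_mkseq.
  by apply: word_in_cat => // g /in_InP; exact: s0G.
apply: contrapT => ne; set M := Num.max (cnorm z1.1) (2 * r).
have bd k : bidisk M (orbit gam k z1).
  by apply: orbit_bounded => // i _ ei; apply: ne; exists i.
pose B := M ^+ 2 + M ^+ 2 + 1.
have hB k : hnorm2 (orbit gam k z1).1 (orbit gam k z1).2 1 <= B.
  have [b1 b2] := bd k; rewrite /hnorm2 cnorm1 expr1n /B lerD2r.
  have M0 : 0 <= M := le_trans (cnorm_ge0 _) b1.
  by rewrite lerD// lerXn2r ?nnegrE ?cnorm_ge0.
(* A Lebesgue number of the cover of Q by the U j. *)
have [N NP] : exists N : nat, forall q L, Q q -> L <> pt100 ->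
    fubini_study q L < N.+1%:R^-1 -> exists j, U j q /\ U j L.
  have /compact_near_coveringP cQ' := cQ.
  have := cQ' nat \oo (fun k q => q <> pt100 -> forall L, L <> pt100 ->
    fubini_study q L < k.+1%:R^-1 -> exists j, U j q /\ U j L) _.
  case.
    move=> q Qq; have [j _ Uq] := QUU q Qq; have [_ [W oW UE]] := UO j.
    have Wq : W q by move: Uq; rewrite UE => -[].
    have [d d0 dW] := (nbhs_ballP _ _).1 (open_nbhs_nbhs (conj oW Wq)).
    have d20 : 0 < d / 2 by rewrite divr_gt0.
    exists (ball q (d / 2), [set k | k.+1%:R^-1 < d / 2]).
      split=> /=; first exact: nbhsx_ballx.
      exact: near_infty_natSinv_lt (PosNum d20).
    move=> [q' k] [/= qq' kd] q'1 L L1 q'L; exists j; rewrite UE.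
    split; split=> //; apply: dW.
      by apply: le_ball qq'; lra.
    rewrite (splitr d); apply: ball_triangle qq' _.
    by apply/ball_P2; exact: lt_trans kd.
  move=> N _ NP; exists N => q L Qq L1 qL; apply: (NP N (leqnn N) q Qq) => //.
  have [j _ Uq] := QUU q Qq; have [_ [W oW UE]] := UO j.
  by move: Uq; rewrite UE => -[].
have Uneq j L : U j L -> L <> pt100.
  by have [_ [W oW UE]] := UO j; rewrite UE => -[].
have l0 : 0 < N.+1%:R^-1 :> R by rewrite invr_gt0 ltr0Sn.
(* A neighbourhood of the starting point inside a single U j. *)
have [rho rho0 rhoP] : exists2 rho : R, 0 < rho & forall w : C * C,
    cnorm (w.1 - z1.1) < rho -> cnorm (w.2 - z1.2) < rho ->
    U j0 (embed w) /\ fubini_study (embed z1) (embed w) < N.+1%:R^-1.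
  have [_ [W oW UE]] := UO j0.
  have Wz : W (embed z1) by move: Uz1; rewrite UE => -[].
  have [d d0 dW] := (nbhs_ballP _ _).1 (open_nbhs_nbhs (conj oW Wz)).
  have m0 : 0 < Num.min d N.+1%:R^-1 by rewrite lt_min d0.
  have [rho rho0 rhoP] := fs_chart_small z1 m0; exists rho; first exact: rho0.
  move=> w w1 w2; have := rhoP w w1 w2.
  rewrite -fs_embed lt_min => /andP[wd wl]; split; last exact: wl.
  rewrite UE; split; first exact: embed_neq_pt100.
  by apply: dW; apply/ball_P2.
pose F k := mkseq gam (n * k).
have FS k : F k.+1 = F k ++ nseq n g0.
  have constE a l : map gam (iota a l) = nseq l g0 by elim: l a => //= l ih a; rewrite ih.
  by rewrite /F mulnS addnC /mkseq iotaD map_cat !constE.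
have contr k (w : C * C) : cnorm (w.1 - z1.1) < rho -> cnorm (w.2 - z1.2) < rho ->
    (exists j, U j (embed (hen_seq (F k) z1)) /\ U j (embed (hen_seq (F k) w))) /\
    fubini_study (embed (hen_seq (F k) z1)) (embed (hen_seq (F k) w)) <=
      c ^+ k * N.+1%:R^-1.
  move=> w1 w2; have [Uw dw] := rhoP w w1 w2.
  elim: k => [|k [[j [Uz Uw']] ih]].
    by rewrite /F muln0 expr0 mul1r; split; [exists j0|exact: ltW].
  have ng g : List.In g (nseq n g0) -> G g.
    by move=> /in_InP; rewrite mem_nseq => /andP[_ /eqP->].
  have [i1 i2] := h1 (nseq n g0) (size_nseq _ _) ng.
  rewrite FS !hen_seq_cat -!(compose_embed (nseq n g0)).
  have dd := i2 j _ _ Uz Uw'.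
  have dk : fubini_study (compose_seq act1 (nseq n g0) (embed (hen_seq (F k) z1)))
      (compose_seq act1 (nseq n g0) (embed (hen_seq (F k) w))) <=
      c ^+ k.+1 * N.+1%:R^-1.
    apply: (le_trans dd); rewrite exprS -mulrA ler_wpM2l//; exact: ltW.
  split; last exact: dk.
  apply: NP.
  - by apply: i1; exists (embed (hen_seq (F k) z1)) => //; exists j.
  - by rewrite compose_embed; exact: embed_neq_pt100.
  - apply: (le_lt_trans dk); rewrite -[ltRHS]mul1r ltr_pM2r//.
    by rewrite exprn_ilt1// ltW.
have e0' : 0 < rho / 4 by rewrite divr_gt0.
have [d d0 dP] := @near_embed R B (rho / 4) e0'.
have [k kd] : exists k : nat, c ^+ k * N.+1%:R^-1 < d.
  have : c ^+ k @[k --> \oo] --> (0 : R).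
    by apply: cvg_expr; rewrite gtr0_norm.
  move=> /cvgr0Pnorm_lt/(_ _ d0)[k _ /(_ k (leqnn k))].
  rewrite gtr0_norm ?exprn_gt0// => ckd; exists k.
  apply: le_lt_trans ckd; rewrite -[leRHS]mulr1 ler_pM2l ?exprn_gt0//.
  by rewrite invf_le1// ler1n.
have : rho <= 2 * (rho / 4).
  apply: (@box_shrink (F k) z1 (hen_seq (F k) z1)) => // w w1 w2.
  have [_ dk] := contr k w w1 w2.
  have hBk : hnorm2 (hen_seq (F k) z1).1 (hen_seq (F k) z1).2 1 <= B.
    by rewrite -orbit_mkseq; exact: hB.
  have [w' [/embed_inj -> ? ?]] := dP _ _ hBk (le_lt_trans dk kd).
  by split.
by lra.
Qed.

End SteerableMeanStable.

(** * Noisy families are steerable *)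
Section Noise.
Context {R : realType}.
Local Notation C := R[i].
Implicit Types (g h : Xplus1 R) (z v w : C * C) (G : set (Xplus1 R)).

Definition small_noise (e : R) v : Prop := cnorm v.1 < e /\ cnorm v.2 < e.

(** The image is a preimage under the inverse map, which is a flipped map. *)
Lemma open_image_hen h (A : set (C * C)) : open A -> open (hen h @` A).
Proof.
move=> oA; pose k w := swap (hen (flip h) (swap w)).
have -> : hen h @` A = k @^-1` A.
  apply/seteqP; split=> [_ [z Az <-]|w Aw]; first by rewrite /preimage/= /k henK swapK.
  exists (k w) => //; have := henK (flip h) (swap w); rewrite flipK swapK => e.
  by rewrite -[hen h _]swapK e swapK.
apply: open_comp oA => w _.
have : (fun w => hen (flip h) (swap w)) @ w --> hen (flip h) (swap w).
  apply: (@cvg_hen _ _ _ _ (fun=> flip h) (fun w => swap w)); first exact: cvg_cst.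
  by apply: cvg_C2; [exact: cvg_snd|exact: cvg_fst].
move=> c; apply: cvg_C2.
  by apply: cvg_comp c _; exact: cvg_snd.
by apply: cvg_comp c _; exact: cvg_fst.
Qed.

Lemma volume_image_hen h (A : set (C * C)) : open A -> Leb4 (hen h @` A) = Leb4 A.
Proof.
move=> oA; rewrite -(volume_hen h (meas4_open (@open_image_hen h _ oA))).
congr (Leb4 _); apply/seteqP; split=> [z [w Aw hw]|z Az]; last by exists z.
by have := henonK (Xplus1_val h) z; have := henonK (Xplus1_val h) w;
  rewrite -![henon _ _]/(hen _ _) hw => -> <-.
Qed.

(** A translate of a point of [B] whose first real part is almost maximal
    carries a cube disjoint from [B]. *)
Lemma volume_expand (A B : set (C * C)) (e M : R) : meas4 A -> meas4 B ->
  0 < e -> B !=set0 -> B `<=` bidisk M ->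
  (forall z v, B z -> small_noise e v -> A (z + v)) -> (Leb4 B < Leb4 A)%E.
Proof.
move=> mA mB e0 [z0 Bz0] BM BA.
pose S : set R := [set complex.Re z.1 | z in B].
have S0 : has_sup S.
  split; first by exists (complex.Re z0.1); exists z0.
  exists M => _ [z Bz <-]; have [h _] := BM z Bz.
  by apply: le_trans h; exact: le_trans (ler_norm _) (Re_le_cnorm _).
(* A point less than d away from the supremum, moved by 2 * d, has a box of
   radius d beyond the supremum; the displacements stay below 4 * d < e. *)
pose d := e / 8; have d0 : 0 < d by rewrite divr_gt0.
have [_ [w Bw <-] sw] := sup_adherent d0 S0.
pose c : C * C := (w.1 + (2 * d)%:C%C, w.2).
have cA : box c d `<=` A.
  move=> u [[u1 u2] [u3 u4]]; rewrite -(subrK w u) addrC; apply: BA => //.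
  split.
    apply: (le_lt_trans (cnorm_le_ReIm _)).
    move: u1 u2; rewrite /c /d /=; case: (u.1) (w.1) => [a1 a2] [b1 b2] /=.
    rewrite !ltr_norml => /andP[? ?] /andP[? ?].
    have : `|a1 - b1| < 3 * (e / 8) by rewrite ltr_norml; apply/andP; split; lra.
    have : `|a2 - b2| < e / 8 by rewrite ltr_norml; apply/andP; split; lra.
    move: e0; clear; lra.
  apply: (le_lt_trans (cnorm_le_ReIm _)).
  move: u3 u4; rewrite /c /d /=; case: (u.2) (w.2) => [a1 a2] [b1 b2] /=.
  move: e0; clear; lra.
have cB : box c d `&` B = set0.
  rewrite -subset0 => u [[[u1 _] _] Bu].
  have : complex.Re u.1 <= sup S by apply: sup_upper_bound => //; exists u.
  move: u1 sw; rewrite /c /=; case: (u.1) (w.1) => [a1 a2] [b1 b2] /=.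
  by rewrite ltr_norml => /andP[? ?]; lra.
have BsubA : B `<=` A.
  move=> z Bz; rewrite -(addr0 z); apply: BA => //.
  by split; rewrite cnorm0.
have : (Leb4 (box c d) + Leb4 B <= Leb4 A)%E.
  have mU : meas4 (box c d `|` B) by exact: measurableU (meas4_box c d) mB.
  have UA : box c d `|` B `<=` A by move=> u [/cA|/BsubA].
  have := le_volume mU mA UA; apply: le_trans.
  rewrite !Leb4E.
  have cB4 : c2_of_r4 @^-1` box c d `&` c2_of_r4 @^-1` B = set0.
    by rewrite -preimage_setI cB preimage_set0.
  by have := measureU lam4 (meas4_box c d) mB cB4; rewrite -preimage_setU => ->.
have : (Leb4 B < +oo)%E.
  apply: (@le_lt_trans _ _ (Leb4 (box 0 (`|M| + 1)))).
    apply: le_volume => //; first exact: meas4_box.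
    move=> z /BM[h1 h2]; have k : forall x : C, cnorm x <= M ->
        `|complex.Re x - 0| < `|M| + 1 /\ `|complex.Im x - 0| < `|M| + 1.
      move=> x xM; have := ler_norm M.
      by rewrite !subr0; have := Re_le_cnorm x; have := Im_le_cnorm x;
        move: xM; move: (cnorm x) `|M| => n m ? ? ? ?; split; lra.
    by split; apply: k.
  by rewrite volume_box ?ltry// ltr_wpDl.
have b0 : (0 <= Leb4 B)%E by rewrite Leb4E; exact: measure_ge0.
rewrite (volume_box c d0); move: b0; case: (Leb4 B) => [b| |] b0 bfin.
- by apply: lt_le_trans; rewrite -EFinD lte_fin ltrDr exprn_gt0// mulrn_wgt0.
- by move: bfin; rewrite ltxx.
- by move: b0.
Qed.

(** Preservation of volume leaves no room for a bounded open set that is mapped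
    into itself together with a uniform amount of noise. *)
Lemma no_bounded_absorbing h (O : set (C * C)) (e M : R) : 0 < e -> open O ->
  O !=set0 -> O `<=` bidisk M ->
  (forall z v, O z -> small_noise e v -> O (hen h z + v)) -> False.
Proof.
move=> e0 oO [z0 Oz0] OM Oabs.
have FO : hen h @` O `<=` O.
  move=> _ [z Oz <-]; rewrite -[hen h z]addr0; apply: Oabs => //.
  by split; rewrite cnorm0.
have := @volume_expand O (hen h @` O) e M (meas4_open oO)
  (meas4_open (@open_image_hen h _ oO)) e0.
rewrite (@volume_image_hen h _ oO) ltxx => H.
suff : is_true false by [].
apply: H; first by exists (hen h z0); exists z0.
  by move=> z /FO /OM.
by move=> _ v [z Oz <-]; exact: Oabs.
Qed.

(** The set of points reachable from a point that cannot be steered to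
    infinity. *)
Lemma not_steerable_trapped G : compact G -> ~ steerable G ->
  exists (S : set (C * C)) (M : R), [/\ S !=set0, S `<=` bidisk M &
    forall g z, G g -> S z -> S (hen g z)].
Proof.
move=> cG /existsNP[z0 /existsNP[r0 nst]].
have [r1 goodr1] := compact_good cG.
pose r := Num.max r1 `|r0|.
have goodr g : G g -> good r g by move=> /goodr1; apply: goodW; rewrite le_max lexx.
pose S : set (C * C) := [set z | exists2 s, word_in G s & hen_seq s z0 = z].
have nesc z : S z -> ~ escaping (2 * r) z.
  move=> [s sG <-] [es1 es2]; apply: nst; exists s => //; split=> //.
  apply: le_lt_trans es1; have := ler_norm r0.
  have : `|r0| <= r by rewrite le_max lexx orbT.
  by have := normr_ge0 r0; move: (`|r0|) (r) => x r2; clear; lra.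
exists S, (Num.max (cnorm z0.1) (2 * r)); split.
- by exists z0; exists [::].
- move=> _ [s sG <-].
  have [->|[g0 Gg0]] : s = [::] \/ exists g, G g.
    by case: s sG => [|g s] sG; [left|right; exists g; apply: sG; rewrite inE eqxx].
  - have h1 : ~ (2 * r < cnorm z0.2 /\ cnorm z0.1 < cnorm z0.2).
      by move=> h; apply: (nesc z0) => //; exists [::].
    split=> /=; first by rewrite le_max lexx.
    rewrite le_max leNgt; apply/orP.
    have [h3|h3] := ltP (cnorm z0.1) (cnorm z0.2); last by left.
    by right; rewrite leNgt; apply/negP => h4; apply: h1.
  - pose gam k := nth g0 s k.
    have gamG k : G (gam k).
      rewrite /gam; have [ks|ks] := ltnP k (size s); last by rewrite nth_default.
      exact/sG/mem_nth.
    have sE : s = mkseq gam (size s).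
      by apply: (@eq_from_nth _ g0); rewrite ?size_mkseq// => i li; rewrite nth_mkseq.
    rewrite {1}sE -orbit_mkseq; apply: orbit_bounded => k; first exact: goodr.
    move=> ks; apply: nesc; exists (mkseq gam k); last by rewrite orbit_mkseq.
    exact: word_in_mkseq.
- move=> g _ Gg [s sG <-]; exists (rcons s g); last first.
    by rewrite -cats1 hen_seq_cat.
  by move=> k; rewrite mem_rcons inE => /orP[/eqP ->//|/sG].
Qed.

Lemma open_thicken (S : set (C * C)) (e : R) :
  open [set w | exists2 z, S z & small_noise e (w - z)].
Proof.
apply/open_C2P => w [z Sz [h1 h2]].
exists (Num.min (e - cnorm (w.1 - z.1)) (e - cnorm (w.2 - z.2))).
  by rewrite lt_min !subr_gt0 h1 h2.
move=> u; rewrite !lt_min => /andP[u1 _] /andP[_ u2]; exists z => //; split.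
  have := cnorm_triangle w.1 u.1 z.1; rewrite /= in h1 *.
  by move: u1 => /=; lra.
have := cnorm_triangle w.2 u.2 z.2; rewrite /= in h2 *.
by move: u2 => /=; lra.
Qed.

(** The absorbing open set is the e-neighbourhood of the image of the trapped
    set. *)
Lemma noise_steerable G h (e : R) : compact G -> 0 < e ->
  (forall z v, small_noise e v -> exists2 g, G g & hen g z = hen h z + v) ->
  steerable G.
Proof.
move=> cG e0 Gh; apply/not_notP => /(not_steerable_trapped cG)[S [M [[z0 Sz0] SM SG]]].
pose O : set (C * C) := [set w | exists2 z, (hen h @` S) z & small_noise e (w - z)].
have OS : O `<=` S.
  move=> w [_ [z Sz <-] nv]; have [g Gg gE] := Gh z _ nv.
  by rewrite -[w](subrK (hen h z)) addrC -gE; exact: SG.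
apply: (@no_bounded_absorbing h O e M) => //.
- exact: open_thicken.
- by exists (hen h z0); exists (hen h z0); [exists z0|rewrite subrr; split; rewrite cnorm0].
- by move=> w /OS /SM.
- move=> z v /OS Sz nv; exists (hen h z); first by exists z.
  by rewrite addrAC subrr add0r.
Qed.

(** For inverse maps the noise acts before the map; the absorbing open set is then
    the e-neighbourhood of the trapped set itself. *)
Lemma noise_steerable_pre G h (e : R) : compact G -> 0 < e ->
  (forall z v, small_noise e v -> exists2 g, G g & hen g z = hen h (z + v)) ->
  steerable G.
Proof.
move=> cG e0 Gh; apply/not_notP => /(not_steerable_trapped cG)[S [M [[z0 Sz0] SM SG]]].
pose O : set (C * C) := [set w | exists2 z, S z & small_noise e (w - z)].
have OS z : O z -> S (hen h z).
  move=> [w Sw nv]; have [g Gg gE] := Gh w _ nv.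
  by rewrite -[z](subrK w) addrC -gE; exact: SG.
apply: (@no_bounded_absorbing h O e (M + e)) => //.
- exact: open_thicken.
- by exists z0; exists z0 => //; rewrite subrr; split; rewrite cnorm0.
- move=> w [z /SM[h1 h2] [h3 h4]].
  have k (a b : C) : cnorm b <= M -> cnorm (a - b) < e -> cnorm a <= M + e.
    by have := cnorm_triangle b a 0; rewrite !subr0; lra.
  by split; [exact: k h3|exact: k h4].
- move=> z v /OS Sz nv; exists (hen h z) => //.
  by rewrite addrAC subrr add0r.
Qed.

End Noise.

(** * Supports of measures on the space of maps *)
Section Separability.
Context {R : realType}.
Local Notation C := R[i].
Implicit Types (f g h : Xplus1 R).

Lemma Xplus1_eq g h : hshift (Xplus1_val g) = hshift (Xplus1_val h) ->
  hpoly (Xplus1_val g) = hpoly (Xplus1_val h) -> g = h.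
Proof.
by move=> a p; apply/Xplus1_val_inj/Xplus_eq => //; rewrite !hjac1.
Qed.

Lemma ball_Xplus1P g (e : R) h : ball g e h <->
  [/\ 0 < e, size (hpoly (Xplus1_val g)) = size (hpoly (Xplus1_val h)),
      cnorm (hshift (Xplus1_val g) - hshift (Xplus1_val h)) < e &
      forall i, cnorm ((hpoly (Xplus1_val g))`_i - (hpoly (Xplus1_val h))`_i) < e].
Proof.
split=> [/ball_Xplus1[s a j p]|[e0 s a p]].
  by split=> //; exact: le_lt_trans (cnorm_ge0 _) a.
by apply/ball_Xplus1; split=> //; rewrite !hjac1 subrr cnorm0.
Qed.

Lemma Xplus1_hausdorff : hausdorff_space (Xplus1 R).
Proof.
move=> g h gh.
have near (e : R) : 0 < e -> ball g e h.
  move=> e0; have e20 : 0 < e / 2 by rewrite divr_gt0.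
  have [k [gk hk]] := gh _ _ (nbhsx_ballx g _ e20) (nbhsx_ballx h _ e20).
  by rewrite (splitr e); apply: ball_triangle gk (ball_sym hk).
have small (x : C) : (forall e : R, 0 < e -> cnorm x < e) -> x = 0.
  move=> xe; apply/eqP; rewrite -cnorm_eq0; apply/negPn/negP => x0.
  have := cnorm_ge0 x; rewrite le_eqVlt eq_sym (negbTE x0)/= => x1.
  by have := xe _ x1; rewrite ltxx.
apply: Xplus1_eq.
  by apply/eqP; rewrite -subr_eq0; apply/eqP/small => e /near/ball_Xplus1P[].
apply/polyP => i; apply/eqP; rewrite -subr_eq0; apply/eqP/small => e.
by move=> /near/ball_Xplus1P[_ _ _]; exact.
Qed.

Definition complex_of_rat (c : rat * rat) : C := (ratr c.1 +i* ratr c.2)%C.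

Lemma complex_of_rat_dense (x : C) (e : R) : 0 < e ->
  exists c, cnorm (x - complex_of_rat c) < e.
Proof.
move=> e0; have near (y : R) : exists c : rat, `|y - ratr c| < e / 2.
  have [c] : exists c : rat, ratr c \in `]y - e / 2, y + e / 2[.
    by apply: rat_in_itvoo; lra.
  by rewrite in_itv/= -ltr_distl distrC => h; exists c.
have [c1 h1] := near (complex.Re x); have [c2 h2] := near (complex.Im x).
exists (c1, c2); apply: (le_lt_trans (cnorm_le_ReIm _)).
by rewrite (splitr e); move: h1 h2; case: x => a b /=; exact: ltrD.
Qed.

Definition rational_map (c : rat * rat) (s : seq (rat * rat)) : Xplus1 R :=
  if pselect (2 < size (Poly [seq complex_of_rat x | x <- s]))%N is left h then
    exist (fun k => k \in [set k : Xplus R | hjac k = 1])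
      (Henon (complex_of_rat c) (oner_neq0 _) h) (mem_set erefl)
  else point.

(** The approximation is finer than the modulus of the leading coefficient, so
    that the degree is kept. *)
Lemma rational_map_dense g (e : R) : 0 < e ->
  exists c s, ball (rational_map c s) e g.
Proof.
move=> e0; set p := hpoly (Xplus1_val g).
have p2 : (2 < size p)%N by exact: hpoly_deg.
have l0 : 0 < cnorm (lead_coef p).
  by rewrite cnorm_gt0 lead_coef_eq0 -size_poly_gt0 (ltn_trans _ p2).
(* Within this distance of the leading coefficient there is no zero. *)
pose d := Num.min e (cnorm (lead_coef p)).
have d0 : 0 < d by rewrite lt_min e0.
pose q (x : C) := xchoose (complex_of_rat_dense x d0).
have qP x : cnorm (x - complex_of_rat (q x)) < d.
  exact: xchooseP (complex_of_rat_dense x d0).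
pose s := [seq q p`_i | i <- iota 0 (size p)].
pose P := Poly [seq complex_of_rat x | x <- s].
have cP i : P`_i = if (i < size p)%N then complex_of_rat (q p`_i) else 0.
  rewrite coef_Poly; case: ifPn => ip.
    rewrite (nth_map (0, 0)) ?size_map ?size_iota//.
    by rewrite (nth_map 0%N) ?size_iota// nth_iota.
  by rewrite nth_default// !size_map size_iota leqNgt.
have sP : size P = size p.
  apply/eqP; rewrite eqn_leq; apply/andP; split.
    by apply/leq_sizeP => j pj; rewrite cP ltnNge pj.
  rewrite -(prednK (ltn_trans _ p2))// ltnNge; apply/negP => /leq_sizeP/(_ _ (leqnn _)).
  rewrite cP prednK ?leqnn ?(ltn_trans _ p2)// => q0.
  have := qP p`_(size p).-1; rewrite q0 subr0 lt_min => /andP[_].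
  by rewrite -/(lead_coef p) ltxx.
exists (q (hshift (Xplus1_val g))), s; rewrite /rational_map.
case: pselect => [h|]; last by rewrite -/P sP.
apply/ball_Xplus1P; split=> //=.
  by rewrite cnormB; apply: lt_le_trans (qP _) _; rewrite ge_min lexx.
move=> i; rewrite cnormB -[in X in _ - X]/P cP; case: ifPn => ip.
  by apply: lt_le_trans (qP _) _; rewrite ge_min lexx.
by rewrite nth_default ?subrr ?cnorm0// leqNgt.
Qed.

Lemma Xplus1_separable : exists D : nat -> Xplus1 R,
  forall g (e : R), 0 < e -> exists n, ball (D n) e g.
Proof.
exists (fun n => if unpickle n is Some (c, s) then rational_map c s else point).
move=> g e /(rational_map_dense g)[c [s b]].
by exists (pickle (c, s)); rewrite pickleK.
Qed.

End Separability.

Section Support.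
Context {R : realType}.

Lemma closed_tsupp (Y : ptopologicalType) (mu : probability (borel Y) R) :
  closed (tsupp mu).
Proof.
move=> y cy U oU Uy.
have [z [zs Uz]] := cy U (open_nbhs_nbhs (conj oU Uy)).
exact: zs.
Qed.

(** Lindelof: the complement of the support is covered by countably many null
    balls with centres in a dense sequence. *)
Lemma tsupp_full (Y : pseudoPMetricType R) (mu : probability (borel Y) R) :
  (exists D : nat -> Y, forall y (e : R), 0 < e -> exists n, ball (D n) e y) ->
  mu (~` tsupp mu) = 0%E.
Proof.
move=> [D Dd].
pose B (k : nat * nat) : set Y := (ball (D k.1) k.2.+1%:R^-1)°.
pose B0 (n : nat) : set Y := if unpickle n is Some k then
  (if mu (B k) == 0%E then B k else set0) else set0.
have mopen (U : set Y) : open U -> measurable (U : set (borel Y)).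
  exact: sub_sigma_algebra.
have mB0 n : measurable (B0 n : set (borel Y)).
  rewrite /B0; case: unpickle => [k|]; last exact: measurable0.
  by case: ifP => _; [apply: mopen; exact: open_interior|exact: measurable0].
have mu0 n : mu (B0 n) = 0%E.
  rewrite /B0; case: unpickle => [k|]; last exact: measure0.
  by case: ifPn => [/eqP //|_]; exact: measure0.
have : (mu (~` tsupp mu) <= \sum_(n <oo) mu (B0 n))%E.
  apply: measure_sigma_subadditive => //.
    by apply: mopen; apply: closed_openC; exact: closed_tsupp.
  move=> y /existsNP[U /not_implyP[oU /not_implyP[Uy /negP]]].
  rewrite -leNgt => U0.
  have /nbhs_ballP[e/= e0 eU] := open_nbhs_nbhs (conj oU Uy).
  have e20 : 0 < e / 2 by rewrite divr_gt0.
  have [m _ /(_ m (leqnn m)) me] := near_infty_natSinv_lt (PosNum e20).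
  have r0 : 0 < m.+1%:R^-1 :> R by rewrite invr_gt0 ltr0Sn.
  have r20 : 0 < m.+1%:R^-1 / 2 :> R by rewrite divr_gt0.
  have [n ny] := Dd y _ r20.
  have yB : B (n, m) y.
    apply/nbhs_ballP; exists (m.+1%:R^-1 / 2) => // z yz.
    by rewrite /= (splitr m.+1%:R^-1); exact: ball_triangle ny yz.
  have BU : B (n, m) `<=` U.
    move=> z /nbhs_singleton Bz; apply: eU.
    have le1 : m.+1%:R^-1 + m.+1%:R^-1 <= e.
      by have {}me : m.+1%:R^-1 < e / 2 := me; move: (m.+1%:R^-1) me => x; clear; lra.
    have le2 : m.+1%:R^-1 / 2 <= m.+1%:R^-1 :> R.
      by move: (m.+1%:R^-1) r0 => x; clear; lra.
    apply: (le_ball le1); apply: ball_triangle Bz; apply: (le_ball le2).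
    exact: ball_sym.
  exists (pickle (n, m)) => //; rewrite /B0 pickleK ifT//.
  rewrite eq_le measure_ge0 andbT; apply: le_trans U0.
  by apply: le_measure; rewrite ?inE//; apply: mopen => //; exact: open_interior.
rewrite eseries0 => [h|n _ _]; last exact: mu0.
by apply/eqP; rewrite eq_le h measure_ge0.
Qed.

Lemma tsupp_neq0 (tau : probability (borel (Xplus1 R)) R) : tsupp tau !=set0.
Proof.
apply/set0P/negP => /eqP t0; have := tsupp_full tau Xplus1_separable.
by rewrite t0 setC0 probability_setT => /eqP; rewrite onee_eq0.
Qed.

End Support.

(** * Mixtures and laws of sequences *)
Section Mixture.
Context {R : realType} d (T : measurableType d).
Variables (mu nu : probability T R) (t : {nonneg R}).
Hypothesis t1 : t%:num <= 1.

Let onemt : {nonneg R} := NngNum (etrans (subr_ge0 _ _) t1).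

Definition mixture : set T -> \bar R :=
  measure_add (mscale onemt mu) (mscale t nu).

HB.instance Definition _ := Measure.on mixture.

Lemma mixtureE A : mixture A = ((1 - t%:num)%:E * mu A + t%:num%:E * nu A)%E.
Proof. by rewrite /mixture measure_addE. Qed.

Let mixture_setT : mixture setT = 1%E.
Proof. by rewrite mixtureE !probability_setT !mule1 -EFinD subrK. Qed.

HB.instance Definition _ := Measure_isProbability.Build _ _ _ mixture mixture_setT.

Lemma integral_mixture (f : T -> \bar R) : (forall x, (0 <= f x)%E) ->
  measurable_fun setT f -> (\int[mixture]_x f x =
    (1 - t%:num)%:E * \int[mu]_x f x + t%:num%:E * \int[nu]_x f x)%E.
Proof.
move=> f0 mf; rewrite /mixture ge0_integral_measure_add//.
by rewrite !ge0_integral_mscale.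
Qed.

(** The bound is first seen for the nonnegative function [h + M], where the
    integral against the mixture is the mixture of the integrals. *)
Lemma Rintegral_mixture_near (h : T -> R) (M : R) : measurable_fun setT h ->
  (forall x, `|h x| <= M) ->
  `|\int[mixture]_x h x - \int[mu]_x h x| <= 2 * M * t%:num.
Proof.
move=> mh hM.
pose k x := h x + M.
have k0 x : 0 <= k x by have := hM x; rewrite /k ler_norml => /andP[? _]; lra.
have k2 x : k x <= 2 * M by have := hM x; rewrite /k ler_norml => /andP[_ ?]; lra.
have mk : measurable_fun setT k by exact: measurable_funD.
have bint (P : probability T R) (f : T -> R) (N : R) : measurable_fun setT f ->
    (forall x, `|f x| <= N) -> P.-integrable setT (EFin \o f).
  move=> mf fN; apply: measurable_bounded_integrable => //.
    by apply: le_lt_trans (probability_le1 P measurableT) _; rewrite ltry.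
  exists N; split; first by rewrite num_real.
  by move=> N' NN' x _ /=; exact: le_trans (fN x) (ltW NN').
have kint (P : probability T R) : P.-integrable setT (EFin \o k).
  by apply: (@bint P k (2 * M) mk) => x; rewrite ger0_norm.
have cE (P : probability T R) c : \int[P]_x cst c x = c.
  have := @Rintegral_cst _ _ _ P setT measurableT c.
  have -> : fine (P setT) = 1 by have := @probability_setT _ _ _ P => ->.
  by rewrite mulr1.
have hE (P : probability T R) : \int[P]_x h x = \int[P]_x k x - M.
  have cint : P.-integrable setT (EFin \o cst M).
    by apply: (@bint P _ `|M|); first exact: measurable_cst.
  have := @RintegralD _ _ _ P setT h (cst M) measurableT (bint P h M mh hM) cint.
  by rewrite cE => ->; rewrite addrK.
have kB (P : probability T R) : 0 <= \int[P]_x k x <= 2 * M.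
  rewrite Rintegral_ge0//=.
  have := @le_Rintegral _ _ _ P setT k (cst (2 * M)) measurableT (kint P).
  rewrite cE; apply=> //.
  by apply: (@bint P _ `|2 * M|); first exact: measurable_cst.
have kE : \int[mixture]_x k x = (1 - t%:num) * \int[mu]_x k x + t%:num * \int[nu]_x k x.
  rewrite /Rintegral integral_mixture//; last exact/measurable_EFinP.
  have fin (P : probability T R) : (\int[P]_x (k x)%:E)%E \is a fin_num.
    by apply: integrable_fin_num => //; exact: kint.
  by rewrite fineD ?fin_numM// !fineM.
rewrite !hE kE; have /andP[a0 a1] := kB mu; have /andP[b0 b1] := kB nu.
move: (\int[mu]_x k x) (\int[nu]_x k x) a0 a1 b0 b1 => a b a0 a1 b0 b1.
have -> : (1 - t%:num) * a + t%:num * b - M - (a - M) = t%:num * (b - a) by ring.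
rewrite normrM ger0_norm// mulrC ler_wpM2r// ler_norml; apply/andP; split; lra.
Qed.

End Mixture.

(** A probability on the naturals that charges every point, transported along a
    sequence [u], has the closure of [u] as support. *)
Lemma sequence_law (R : realType) d (T : measurableType d) (u : nat -> T) :
  exists rho : probability T R,
    (forall A, measurable A -> (forall k, A (u k)) -> rho A = 1%E) /\
    (forall A k, measurable A -> A (u k) -> (0 < rho A)%E).
Proof.
have mu : measurable_fun [set: nat] u by [].
exists (distribution (poisson_prob (1 : R) 0%N) (mfun_Sub (mem_set mu))); split.
  move=> A mA Au.
  have uA : u @^-1` A = setT by rewrite -subTset => k _; exact: Au.
  by have := @probability_setT _ _ _ (poisson_prob (1 : R) 0%N); rewrite -uA.
move=> A k mA Ak.
apply: (@lt_le_trans _ _ (poisson_prob (1 : R) 0%N [set k])).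
  have pk : 0 < poisson_pmf (1 : R) k.
    by rewrite /poisson_pmf ltr01 mulr_gt0 ?expR_gt0// mulr_gt0 ?exprn_gt0// invr_gt0 ltr0n fact_gt0.
  by rewrite /poisson_prob ltr01 esum_set1 ?lee_fin ?poisson_pmf_ge0// lte_fin.
by apply: le_measure; rewrite ?inE// => _ ->.
Qed.

(** * Openness and density *)
Section Kick.
Context {R : realType}.
Local Notation C := R[i].
Implicit Types (f g h : Xplus1 R) (z v w : C * C).

Fact kick_deg v f : (2 < size (hpoly (Xplus1_val f) + v.2%:P)%R)%N.
Proof.
have p2 := hpoly_deg (Xplus1_val f).
by rewrite size_polyDl// (leq_ltn_trans (size_polyC_leq1 _))// ltnW.
Qed.

(** The map f followed by the translation by v. *)
Definition kick v f : Xplus1 R :=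
  exist (fun k => k \in [set k : Xplus R | hjac k = 1])
    (Henon (hshift (Xplus1_val f) + v.1) (oner_neq0 _) (kick_deg v f))
    (mem_set (erefl : hjac (Henon _ _ (kick_deg v f)) = 1)).

Lemma kick0 f : kick 0 f = f.
Proof. by apply: Xplus1_eq; rewrite /= ?addr0. Qed.

Lemma hen_kick v f z : hen (kick v f) z = hen f z + v.
Proof.
rewrite !henE /= hornerD hornerC; case: v => v1 v2 /=.
by congr (_, _); [rewrite addrA|rewrite addrAC].
Qed.

(** For inverses the translation comes first. *)
Lemma hen_flip_kick v f z : hen (flip (kick v f)) z = hen (flip f) (z - swap v).
Proof.
rewrite !hen_flip /henon_inv /= (hjac1 f) !divr1 /swap /= hornerD hornerC.
congr (_, _); first by rewrite opprD addrA addrAC.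
by rewrite opprD addrA [z.2 - _ - _]addrAC opprB addrA.
Qed.

Lemma kick_near (e : R) v w f : small_noise e (w - v) ->
  ball (kick v f) e (kick w f).
Proof.
have p2 := hpoly_deg (Xplus1_val f).
have s u : size (hpoly (Xplus1_val f) + (u : C)%:P) = size (hpoly (Xplus1_val f)).
  by rewrite size_polyDl// (leq_ltn_trans (size_polyC_leq1 _))// ltnW.
move=> [h1 h2]; have e0 : 0 < e := le_lt_trans (cnorm_ge0 _) h1.
apply/ball_Xplus1P; split=> //=; first by rewrite !s.
  by rewrite opprD addrACA subrr add0r cnormB.
move=> i; rewrite !coefD opprD addrACA subrr add0r !coefC.
by case: ifP => _; [rewrite cnormB|rewrite subrr cnorm0].
Qed.

Lemma continuous_kick f : continuous (fun v => kick v f).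
Proof.
move=> v A /nbhs_ballP[e/= e0 eA].
apply/nbhs_C2P; exists e => // w h1 h2.
by apply: eA; exact: kick_near.
Qed.

Lemma dense_sequence : exists q : nat -> C * C,
  forall z (e : R), 0 < e -> exists k, small_noise e (q k - z).
Proof.
exists (fun n => if unpickle n is Some (a, b) then
  (complex_of_rat a, complex_of_rat b) else 0).
move=> [z1 z2] e e0; have [a ha] := complex_of_rat_dense z1 e0.
have [b hb] := complex_of_rat_dense z2 e0.
by exists (pickle (a, b)); rewrite pickleK; split; rewrite /= cnormB.
Qed.

(** The atoms are the maps kicked by a sequence that is dense in the bidisk. *)
Lemma noise_law f (e : R) : 0 < e -> exists rho : probability (borel (Xplus1 R)) R,
  rho (~` ((fun v => kick v f) @` bidisk e)) = 0%E /\
  forall v, small_noise e v -> tsupp rho (kick v f).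
Proof.
move=> e0; have [q qd] := dense_sequence.
pose p k := if pselect (bidisk e (q k)) is left _ then q k else 0.
have pe k : bidisk e (p k).
  by rewrite /p; case: pselect => // _; split; rewrite cnorm0 ltW.
have [rho [rho1 rho2]] :=
  @sequence_law R _ (borel (Xplus1 R)) (fun k => kick (p k) f).
exists rho; split.
  set K := _ @` _.
  have cK : closed K.
    apply: compact_closed; first exact: Xplus1_hausdorff.
    apply: continuous_compact; last exact: compact_bidisk.
    by apply: continuous_subspaceT; exact: continuous_kick.
  have mK : measurable (~` K : set (borel (Xplus1 R))).
    by apply: sub_sigma_algebra; exact: closed_openC.
  have mK' : measurable (K : set (borel (Xplus1 R))).
    by rewrite -(setCK K); exact: measurableC.
  have rK : rho K = 1%E by apply: rho1 => // k; exists (p k).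
  by rewrite (probability_setC rho mK') rK subee.
move=> v [v1 v2] U oU /= Uv.
have /nbhs_ballP[d/= d0 dU] := open_nbhs_nbhs (conj oU Uv).
pose c := Num.min d (Num.min (e - cnorm v.1) (e - cnorm v.2)).
have c0 : 0 < c by rewrite !lt_min d0 !subr_gt0 v1 v2.
have [k []] := qd v c c0; rewrite !lt_min => /and3P[k1 k1' _] /and3P[k2 _ k2'].
apply: (rho2 U k); first exact: sub_sigma_algebra.
apply: dU; apply: kick_near; rewrite /p; case: pselect => // -[].
split; rewrite /= in k1' k2' *.
  by have := cnorm_triangle v.1 (q k).1 0; rewrite !subr0; lra.
by have := cnorm_triangle v.2 (q k).2 0; rewrite !subr0; lra.
Qed.

Lemma kicked_steerable f (e : R) (G : set (Xplus1 R)) : compact G -> 0 < e ->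
  (forall v, small_noise e v -> G (kick v f)) ->
  steerable G /\ steerable (flip @` G).
Proof.
move=> cG e0 Gk; split.
  apply: (@noise_steerable _ G f e) => // z v /Gk Gv.
  by exists (kick v f) => //; exact: hen_kick.
apply: (@noise_steerable_pre _ _ (flip f) e) => //.
  apply: continuous_compact => //.
  by apply: continuous_subspaceT; exact: continuous_flip.
move=> z v [v1 v2]; exists (flip (kick (- swap v) f)); last first.
  by rewrite hen_flip_kick (_ : swap (- swap v) = - v) ?opprK.
by exists (kick (- swap v) f) => //; apply: Gk; split; rewrite /= cnormN.
Qed.

End Kick.

Lemma borel_cmeas (R : realType) (Y : ptopologicalType) (phi : Y -> R[i]) :
  continuous phi -> cmeas (phi : borel Y -> R[i]).
Proof.
move=> cphi.
have cont (h : R[i] -> R) : (forall x y, `|h x - h y| <= cnorm (x - y)) ->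
    measurable_fun [set: borel Y] (h \o phi : borel Y -> R).
  move=> hl; have ch : continuous (h \o phi).
    move=> y; apply/cvgrPdist_lt => e e0.
    have /cvg_CP/(_ e e0) := cphi y; apply: filterS => z.
    by rewrite cnormB => ze; apply: le_lt_trans ze; exact: hl.
  apply: (measurability _ (RGenOpens.measurableE R)) => //.
  move=> _ [_ [a [b ->]] <-]; rewrite setTI; apply: sub_sigma_algebra.
  by move/continuousP : ch; apply; exact: interval_open.
split; apply: cont => -[a b] [a' b'].
  exact: (Re_le_cnorm ((a +i* b) - (a' +i* b'))%C).
exact: (Im_le_cnorm ((a +i* b) - (a' +i* b'))%C).
Qed.

Section Density.
Context {R : realType}.
Local Notation C := R[i].
Local Notation Y := (Xplus1 R).
Implicit Types tau : M1c R Y.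

Definition bisteerable : set (M1c R Y) :=
  [set tau | steerable (tsupp tau) /\ steerable (flip @` tsupp tau)].

(** Adding the noise around a map of the support changes the support by at most e
    and the integrals by a multiple of the proportion t of noise. *)
Lemma noisy_mixture tau (e t : R) : 0 < e -> 0 < t < 1 ->
  exists tau' : M1c R Y, [/\ bisteerable tau',
    hausdorff_ball (tsupp tau : hset Y) (2 * e) (tsupp tau') &
    forall (phi : Y -> C) (M : R), continuous phi -> (forall y, cnorm (phi y) <= M) ->
      cnorm (cintegral tau' phi - cintegral tau phi) <= 4 * M * t].
Proof.
move=> e0 /andP[t0 t1].
have [f tf] := tsupp_neq0 tau.
pose e' := e / 2; have e'0 : 0 < e' by rewrite divr_gt0.
have [rho [rhoK rhos]] := noise_law f e'0.
set K := _ @` _ in rhoK.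
have cK : compact K.
  apply: continuous_compact; last exact: compact_bidisk.
  by apply: continuous_subspaceT; exact: continuous_kick.
have clK : closed K by apply: compact_closed cK; exact: Xplus1_hausdorff.
pose tt : {nonneg R} := NngNum (ltW t0).
have tt1 : tt%:num <= 1 by exact: ltW.
pose mu : probability (borel Y) R := mixture tau rho tt1.
have muE A : mu A = ((1 - t)%:E * tau A + t%:E * rho A)%E by exact: mixtureE.
have s1 : tsupp mu `<=` tsupp tau `|` K.
  move=> g gmu; apply/not_notP => /not_orP[/existsNP[U /not_implyP[oU]]].
  move=> /not_implyP[Ug /negP]; rewrite -leNgt => U0 gK.
  have oUK : open (U `&` ~` K) by apply: openI => //; exact: closed_openC.
  have := gmu _ oUK (conj Ug gK); rewrite muE.
  have m1 : measurable (U : set (borel Y)) by exact: sub_sigma_algebra.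
  have m2 : measurable (U `&` ~` K : set (borel Y)) by exact: sub_sigma_algebra.
  have m3 : measurable (~` K : set (borel Y)).
    by apply: sub_sigma_algebra; exact: closed_openC.
  have -> : (tau : probability _ _) (U `&` ~` K) = 0%E.
    apply/eqP; rewrite eq_le measure_ge0 andbT; apply: le_trans U0.
    by apply: le_measure; rewrite ?inE.
  have -> : rho (U `&` ~` K) = 0%E.
    apply/eqP; rewrite eq_le measure_ge0 andbT -rhoK.
    by apply: le_measure; rewrite ?inE.
  by rewrite !mule0 adde0 ltxx.
have s2 : tsupp tau `<=` tsupp mu.
  move=> g gt U oU Ug; rewrite muE; apply: (@lt_le_trans _ _ ((1 - t)%:E * law tau U)%E).
    by rewrite mule_gt0 ?lte_fin ?subr_gt0//; exact: gt.
  by rewrite leeDl//; apply: mule_ge0 => //; rewrite lee_fin ltW.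
have s3 : tsupp rho `<=` tsupp mu.
  move=> g gt U oU Ug; rewrite muE; apply: (@lt_le_trans _ _ (t%:E * rho U)%E).
    by rewrite mule_gt0 ?lte_fin//; exact: gt.
  by rewrite leeDr//; apply: mule_ge0 => //; rewrite lee_fin subr_ge0 ltW.
have cmu : compact (tsupp mu).
  apply: (subclosed_compact (@closed_tsupp _ _ mu) _ s1).
  by apply: compactU => //; exact: compact_tsupp.
exists (MkM1c cmu); split.
- by apply: (@kicked_steerable _ f e') => // v /rhos /s3.
- exists e; split=> //; first lra.
    by move=> g tg; exists g; [exact: s2|exact: ballxx].
  move=> g /s1[tg|[v [v1 v2] <-]]; first by exists g => //; exact: ballxx.
  exists f => //; rewrite -[X in ball X](kick0 f).
  by apply: kick_near; rewrite subr0 /e' in v1 v2 *; split; lra.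
- move=> phi M cphi phiM; apply: (le_trans (cnorm_le_ReIm _)).
  have [m1 m2] := borel_cmeas cphi.
  have h1 : forall y, `|complex.Re (phi y)| <= M.
    by move=> y; apply: le_trans (Re_le_cnorm _) (phiM y).
  have h2 : forall y, `|complex.Im (phi y)| <= M.
    by move=> y; apply: le_trans (Im_le_cnorm _) (phiM y).
  have r1 := @Rintegral_mixture_near _ _ _ tau rho tt tt1 _ M m1 h1.
  have r2 := @Rintegral_mixture_near _ _ _ tau rho tt tt1 _ M m2 h2.
  have := lerD r1 r2; rewrite /= => h; apply: le_trans h _.
  by rewrite -mulrDl -mulrDl -natrD.
Qed.

Lemma bounded_cnorm (phi : Y -> C) : bounded_fun phi ->
  exists M : R, forall y, cnorm (phi y) <= M.
Proof.
move=> [M0 [M0r h]]; exists (complex.Re (M0 + 1)) => y.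
have k : `|phi y| <= M0 + 1 by apply: h => //; rewrite ltrDl.
rewrite -(@lecR R) cnormE RRe_real//.
by apply: ger0_real; apply: le_trans k; exact: normr_ge0.
Qed.

(** Both the size and the proportion of the noise tend to 0. *)
Lemma dense_bisteerable : dense bisteerable.
Proof.
move=> U [tau Utau] oU.
pose e n : R := n.+2%:R^-1.
have e0 n : 0 < e n by rewrite invr_gt0 ltr0n.
have e1 n : 0 < e n < 1 by rewrite e0 invf_lt1 ?ltr0n// ltr1n.
have ele (d : R) : 0 < d -> \forall n \near \oo, e n < d.
  move=> d0; have := near_infty_natSinv_lt (PosNum d0); apply: filterS => n.
  apply: le_lt_trans; rewrite /e lef_pV2 ?posrE ?ltr0n//.
  by rewrite ler_nat.
have := fun n => noisy_mixture tau (e0 n) (e1 n).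
move=> /choice[tau_ tauP].
have : tau_ n @[n --> \oo] --> tau.
  apply/wH_cvgP; split.
    move=> phi cphi /bounded_cnorm[M phiM]; apply/cvg_CP => d d0.
    have M0 : 0 <= M by apply: le_trans (phiM point); exact: cnorm_ge0.
    have M10 : 0 < 4 * M + 1 by lra.
    have := ele _ (divr_gt0 d0 M10); apply: filterS => n.
    rewrite ltr_pdivlMr// => en; have [_ _ /(_ phi M cphi phiM)] := tauP n.
    by move/le_lt_trans; apply; have := e0 n; move: en; move: (e n) => x; nra.
  apply/cvg_ballP => d d0.
  have := ele _ (divr_gt0 d0 (ltr0n R 2)); apply: filterS => n en.
  have [_ [c [c0 c1 h1 h2]] _] := tauP n; exists c; split=> //.
  by apply: lt_le_trans c1 _; lra.
move=> /(_ U (open_nbhs_nbhs (conj oU Utau))) [N _ /(_ N (leqnn N)) UN].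
by exists (tau_ N); split=> //; have [] := tauP N.
Qed.

(** The support depends continuously on the measure, by definition of the
    topology, and so does its image under [flip]. *)
Lemma open_bisteerable : open bisteerable.
Proof.
rewrite openE => tau [st1 st2].
have ctau : compact (tsupp tau) by exact: compact_tsupp.
have [e1 e10 h1] := steerable_open ctau st1.
have cf : compact (flip @` tsupp tau).
  apply: continuous_compact; last exact: compact_tsupp.
  by apply: continuous_subspaceT; exact: continuous_flip.
have [e2 e20 h2] := steerable_open cf st2.
have [e3 e30 h3] := hausdorff_image (@continuous_flip R) ctau e20.
have cs : (fun tau' : M1c R Y => tsupp tau' : hset Y) @ tau --> (tsupp tau : hset Y).
  have c : @wH_map R Y @ tau --> wH_map tau by exact: initial_continuous.
  have : (snd \o @wH_map R Y) @ tau --> (wH_map tau).2.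
    by apply: (cvg_comp _ _ c); exact: cvg_snd.
  exact.
have B1 := cs _ (nbhsx_ballx (tsupp tau : hset Y) e1 e10).
have B3 := cs _ (nbhsx_ballx (tsupp tau : hset Y) e3 e30).
have B := @filterI _ _ (nbhs_filter tau) _ _ B1 B3.
suff : nbhs tau bisteerable by [].
apply: (@filterS _ _ (nbhs_filter tau) _ _ _ B) => tau' [b1 b3].
split; first exact: h1.
exact: (h2 _ (h3 _ b3)).
Qed.

Lemma MS_bisteerable tau : MS (M1c_incl tau) <-> bisteerable tau.
Proof.
have id_fs (L M : P2 R) : fubini_study (id L) (id M) = fubini_study L M by [].
have c1 : compact (tsupp tau) by exact: compact_tsupp.
have c2 : compact (flip @` tsupp tau).
  apply: continuous_compact => //.
  by apply: continuous_subspaceT; exact: continuous_flip.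
have suppE : tsupp (M1c_incl tau) = @Xplus1_val R @` tsupp tau by exact: tsupp_push.
have suppE' : tsupp (M1c_inv (M1c_incl tau)) = @Xinv R @` (@Xplus1_val R @` tsupp tau).
  by rewrite -suppE; exact: tsupp_push.
have fwd : mean_stable extend (~` [set pt100]) (~` [set pt100]) (M1c_incl tau) <->
    steerable (tsupp tau).
  rewrite mean_stableE suppE; split.
    move=> ms; apply: mean_stable_steerable => //.
    apply: (@mean_stable_transfer _ _ _ _ _ id _ _ _ _
      (fun g k => Xplus1_val g = k)) ms => //.
    - by move=> g tg; exists (Xplus1_val g) => //; exists g.
    - by move=> g k /= <- L _.
  move=> /(steerable_mean_stable c1); apply: (@mean_stable_transfer _ _ _ _ _ id _ _ _ _
      (fun k g => k = Xplus1_val g)) => //.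
  - by move=> _ [g tg <-]; exists g.
  - by move=> g tg; exists (Xplus1_val g) => //; exists g.
  - by move=> k g /= -> L _.
have bwd : mean_stable (fun g => extend_inv (Xinv_of g)) (~` [set pt010])
    (~` [set pt010]) (M1c_inv (M1c_incl tau)) <-> steerable (flip @` tsupp tau).
  have sw (L : P2 R) : (~` [set pt100]) L <-> (~` [set pt010]) (swapP2 L).
    rewrite /setC /=; split=> h e; apply: h.
      by rewrite -(swapP2K L) e swapP2_pt010.
    by rewrite e swapP2_pt100.
  have sw' (L : P2 R) : (~` [set pt010]) L <-> (~` [set pt100]) (swapP2 L).
    by rewrite sw swapP2K.
  rewrite mean_stableE suppE'; split.
    move=> ms; apply: mean_stable_steerable => //.
    apply: (@mean_stable_transfer _ _ _ _ _ (@swapP2 R) _ _ _ _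
      (fun k g => exists2 h, k = flip h & g = Xinv (Xplus1_val h))) ms.
    - exact: swapP2K.
    - exact: fs_swapP2.
    - exact: sw.
    - by move=> _ [g tg <-]; exists (Xinv (Xplus1_val g)); [exists (Xplus1_val g) => //; exists g|exists g].
    - by move=> _ [_ [g tg <-] <-]; exists (flip g); [exists g|exists g].
    - move=> _ _ [g -> ->] L /sw L1 /=.
      by rewrite extend_flip ?swapP2K.
  move=> /(steerable_mean_stable c2); apply: (@mean_stable_transfer _ _ _ _ _ (@swapP2 R) _ _ _ _
      (fun g k => exists2 h, k = flip h & g = Xinv (Xplus1_val h))).
  - exact: swapP2K.
  - exact: fs_swapP2.
  - exact: sw'.
  - by move=> _ [_ [g tg <-] <-]; exists (flip g); [exists g|exists g].
  - by move=> _ [g tg <-]; exists (Xinv (Xplus1_val g)); [exists (Xplus1_val g) => //; exists g|exists g].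
  - by move=> _ _ [g -> ->] L L1 /=; exact: extend_flip.
by rewrite /MS /=; split=> -[/fwd h1 /bwd h2].
Qed.

End Density.

(** * Independence of the terms of a random sequence *)
Section PowerTools.
Context {R : realType} {Y : ptopologicalType}.
Implicit Types (tau : probability (borel Y) R) (P Q : probability (biseq Y) R).

Lemma measurable_biseq_coord i :
  measurable_fun [set: biseq Y] ((fun gam => gam i) : biseq Y -> borel Y).
Proof.
move=> _ A mA; rewrite setTI; apply: sub_sigma_algebra.
by exists i, A; split.
Qed.

Lemma measurable_biseq_box (s : seq int) (A : int -> set (borel Y)) :
  (forall i, measurable (A i)) ->
  measurable [set gam : biseq Y | forall i, i \in s -> A i (gam i)].
Proof.
move=> mA; rewrite (_ : mkset _ =
    \bigcap_(i in [set` s]) ((fun gam : biseq Y => gam i) @^-1` A i)); last first.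
  by apply/seteqP; split=> gam h i; exact: h.
apply: fin_bigcap_measurable; first exact: finite_seq.
move=> i _; have := @measurable_biseq_coord i measurableT _ (mA i).
by rewrite setTI.
Qed.

(** Boxes form a pi-system that generates the sigma-algebra. *)
Lemma power_unique tau P Q : is_power tau P -> is_power tau Q ->
  forall A, measurable A -> P A = Q A.
Proof.
move=> Ppow Qpow A mA.
pose boxes : set (set (biseq Y)) := [set B | exists (s : seq int)
  (D : int -> set (borel Y)), [/\ uniq s, forall i, measurable (D i) &
    B = [set gam | forall i, i \in s -> D i (gam i)]]].
apply: (measure_unique boxes (fun=> setT)) mA.
- apply/seteqP; split.
    apply: smallest_sub; first exact: smallest_sigma_algebra.
    move=> _ [i [D [mD ->]]]; apply: sub_sigma_algebra.
    exists [:: i], (fun=> D); split=> //; apply/seteqP; split=> gam /=.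
      by move=> h j; rewrite inE => /eqP ->.
    by move=> h; exact: (h i (mem_head _ _)).
  apply: smallest_sub; first exact: sigma_algebra_measurable.
  by move=> _ [s [D [_ mD ->]]]; exact: measurable_biseq_box.
- move=> _ _ [s [D [us mD ->]]] [s' [D' [us' mD' ->]]].
  exists (undup (s ++ s')), (fun i => (if i \in s then D i else setT) `&`
    (if i \in s' then D' i else setT)); split.
  + exact: undup_uniq.
  + by move=> i; apply: measurableI; case: ifP.
  + apply/seteqP; split=> gam /=.
      move=> [h h'] i _; split; case: ifPn => // is_; [exact: h|exact: h'].
    move=> h; split=> i is_.
      by have := h i; rewrite mem_undup mem_cat is_ => /(_ isT)[].
    by have := h i; rewrite mem_undup mem_cat is_ orbT => /(_ isT)[].
- move=> _; exists [::], (fun=> setT); split=> //.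
  by apply/seteqP; split.
- by rewrite bigcup_const //; exists 0%N.
- by move=> _ [s [D [us mD ->]]]; exact: etrans (Ppow s D us mD) (esym (Qpow s D us mD)).
- by move=> _; apply: (le_lt_trans (probability_le1 P measurableT)); rewrite ltry.
Qed.

Lemma power_ae_all tau P (G : set Y) : is_power tau P -> tau (~` G) = 0%E ->
  measurable (G : set (borel Y)) ->
  measurable [set gam : biseq Y | forall k : nat, G (gam k%:Z)] /\
  P [set gam | forall k : nat, G (gam k%:Z)] = 1%E.
Proof.
move=> Ppow G0 mG.
pose B (k : nat) := (fun gam : biseq Y => gam k%:Z) @^-1` (~` G).
have mB k : measurable (B k).
  by have := @measurable_biseq_coord k%:Z measurableT _ (measurableC mG); rewrite setTI.
have E : [set gam : biseq Y | forall k : nat, G (gam k%:Z)] = ~` \bigcup_k B k.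
  apply/seteqP; split=> gam h; first by move=> [k _]; apply; exact: h.
  by move=> k; apply/not_notP => nG; apply: h; exists k.
have mU : measurable (\bigcup_k B k) by exact: bigcupT_measurable.
have PU : P (\bigcup_k B k) = 0%E.
  apply/eqP; rewrite eq_le measure_ge0 andbT.
  have : (P (\bigcup_k B k) <= \sum_(k <oo) P (B k))%E.
    exact: measure_sigma_subadditive.
  move/le_trans; apply; rewrite eseries0 => // k _ _.
  have := Ppow [:: k%:Z] (fun=> ~` G) isT (fun _ => measurableC mG).
  rewrite big_seq1 G0 => <-; congr (P _); apply/seteqP; split=> gam /=.
    by move=> h j; rewrite inE => /eqP ->.
  by move=> h; exact: (h k%:Z (mem_head _ _)).
rewrite E; split; first exact: measurableC.
by rewrite (probability_setC P mU) PU sube0.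
Qed.

Definition restart (m : nat) (p : biseq Y * biseq Y) : biseq Y :=
  fun i => if i < m%:Z then p.1 i else p.2 (i - m%:Z).

Lemma measurable_restart m : measurable_fun setT (restart m).
Proof.
apply: measurable_biseq => i; rewrite /restart.
case: (i < m%:Z).
  exact: (measurableT_comp (@measurable_biseq_coord i) measurable_fst).
exact: (measurableT_comp (@measurable_biseq_coord _) measurable_snd).
Qed.

(** Markov property of independent identically distributed sequences: both
    sides are powers of the same measure. *)
Lemma power_restart tau P m (A : set (biseq Y)) : is_power tau P -> measurable A ->
  P A = (\int[P]_gam P [set gam' | A (restart m (gam, gam'))])%E.
Proof.
move=> Ppow mA.
pose Q : probability (biseq Y) R :=
  distribution (P \x P)%E (mfun_Sub (mem_set (measurable_restart m))).
have QE B : Q B = (P \x P)%E (restart m @^-1` B) by [].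
have Qpow : is_power tau Q.
  move=> s D us mD; rewrite QE.
  pose s1 := [seq i <- s | i < m%:Z]; pose s2 := [seq i - m%:Z | i <- s & ~~ (i < m%:Z)].
  have -> : restart m @^-1` [set gam | forall i, i \in s -> D i (gam i)] =
      [set gam : biseq Y | forall i, i \in s1 -> D i (gam i)] `*`
      [set gam : biseq Y | forall i, i \in s2 -> D (i + m%:Z) (gam i)].
    apply/seteqP; split=> -[gam gam'] /=.
      move=> h; split=> i.
        by rewrite mem_filter => /andP[im is_]; have := h i is_; rewrite /restart im.
      move=> /mapP[j]; rewrite mem_filter => /andP[/negbTE jm js] ->.
      by rewrite subrK; have := h j js; rewrite /restart jm.
    move=> [h1 h2] i is_; rewrite /restart; case: ifPn => im.
      by apply: h1; rewrite mem_filter im.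
    have := h2 (i - m%:Z); rewrite subrK; apply.
    by apply: map_f; rewrite mem_filter im.
  have mD2 i : measurable (D (i + m%:Z)) by exact: mD.
  have us2 : uniq s2 by rewrite map_inj_uniq ?filter_uniq// => i j /addIr.
  rewrite (product_measure1E P P (measurable_biseq_box s1 mD)
    (measurable_biseq_box s2 mD2)).
  apply: (etrans (f_equal2 mule (Ppow s1 D (filter_uniq _ us) mD) (Ppow s2 _ us2 mD2))).
  rewrite [RHS](bigID (fun i => i < m%:Z))/= big_filter; congr (_ * _)%E.
  by rewrite big_map big_filter; apply: eq_bigr => i _; rewrite subrK.
rewrite (power_unique Ppow Qpow mA) QE /product_measure1.
by apply: eq_integral => gam _ /=; congr (P _); apply/seteqP; split=> gam' /=;
  rewrite /xsection/= inE.
Qed.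

End PowerTools.

Lemma measure_setI_full (R : realType) d (T : measurableType d)
    (P : probability T R) (A E : set T) : measurable A -> measurable E ->
  P E = 1%E -> P (A `&` E) = P A.
Proof.
move=> mA mE PE; apply/eqP; rewrite eq_le; apply/andP; split.
  by apply: le_measure; rewrite ?inE//; exact: measurableI.
have E0 : P (~` E) = 0%E by rewrite (probability_setC P mE) PE subee.
have mAE := measurableI _ _ mA mE; have mE' := measurableC mE.
have -> : P (A `&` E) = (P (A `&` E) + P (~` E))%E by rewrite E0 adde0.
apply: (@le_trans _ _ (P ((A `&` E) `|` ~` E))); last exact: measureU2.
apply: le_measure; rewrite ?inE//; first exact: measurableU.
by move=> x Ax; have [Ex|nE] := pselect (E x); [left|right].
Qed.

(** * Probability of escape *)
Section RandomOrbits.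
Context {R : realType}.
Local Notation C := R[i].
Local Notation Y := (Xplus1 R).
Implicit Types (z : C * C) (g : Y).

Definition positive_part (gam : biseq Y) : nat -> Y := fun k => gam k%:Z.

Lemma cmeas_orbit d (X : measurableType d) (gam : X -> nat -> Y) (z : X -> C * C) n :
  (forall k, measurable_fun setT ((fun x => gam x k) : X -> borel Y)) ->
  cmeas (fun x => (z x).1) -> cmeas (fun x => (z x).2) ->
  cmeas (fun x => (orbit (gam x) n (z x)).1) /\
  cmeas (fun x => (orbit (gam x) n (z x)).2).
Proof.
move=> mg m1 m2; elim: n => [//|n [ih1 ih2]] /=.
have comp (phi : Y -> C) : continuous phi -> cmeas (fun x => phi (gam x n)).
  move=> /borel_cmeas[p1 p2].
  by split; [exact: (measurableT_comp p1 (mg n))|exact: (measurableT_comp p2 (mg n))].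
have [hs hc] := (comp _ (@continuous_hshift R), fun i => comp _ (@continuous_hcoef R i)).
exact: (cmeas_hen hs hc ih1 ih2).
Qed.

Lemma near_word_nth (e : R) (s s' : seq Y) : size s = size s' ->
  (forall k, (k < size s)%N -> ball (nth point s k) e (nth point s' k)) ->
  near_word e s s'.
Proof.
elim: s s' => [|g s ih] [|g' s']//= [ss] h; split; first exact: (h 0%N).
by apply: ih => // k ks; exact: (h k.+1).
Qed.

Variables (tau : probability (borel Y) R) (P : probability (biseq Y) R) (r : R).
Local Notation G := (tsupp tau).
Hypotheses (Ppow : is_power tau P) (sG : steerable G).
Hypothesis goodG : forall g, G g -> good r g.

Definition in_support : set (biseq Y) := [set gam | forall k, G (positive_part gam k)].

Definition escaped n z : set (biseq Y) :=
  [set gam | escaping (2 * r) (orbit (positive_part gam) n z)].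

Lemma measurable_tsupp : measurable (G : set (borel Y)).
Proof.
rewrite -(setCK G); apply: measurableC; apply: sub_sigma_algebra.
by apply: closed_openC; exact: closed_tsupp.
Qed.

Lemma in_support_full : measurable in_support /\ P in_support = 1%E.
Proof.
apply: (power_ae_all Ppow); last exact: measurable_tsupp.
by apply: tsupp_full; exact: Xplus1_separable.
Qed.

(** The orbit depends measurably on the sequence because the parameters of a map
    are continuous functions of the map. *)
Lemma measurable_escaped n z : measurable (escaped n z).
Proof.
have [m1 m2] := @cmeas_orbit _ (biseq Y) positive_part (fun=> z) n
  (fun k => @measurable_biseq_coord Y k%:Z) (cmeas_cst _) (cmeas_cst _).
exact: (measurable_escaping (2 * r) m1 m2).
Qed.

Lemma good_positive_part gam : in_support gam ->
  forall k, good r (positive_part gam k).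
Proof. by move=> h k; exact: goodG. Qed.

Lemma escapedW m n z gam : (m <= n)%N -> in_support gam -> escaped m z gam ->
  escaped n z gam.
Proof.
move=> mn ing esc; rewrite /escaped/= -(subnKC mn).
by have [] := orbit_escaping (n - m) (good_positive_part ing) esc.
Qed.

(** A finite word that drives a point of the bidisk to escape keeps doing so
    after a perturbation of the word and of the point, and the random sequence
    follows a perturbation of this word with positive probability. *)
Lemma uniform_escape : exists (N : nat) (e : R), 0 < e /\
  forall z, bidisk (2 * r) z -> (e%:E <= P (escaped N z))%E.
Proof.
have [mI PI] := in_support_full.
have /compact_near_coveringP cB := @compact_bidisk R (2 * r).
have := cB nat \oo (fun n z => ((n.+1%:R^-1 : R)%:E <= P (escaped n z))%E) _.
case; last first.
  move=> N _ /(_ N (leqnn N)) NP; exists N, N.+1%:R^-1; split.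
    by rewrite invr_gt0 ltr0Sn.
  exact: NP.
move=> z _; have [s sGs es] := sG z (2 * r).
have [e e0 eP] := hen_seq_near (open_nbhs_nbhs (conj (@open_escaping R (2 * r)) es)).
pose D (i : int) : set Y := (ball (nth point s `|i|%N) e)°.
pose ks := [seq k%:Z | k <- iota 0 (size s)].
pose B : set (biseq Y) := [set gam | forall i, i \in ks -> D i (gam i)].
have oD i : open (D i) by exact: open_interior.
have mD i : measurable (D i : set (borel Y)) by exact: sub_sigma_algebra.
have mB : measurable B by exact: measurable_biseq_box.
have PB : (0 < P B)%E.
  have uks : uniq ks by rewrite map_inj_uniq ?iota_uniq// => i j [].
  rewrite (Ppow uks mD) /ks big_map big_seq; 
    apply: (big_ind (fun x : \bar R => (0 < x)%E)) => [//|x y|k]; first exact: mule_gt0.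
  rewrite mem_iota /= add0n => ks'.
  apply: (sGs (nth point s k)) => //; first exact: mem_nth.
  by have := nbhsx_ballx (nth point s k) _ e0.
have PBfin : P B \is a fin_num by exact: fin_num_measure.
pose p := fine (P B); have p0 : 0 < p by rewrite fine_gt0// PB ltey_eq PBfin.
exists ([set w | cnorm (w.1 - z.1) < e /\ cnorm (w.2 - z.2) < e],
    [set n | n.+1%:R^-1 < p /\ (size s <= n)%N]).
  split=> /=; first by apply/nbhs_C2P; exists e.
  apply: filterI; first exact: near_infty_natSinv_lt (PosNum p0).
  by exists (size s).
move=> [w n] [/= [w1 w2] [np sn]].
apply: (@le_trans _ _ (P B)); first by rewrite -(fineK PBfin) lee_fin ltW.
rewrite -(measure_setI_full mB mI PI).
apply: le_measure; rewrite ?inE.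
- exact: measurableI.
- exact: measurable_escaped.
move=> gam [Bgam Igam]; apply: (escapedW sn Igam).
rewrite /escaped/= orbit_mkseq; apply: eP => //.
apply: near_word_nth; first by rewrite size_mkseq.
move=> k ks'; rewrite nth_mkseq//.
have : D k%:Z (gam k%:Z) by apply: Bgam; apply: map_f; rewrite mem_iota.
exact: nbhs_singleton.
Qed.

Lemma positive_part_restart N (gam gam' : biseq Y) n z :
  orbit (positive_part (restart N (gam, gam'))) (N + n) z =
  orbit (positive_part gam') n (orbit (positive_part gam) N z).
Proof.
have head m : (m <= N)%N -> orbit (positive_part (restart N (gam, gam'))) m z =
    orbit (positive_part gam) m z.
  elim: m => //= m ih mN; rewrite ih ?(ltnW mN)//.
  by rewrite /positive_part /restart /= ltz_nat mN.
elim: n => [|n ih]; first by rewrite addn0 head.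
rewrite addnS /= ih; congr (hen _ _).
rewrite /positive_part /restart /= ltz_nat ltnNge leq_addr /=.
by congr gam'; rewrite PoszD addrC addKr.
Qed.

(** Each block of [N] steps escapes with probability at least [e], whatever
    happened before. *)
Lemma survival_decay N (e : R) :
  (forall z, bidisk (2 * r) z -> (e%:E <= P (escaped N z))%E) ->
  forall n z, bidisk (2 * r) z ->
  (P (in_support `&` ~` escaped (n * N) z) <= ((1 - e) ^+ n)%:E)%E.
Proof.
have [mI PI] := in_support_full.
have mS m z : measurable (in_support `&` ~` escaped m z).
  by apply: measurableI => //; apply: measurableC; exact: measurable_escaped.
move=> esc.
have b0 : bidisk (2 * r) (0 : C * C).
  have [g Gg] := steerable_neq0 sG; have [r1 _ _] := goodG Gg.
  by split; rewrite cnorm0; lra.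
have e1 : e <= 1.
  by rewrite -lee_fin; apply: le_trans (esc 0 b0) _; apply: probability_le1; exact: measurable_escaped.
elim=> [z _|n ih z zb]; first by rewrite expr0; exact: probability_le1.
have stay gam w : bidisk (2 * r) w -> in_support gam -> ~ escaped (n.+1 * N) w gam ->
    bidisk (2 * r) (orbit (positive_part gam) N w) /\ ~ escaped N w gam.
  move=> wb Ig nesc.
  have nesc' k : (k <= n.+1 * N)%N -> ~ escaped k w gam.
    by move=> kn h; apply: nesc; exact: escapedW h.
  have NN : (N <= n.+1 * N)%N by rewrite mulSn leq_addr.
  split; last exact: nesc'.
  have := @orbit_bounded R r (positive_part gam) w N (good_positive_part Ig).
  have -> : Num.max (cnorm w.1) (2 * r) = 2 * r by apply/max_idPr; case: wb.
  by apply=> k kN; apply: nesc'; exact: leq_trans NN.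
(* Condition on the first N terms. *)
rewrite (power_restart N Ppow (mS _ _)).
have mB : measurable (~` escaped N z) by apply: measurableC; exact: measurable_escaped.
have en0 : 0 <= (1 - e) ^+ n by rewrite exprn_ge0// subr_ge0.
apply: (@le_trans _ _ (\int[P]_gam (((1 - e) ^+ n)%:E * (\1_(~` escaped N z) gam)%:E))%E).
  have mR : measurable (restart N @^-1` (in_support `&` ~` escaped (n.+1 * N) z)).
    by have := measurable_restart N measurableT (mS (n.+1 * N)%N z); rewrite setTI.
  apply: ge0_le_integral => //.
  - have := measurable_fun_xsection P mR; apply: eq_measurable_fun => gam _ /=.
    by congr (P _); apply/seteqP; split=> gam' /=; rewrite /xsection/= inE.
  - apply: emeasurable_funM; first exact: measurable_cst.
    by apply/measurable_EFinP; apply: measurable_indic.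
  move=> gam _; set S := [set gam' | _].
  have [[gam0 [I0 N0]]|S0] := pselect (S !=set0); last first.
    have -> : S = set0 by apply/eqP/negPn/negP => /set0P.
    by rewrite measure0 mule_ge0 ?lee_fin.
  have orbE : orbit (positive_part (restart N (gam, gam0))) N z =
      orbit (positive_part gam) N z.
    by have := positive_part_restart N gam gam0 0 z; rewrite addn0.
  have [ob nesc] := stay _ _ zb I0 N0.
  rewrite orbE in ob; rewrite /escaped/= orbE in nesc.
  rewrite indicE mem_set// mule1.
  apply: le_trans (ih _ ob); apply: le_measure; rewrite ?inE//.
    have := measurable_xsection gam mR.
    by congr measurable; apply/seteqP; split=> gam' /=; rewrite /xsection/= inE.
  move=> gam' [I1 N1]; split.
    move=> k; have := I1 (N + k)%N; rewrite /positive_part /restart /= ltz_nat.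
    by rewrite ltnNge leq_addr /= PoszD addrC addKr.
  by move: N1; rewrite /escaped/= mulSn positive_part_restart.
rewrite ge0_integralZl//; last by apply/measurable_EFinP; exact: measurable_indic.
rewrite integral_indic// setIT exprSr EFinM.
apply: lee_wpmul2l; first by rewrite lee_fin.
apply: (@le_trans _ _ (1 - P (escaped N z))%E).
  by rewrite -(probability_setC P (measurable_escaped N z)).
by rewrite EFinB; apply: leeB => //; exact: esc.
Qed.

Lemma survival_null z : bidisk (2 * r) z ->
  P (in_support `&` [set gam | forall n, ~ escaped n z gam]) = 0%E.
Proof.
have [mI PI] := in_support_full.
have [N [e [e0 esc]]] := uniform_escape.
move=> zb; set S := _ `&` _.
have SE : S = \bigcap_n (in_support `&` ~` escaped n z).
  apply/seteqP; split=> gam; first by move=> [h1 h2] n _; split=> //; exact: h2.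
  by move=> h; split; [have [] := h 0%N I|move=> n; have [] := h n I].
have mS : measurable S.
  rewrite SE; apply: bigcapT_measurable => n; apply: measurableI => //.
  by apply: measurableC; exact: measurable_escaped.
have e1 : e <= 1.
  by rewrite -lee_fin; apply: le_trans (esc z zb) _; apply: probability_le1; exact: measurable_escaped.
have Pn n : (P S <= ((1 - e) ^+ n)%:E)%E.
  apply: le_trans (survival_decay esc n zb).
  apply: le_measure; rewrite ?inE//.
    by apply: measurableI => //; apply: measurableC; exact: measurable_escaped.
  by rewrite SE => gam; apply.
have PSfin : P S \is a fin_num by exact: fin_num_measure.
apply/eqP; rewrite eq_le measure_ge0 andbT -(fineK PSfin) lee_fin leNgt.
apply/negP => p0.
have : (1 - e) ^+ n @[n --> \oo] --> (0 : R).
  by apply: cvg_expr; rewrite ger0_norm ?subr_ge0//; lra.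
move=> /cvgrPdist_lt/(_ _ p0)[n _ /(_ n (leqnn n))].
rewrite sub0r normrN ger0_norm ?exprn_ge0 ?subr_ge0// ltNge => /negP; apply.
by rewrite -lee_fin fineK.
Qed.

End RandomOrbits.

(** * Forward orbits of almost every sequence *)
Section ForwardOrbits.
Context {R : realType}.
Local Notation C := R[i].
Local Notation Y := (Xplus1 R).
Implicit Types (z w : C * C) (g : Y).

Definition include (gam : int -> Y) : int -> Xplus R := fun i => Xplus1_val (gam i).

(** Maxima are compared by cases because the order of R[i] is partial. *)
Lemma prod_norm_ge z : `|z.1| <= `|z| /\ `|z.2| <= `|z|.
Proof.
rewrite prod_normE; move: z => [x y] /=; rewrite /Order.max; case: ifPn => [/ltW//|].
by rewrite -real_leNgt ?normr_real.
Qed.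

Lemma prod_norm_le z (x : C) : `|z.1| <= x -> `|z.2| <= x -> `|z| <= x.
Proof. by rewrite prod_normE; rewrite /Order.max; case: ifP. Qed.

Lemma bounded_C2P (A : set (C * C)) : bounded_set A <-> exists M : R, A `<=` bidisk M.
Proof.
split=> [[M0 [_ h]]|[M AM]].
  exists (complex.Re (M0 + 1)) => z Az.
  have zM : `|z| <= M0 + 1 by apply: h => //; rewrite ltrDl.
  have M1 : (complex.Re (M0 + 1))%:C%C = M0 + 1.
    by rewrite RRe_real// ger0_real//; apply: le_trans zM; exact: normr_ge0.
  have [z1 z2] := prod_norm_ge z.
  by split; rewrite -(@lecR R) cnormE M1; apply: le_trans zM.
exists M%:C%C; split; first by apply/complex_realP; exists M.
move=> x Mx z /AM[z1 z2]; apply: le_trans (ltW Mx).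
by apply: prod_norm_le; rewrite -cnormE lecR.
Qed.

Lemma embed_chart w : w.2 != 0 -> embed w = chart (w.1 / w.2, w.2^-1).
Proof.
move=> w0; rewrite /chart /chart010 -(@hpoint_scale _ w.2) //=.
by rewrite mulrC mulfVK// mulr1 mulfV.
Qed.

(** Along an escaping orbit the second coordinate grows superlinearly, so it
    also dominates the first one. *)
Lemma escape_to_pt010 K (r : R) (gam : nat -> Y) z n0 :
  (forall k, good r (gam k)) -> (forall k, tame K (Xplus1_val (gam k))) ->
  escaping (2 * r) (orbit gam n0 z) ->
  embed (orbit gam n z) @[n --> \oo] --> (pt010 : P2 R).
Proof.
move=> gr gK es; apply/cvg_ballP => e e0.
have [d d0 dP] := fs_chart_small (0, 0) e0.
(* With this growth rate |x / y| < d after one more step. *)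
have T0 : 0 <= 2 / d + 2 by rewrite addr_ge0// divr_ge0// ltW.
have [R0 R01 growth] := @tame_growth R K (2 / d + 2) T0.
have [m0 m0P] := exp7_large (Num.max R0 d^-1).
exists (n0 + m0).+1 => // n' /= n'0.
have [m m0m ->] : exists2 m, (m0 <= m)%N & n' = (n0 + m).+1.
  exists (m0 + (n' - (n0 + m0).+1))%N; first exact: leq_addr.
  by rewrite addnA -addSn subnKC.
have large k : (m0 <= k)%N -> Num.max R0 d^-1 < cnorm (orbit gam (n0 + k) z).2.
  move=> m0k; have [_ h] := orbit_escaping k gr es.
  apply: lt_le_trans m0P _; apply: le_trans h.
  by rewrite ler_weXn2l// ler1n.
have [[es1 es2] _] := orbit_escaping m gr es.
have := large m m0m; rewrite gt_max => /andP[l1 _].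
have := large m.+1 (leqW m0m); rewrite addnS gt_max => /andP[_ l2].
have [r1 ar _] := gr (n0 + m)%N.
have grow := growth _ (gK (n0 + m)%N) _ (ltW l1).
have y0 : 0 < cnorm (orbit gam (n0 + m).+1 z).2.
  by apply: lt_trans l2; rewrite invr_gt0.
have y1 : (orbit gam (n0 + m).+1 z).2 != 0 by rewrite -cnorm_gt0.
apply/ball_P2; rewrite pt010_chart embed_chart//; apply: dP; rewrite /= subr0; last first.
  by rewrite -div1r cnorm_div cnorm1 ltr_pdivrMr// mulrC -ltr_pdivrMr// div1r.
rewrite cnorm_div ltr_pdivrMr//.
have oE : orbit gam (n0 + m).+1 z = hen (gam (n0 + m)%N) (orbit gam (n0 + m) z) by [].
move: grow ar es1 es2 l1 y0; rewrite oE henE.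
move: (orbit gam (n0 + m) z) => -[x y] /=.
move: (hshift _) (_.[y]) => a p grow ar es1 es2 l1 y0.
have h1 := cnormD y a; have h2 := cnorm_sub_le p x.
have {}grow : 2 * cnorm y + 2 * cnorm y * d <= d * cnorm p.
  have : d * ((2 / d + 2) * cnorm y) <= d * cnorm p by rewrite ler_pM2l.
  by have -> : d * ((2 / d + 2) * cnorm y) = 2 * cnorm y + 2 * cnorm y * d;
    first by field; rewrite gt_eqF.
have : d * (cnorm p - cnorm x) <= d * cnorm (p - x) by rewrite ler_pM2l.
have : d * cnorm x < d * cnorm y by rewrite ltr_pM2l.
have : 0 < d * cnorm y by rewrite mulr_gt0//; lra.
move: grow h1 ar es1 r1; rewrite hjac1 mul1r; clear; lra.
Qed.

End ForwardOrbits.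

Section ForwardTheorem.
Context {R : realType}.
Local Notation C := R[i].
Local Notation Y := (Xplus1 R).
Local Notation T1 := (measurableTypeR R).
Local Notation T2 := (T1 * T1)%type.
Local Notation T4 := (T2 * T2)%type.
Implicit Types (z w : C * C) (g : Y).

Lemma forwardE (gam : biseq Y) n z :
  forward (include gam) n z = orbit (positive_part gam) n z.
Proof. by elim: n => //= n ->. Qed.

Lemma forwardP2_embed (gam : biseq Y) n z :
  forwardP2 (include gam) n (embed z) = embed (orbit (positive_part gam) n z).
Proof. by elim: n => //= n ->; rewrite extend_embed. Qed.

Variables (tau : probability (borel Y) R) (P : probability (biseq Y) R).
Hypotheses (Ppow : is_power tau P) (ctau : compact (tsupp tau)).
Hypothesis (sG : steerable (tsupp tau)).
Local Notation inG := (in_support tau).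

Definition trapped (r : R) (gam : biseq Y) : set (C * C) :=
  [set z | forall n, ~ escaped r n z gam].

Lemma measurable_trapped r d (X : measurableType d) (gam : X -> biseq Y) (z : X -> C * C) :
  measurable_fun setT gam ->
  cmeas (fun x => (z x).1) -> cmeas (fun x => (z x).2) ->
  measurable [set x | trapped r (gam x) (z x)].
Proof.
move=> mg m1 m2.
rewrite (_ : mkset _ =
    \bigcap_n ~` [set x | escaping (2 * r) (orbit (positive_part (gam x)) n (z x))]).
  apply: bigcapT_measurable => n; apply: measurableC.
  have mk k : measurable_fun setT ((fun x => positive_part (gam x) k) : X -> borel Y).
    exact: (measurableT_comp (@measurable_biseq_coord Y k%:Z) mg).
  have [p1 p2] := cmeas_orbit n mk m1 m2.
  exact: (measurable_escaping (2 * r) p1 p2).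
by apply/seteqP; split=> x h n; [move=> _; exact: h|exact: (h n I)].
Qed.

(** Any point lies in the bidisk of a larger radius r', and a point that never
    escapes for r never escapes for r'. *)
Lemma trapped_null r : (forall g, tsupp tau g -> good r g) ->
  forall z, P (inG `&` [set gam | trapped r gam z]) = 0%E.
Proof.
move=> goodG z; have [mI PI] := in_support_full Ppow.
pose r' := Num.max r (cnorm z.1 + cnorm z.2).
have goodG' g : tsupp tau g -> good r' g.
  by move=> /goodG; apply: goodW; rewrite le_max lexx.
have [g0 Gg0] := steerable_neq0 sG; have [r1 _ _] := goodG g0 Gg0.
have zb : bidisk (2 * r') z.
  have h : cnorm z.1 + cnorm z.2 <= r' by rewrite le_max lexx orbT.
  have := cnorm_ge0 z.1; have := cnorm_ge0 z.2.
  by split; move: h => /=; lra.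
have mT k : measurable [set gam | trapped k gam z].
  by apply: (@measurable_trapped k _ (biseq Y) id (fun=> z)); [exact: measurable_id|
    exact: cmeas_cst|exact: cmeas_cst].
apply/eqP; rewrite eq_le measure_ge0 andbT -(survival_null Ppow sG goodG' zb).
apply: le_measure; rewrite ?inE.
- exact: measurableI.
- by apply: measurableI => //; exact: (mT r').
move=> gam [Ig tr]; split=> // n [e1 e2]; apply: (tr n); split=> //.
apply: le_lt_trans e1; rewrite ler_pM2l// /r' le_max lexx //.
Qed.

(** Orbits either escape, and are unbounded, or stay in a bidisk. *)
Lemma Kplus_trapped r gam : (forall k, good r (positive_part gam k)) ->
  Kplus (include gam) = trapped r gam.
Proof.
move=> gr; apply/seteqP; split=> z.
  move=> /bounded_C2P[M AM] n es.
  have [m mM] := exp7_large M.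
  have [_ h] := orbit_escaping m.+1 gr es.
  have : bidisk M (orbit (positive_part gam) (n + m.+1) z).
    by apply: AM; exists (n + m.+1)%N; [rewrite /= addnS|rewrite forwardE].
  move=> [_ /(le_trans h)]; rewrite leNgt => /negP; apply.
  by apply: lt_le_trans mM _; rewrite ler_weXn2l// ler1n.
move=> tr; apply/bounded_C2P; exists (Num.max (cnorm z.1) (2 * r)).
move=> _ [n _ <-]; rewrite forwardE; apply: orbit_bounded => // k _.
exact: tr.
Qed.

Lemma closed_trapped r gam : closed (trapped r gam).
Proof.
rewrite -openC; apply/open_C2P => z /existsNP[n /contrapT].
rewrite /escaped/= orbit_mkseq => es.
have [e e0 eP] := hen_seq_near (open_nbhs_nbhs (conj (@open_escaping R (2 * r)) es)).
exists e => // z' z1 z2 /(_ n); apply; rewrite /escaped/= orbit_mkseq.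
apply: eP => //; apply: near_word_nth => // k ks; exact: ballxx.
Qed.

(** A set with nonempty interior contains a box of positive volume. *)
Lemma null_closed_frontier (K : set (C * C)) : closed K -> Leb4 K = 0%E ->
  frontier K = K.
Proof.
move=> cK K0; rewrite /frontier.
have -> : closure K = K by apply/esym/closure_id.
suff -> : interior K = set0 by rewrite setD0.
rewrite -subset0 => z /nbhs_C2P[e e0 eK].
have e20 : 0 < e / 2 by rewrite divr_gt0.
have boxK : box z (e / 2) `<=` K.
  move=> w [[w1 w2] [w3 w4]]; apply: eK; apply: (le_lt_trans (cnorm_le_ReIm _)).
    by move: w1 w2; case: (w.1) (z.1) => [a b] [a' b'] /=; lra.
  by move: w3 w4; case: (w.2) (z.2) => [a b] [a' b'] /=; lra.
have mK : meas4 K.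
  have : meas4 (~` ~` K) by apply: measurableC; apply: meas4_open; exact: closed_openC.
  by rewrite setCK.
have := le_volume (meas4_box z (e / 2)) mK boxK.
rewrite K0 (volume_box z e20) lee_fin leNgt => /negP; apply.
by rewrite exprn_gt0// mulrn_wgt0.
Qed.

(** Points at infinity other than [1 : 0 : 0] are mapped to the fixed point
    [0 : 1 : 0] at once. *)
Theorem forward_converges (L : P2 R) : L <> pt100 ->
  exists E : set (biseq Y), [/\ measurable E, P E = 1%E & forall gam, E gam ->
    forwardP2 (include gam) n L @[n --> \oo] --> (pt010 : P2 R)].
Proof.
move=> L1; have [mI PI] := in_support_full Ppow.
case: (P2_caseU L1) => [[z ->]|[x [y [y0 ->]]]].
  have [r goodG] := compact_good ctau.
  have mT : measurable [set gam | trapped r gam z].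
    by apply: (@measurable_trapped r _ (biseq Y) id (fun=> z)); [exact: measurable_id|
      exact: cmeas_cst|exact: cmeas_cst].
  have mS := measurableI _ _ mI mT.
  exists (inG `&` ~` (inG `&` [set gam | trapped r gam z])); split.
  - by apply: measurableI => //; exact: measurableC.
  - rewrite setIC measure_setI_full//; last exact: measurableC.
    by rewrite (probability_setC P mS) trapped_null// sube0.
  move=> gam [Ig /not_andP[//|/existsNP[n0 /contrapT es]]].
  have [K [e [e0 tK]]] := tame_compact ctau.
  under eq_fun do rewrite forwardP2_embed.
  apply: (@escape_to_pt010 _ K r _ _ n0) => // k; first exact: goodG.
  by apply: tK (Ig k) _; exact: ballxx.
exists setT; split; [exact: measurableT|exact: probability_setT|].
move=> gam _; apply: cvg_near_cst; exists 1%N => // -[//|n _].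
elim: n => [|n ih]; first exact: extend_infinity.
have -> : forwardP2 (include gam) n.+2 (hpoint x y 0) =
  extend (include gam n.+1%:Z) (forwardP2 (include gam) n.+1 (hpoint x y 0)) by [].
by rewrite ih; apply: extend_infinity; rewrite oner_eq0.
Qed.

(** Every point is almost surely not trapped, hence by Fubini almost every
    sequence traps almost no point. *)
Theorem forward_null : exists E : set (biseq Y), [/\ measurable E, P E = 1%E &
  forall gam, E gam -> closed (Kplus (include gam)) /\
    Leb4 (Kplus (include gam)) = 0%E].
Proof.
have [mI PI] := in_support_full Ppow.
have [r goodG] := compact_good ctau.
pose W : set (biseq Y * T4) :=
  [set x | inG x.1 /\ trapped r x.1 (c2_of_r4 x.2)].
have mW : measurable W.
  have [c1 c2] := @cmeas_c2_of_r4 R.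
  apply: (@measurableI _ _ (fst @^-1` inG)).
    by have := @measurable_fst _ _ (biseq Y) T4 measurableT _ mI; rewrite setTI.
  have comp (f : T4 -> C) : cmeas f -> cmeas (fun x : biseq Y * T4 => f x.2).
    by move=> [f1 f2]; split; [exact: (measurableT_comp f1 measurable_snd)|
      exact: (measurableT_comp f2 measurable_snd)].
  apply: measurable_trapped; first exact: measurable_fst.
    exact: comp c1.
  exact: comp c2.
have PW : (\int[P]_gam lam4 (xsection W gam) = 0)%E.
  have fub : (P \x lam4)%E W = (P \x^ lam4)%E W.
    apply: (product_measure_unique (m1 := P) (m2 := lam4)) mW => B D mB mD.
    exact: product_measure2E.
  transitivity ((P \x lam4)%E W); first by [].
  rewrite fub; transitivity (\int[lam4]_t (P (ysection W t)))%E; first by [].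
  rewrite integral0_eq // => t _; rewrite -(trapped_null goodG (c2_of_r4 t)).
  by congr (P _); apply/seteqP; split=> gam /=; rewrite /ysection/= inE.
have mf : measurable_fun setT (fun gam => lam4 (xsection W gam)).
  exact: measurable_fun_xsection.
pose E := inG `&` [set gam | lam4 (xsection W gam) = 0%E].
have mE0 : measurable [set gam | lam4 (xsection W gam) = 0%E].
  by have := mf measurableT _ (emeasurable_set1 0%E); rewrite setTI.
have ae0 : P (~` [set gam | lam4 (xsection W gam) = 0%E]) = 0%E.
  have : (\int[P]_gam `|lam4 (xsection W gam)| = 0)%E.
    by rewrite -PW; apply: eq_integral => gam _; rewrite gee0_abs.
  move=> /(ae_eq_integral_abs P measurableT mf)[B [mB B0 sub]].
  apply/eqP; rewrite eq_le measure_ge0 andbT -[leRHS]B0.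
  apply: le_measure; [exact: mem_set (measurableC mE0)|exact: mem_set mB|].
  by move=> gam n0; apply: sub => /= /(_ I).
exists E; split; first exact: measurableI.
  rewrite /E setIC measure_setI_full//.
  have := probability_setC P (measurableC mE0); rewrite setCK ae0 sube0.
  exact.
move=> gam [Ig v0].
have gr k : good r (positive_part gam k) by exact: goodG.
rewrite (Kplus_trapped gr).
have K0 : Leb4 (trapped r gam) = 0%E.
  rewrite Leb4E -v0; congr (lam4 _); apply/seteqP; split=> t.
    by move=> h; rewrite /xsection/= inE.
  by rewrite /xsection/= inE => -[].
by split; [exact: closed_trapped|exact: K0].
Qed.

End ForwardTheorem.

(** * Backward orbits *)
Section TimeReversal.
Context {R : realType}.
Local Notation C := R[i].
Local Notation Y := (Xplus1 R).
Local Notation T1 := (measurableTypeR R).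
Local Notation T2 := (T1 * T1)%type.
Local Notation T4 := (T2 * T2)%type.
Implicit Types (z w : C * C) (g : Y) (tau : probability (borel Y) R).

Lemma flip_embedding : closed_embedding (@flip R).
Proof.
split; first exact: continuous_flip.
  have -> : range (@flip R) = setT; last exact: closedT.
  by apply/seteqP; split=> // g _; exists (flip g) => //; exact: flipK.
move=> U oU; exists (flip @^-1` U).
  by apply: open_comp => // g _; exact: continuous_flip.
by apply/seteqP; split=> g; rewrite /preimage/= flipK.
Qed.

(** The inverse maps, conjugated by the exchange of coordinates, in the order
    in which the backward orbit applies them. *)
Definition reverse (gam : biseq Y) : biseq Y := fun i => flip (gam (- (i + 1))).

Lemma measurable_reverse : measurable_fun setT reverse.
Proof.
apply: measurable_biseq => i.
exact: (measurableT_comp (closed_embedding_measurable flip_embedding)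
  (@measurable_biseq_coord Y (- (i + 1)))).
Qed.

Definition reverse_law (P : probability (biseq Y) R) : probability (biseq Y) R :=
  distribution P (mfun_Sub (mem_set measurable_reverse)).

(** The reversal of time i |-> - (i + 1) permutes the coordinates. *)
Lemma power_reverse tau P : is_power tau P ->
  is_power (push flip_embedding tau) (reverse_law P).
Proof.
move=> Ppow s A us mA.
pose op (i : int) : int := - (i + 1).
have opK : involutive op by move=> i; rewrite /op opprD opprK addrK.
pose B i : set (borel Y) := flip @^-1` (A (op i)).
have mB i : measurable (B i).
  have := closed_embedding_measurable flip_embedding measurableT (mA (op i)).
  by rewrite setTI.
have us' : uniq (map op s) by rewrite map_inj_uniq//; exact: inv_inj.
have := Ppow _ B us' mB.
have -> : [set gam | forall i, i \in map op s -> B i (gam i)] =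
    reverse @^-1` [set gam | forall i, i \in s -> A i (gam i)].
  apply/seteqP; split=> gam h i.
    by move=> is_; have := h (op i) (map_f op is_); rewrite /B /preimage/= opK.
  by move=> /mapP[j js ->]; rewrite /B /preimage/= opK; exact: h.
rewrite big_map => h; apply: etrans h _.
by apply: eq_bigr => i _; rewrite /B opK.
Qed.

Lemma backward_reverse (gam : biseq Y) n z :
  backward (include gam) n z = swap (forward (include (reverse gam)) n (swap z)).
Proof.
elim: n => [|n ih]; first by rewrite swapK.
have -> : backward (include gam) n.+1 z =
  henon_inv (include gam (- n.+1%:Z)) (backward (include gam) n z) by [].
have -> : forward (include (reverse gam)) n.+1 (swap z) =
  hen (reverse gam n%:Z) (forward (include (reverse gam)) n (swap z)) by [].
rewrite ih /reverse hen_flip swapK /include.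
by rewrite -PoszD addn1.
Qed.

Lemma Kminus_reverse (gam : biseq Y) :
  Kminus (include gam) = swap @^-1` Kplus (include (reverse gam)).
Proof.
apply/seteqP; split=> z /bounded_C2P[M h]; apply/bounded_C2P; exists M.
  move=> _ [n n1 <-]; rewrite -[forward _ _ _]swapK -backward_reverse.
  by have [h1 h2] := h _ (ex_intro2 _ _ n n1 erefl).
move=> _ [n n1 <-]; rewrite backward_reverse.
by have [h1 h2] := h _ (ex_intro2 _ _ n n1 erefl).
Qed.

Lemma forwardP2_neq_pt100 (gam : biseq Y) n (L : P2 R) : L <> pt100 ->
  forwardP2 (include gam) n L <> pt100.
Proof. by move=> L1; elim: n => //= n ih; exact: act1_neq_pt100. Qed.

Lemma backwardP2_reverse (gam : biseq Y) n (L : P2 R) : L <> pt010 ->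
  backwardP2 (include gam) n L =
  swapP2 (forwardP2 (include (reverse gam)) n (swapP2 L)).
Proof.
move=> L1; have L1' : swapP2 L <> pt100.
  by move=> e; apply: L1; rewrite -(swapP2K L) e swapP2_pt100.
elim: n => [|n ih]; first by rewrite swapP2K.
have -> : backwardP2 (include gam) n.+1 L =
  extend_inv (include gam (- n.+1%:Z)) (backwardP2 (include gam) n L) by [].
have neq := @forwardP2_neq_pt100 (reverse gam) n _ L1'.
rewrite ih /include extend_flip; last first.
  by move=> e; apply: neq; rewrite -[LHS]swapP2K e swapP2_pt010.
by rewrite swapP2K /= /reverse -PoszD addn1.
Qed.

Lemma continuous_swap : continuous (@swap R).
Proof. by move=> z; apply: cvg_C2; [exact: cvg_snd|exact: cvg_fst]. Qed.

Lemma volume_swap (A : set (C * C)) : meas4 A -> Leb4 (swap @^-1` A) = Leb4 A.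
Proof.
move=> mA; rewrite !Leb4E.
pose f (t : T4) : T4 := (t.2, t.1).
have mf : measurable_fun setT f.
  exact: (measurable_fun_pair measurable_snd measurable_fst).
suff : pushforward lam4 (f : T4 -> T4) (c2_of_r4 @^-1` A) = lam4 (c2_of_r4 @^-1` A).
  by [].
apply/esym/product_measure_unique => //= B D mB mD.
rewrite /pushforward.
have -> : f @^-1` (B `*` D) = D `*` B by apply/seteqP; split=> -[t u] [].
by apply: (eq_trans (product_measure1E lam2 lam2 mD mB)); exact: muleC.
Qed.

End TimeReversal.

Theorem theorem1p10 (R : realType) :
  let MS1 : set (M1c R (Xplus1 R)) := [set tau | MS (M1c_incl tau)] in
  [/\ open MS1, dense MS1 &
    forall tau : M1c R (Xplus1 R), MS1 tau ->
      let tauZ := power_measure tau in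
      let emb (gam : int -> Xplus1 R) : int -> Xplus R :=
        fun i => Xplus1_val (gam i) in
      [/\ forall z : P2 R, z <> pt100 ->
            exists E : set (biseq (Xplus1 R)),
              [/\ measurable E, tauZ E = 1%E &
                forall gam, E gam ->
                  forwardP2 (emb gam) n z @[n --> \oo] --> (pt010 : P2 R)],
          forall z : P2 R, z <> pt010 ->
            exists E : set (biseq (Xplus1 R)),
              [/\ measurable E, tauZ E = 1%E &
                forall gam, E gam ->
                  backwardP2 (emb gam) n z @[n --> \oo] --> (pt100 : P2 R)] &
          {ae tauZ, forall gam,
            [/\ Jplus (emb gam) = Kplus (emb gam),
              Jminus (emb gam) = Kminus (emb gam),
              Leb4 (Kplus (emb gam)) = 0%E &
              Leb4 (Kminus (emb gam)) = 0%E]}]].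
Proof.
have MSE : [set tau | MS (M1c_incl tau)] = @bisteerable R.
  by apply/seteqP; split=> tau; case: (MS_bisteerable tau).
move=> MS1; rewrite /MS1 MSE; split.
- exact: open_bisteerable.
- exact: dense_bisteerable.
move=> tau [st stf]; set tauZ := power_measure tau.
have pow : is_power tau tauZ by exact: power_measureP.
have ctau : compact (tsupp tau) by exact: compact_tsupp.
(* The backward orbits are the forward orbits of the reversed sequences. *)
pose tau' := push (@flip_embedding R) tau.
have powr : is_power tau' (reverse_law tauZ) by exact: power_reverse.
have tau'E : tsupp tau' = flip @` tsupp tau by exact: tsupp_push.
have ctau' : compact (tsupp tau').
  rewrite tau'E; apply: continuous_compact => //.
  by apply: continuous_subspaceT; exact: continuous_flip.
have st' : steerable (tsupp tau') by rewrite tau'E.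
have measurable_pull E : measurable E -> measurable (@reverse R @^-1` E).
  by move=> mE; have := @measurable_reverse R measurableT _ mE; rewrite setTI.
split.
- move=> z z1; have [E [mE PE cvgE]] := forward_converges pow ctau st z1.
  by exists E; split=> [||gam /cvgE].
- move=> z z1; have z1' : swapP2 z <> pt100.
    by move=> e; apply: z1; rewrite -(swapP2K z) e swapP2_pt100.
  have [E [mE PE cvgE]] := forward_converges powr ctau' st' z1'.
  exists (@reverse R @^-1` E); split; [exact: measurable_pull|exact: PE|].
  move=> gam /cvgE cv.
  suff : backwardP2 (include gam) n z @[n --> \oo] --> (pt100 : P2 R) by [].
  under eq_fun do rewrite backwardP2_reverse//.
  rewrite -swapP2_pt010; apply: continuous_cvg cv.
  by apply: continuous_isometry; exact: fs_swapP2.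
- have [E [mE PE hE]] := forward_null pow ctau st.
  have [F [mF PF hF]] := forward_null powr ctau' st'.
  have mrF := measurable_pull F mF.
  have PrF : tauZ (@reverse R @^-1` F) = 1%E by exact: PF.
  exists (~` (E `&` @reverse R @^-1` F)); split.
  + by apply: measurableC; exact: measurableI.
  + rewrite (probability_setC tauZ (measurableI _ _ mE mrF)).
    by rewrite (measure_setI_full mE mrF PrF) PE subee.
  move=> gam ngam [Egam Fgam]; apply: ngam.
  have [cK K0] := hE gam Egam.
  have [cK' K0'] := hF (reverse gam) Fgam.
  have cm : closed (Kminus (include gam)).
    rewrite Kminus_reverse; apply: preimage_closed cK'.
    by move=> z _; exact: continuous_swap.
  have m0 : Leb4 (Kminus (include gam)) = 0%E.
    rewrite Kminus_reverse volume_swap ?K0'//.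
    have mK : meas4 (~` ~` Kplus (include (reverse gam))).
      by apply: measurableC; apply: meas4_open; exact: closed_openC.
    by rewrite setCK in mK.
  split; [ | | exact: K0 | exact: m0].
  + exact: null_closed_frontier cK K0.
  + exact: null_closed_frontier cm m0.
Qed.
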